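(* Let $G$ be a discrete group, $\mathcal{C}=\{M_a:a\in c_0(G)\}\subseteq\mathcal{B}(\ell^2(G))$ the C*-algebra of multiplication operators by functions in $c_0(G)$, $\alpha$ the action of $G$ on $\mathcal{C}$ by left translations, and $\mathcal{K}$ the C*-algebra of compact operators on $\ell^2(G)$. Let $F:G\to\mathrm{CB}(\mathcal{C})$. The following are equivalent: (i) $F$ is a completely compact Herz-Schur $(\mathcal{C},G,\alpha)$-multiplier; (ii) there exists $u\in\mathcal{K}\otimes_{\rm h}\mathcal{K}$ such that $\Gamma_{u_s}(a)=F(s)(a)$ for all $a\in\mathcal{C}$ and $s\in G$.
   Context: For $a\in c_0(G)$, $(M_a\xi)(s)=a(s)\xi(s)$, $\xi\in\ell^2(G)$. The action is $\alpha_t(M_a)=M_{\alpha_t(a)}$ with $\alpha_t(a)(s)=a(t^{-1}s)$. $\lambda^0$ is the left regular representation of $G$ on $\ell^2(G)$. The Haagerup tensor product $\mathcal{K}\otimes_{\rm h}\mathcal{K}$ consists of (convergent) series $u=\sum_{i=1}^\infty a_i\otimes b_i$ with $a_i,b_i\in\mathcal{K}$ such that $\sum_ia_ia_i^*$ and $\sum_ib_i^*b_i$ converge in norm. Each such $u$ gives a completely bounded map $\Gamma_u(x)=\sum_{i=1}^\infty a_ixb_i$ on $\mathcal{B}(\ell^2(G))$. For $s\in G$, $u_s=\sum_{i=1}^\infty a_i\otimes\lambda_s^0b_i\lambda_{s^{-1}}^0\in\mathcal{K}\otimes_{\rm h}\mathcal{K}$. For a C*-dynamical system $(A,G,\alpha)$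 with $A\subseteq\mathcal{B}(H)$ non-degenerate, on $\mathcal{H}=\ell^2(G,H)$ put $(\lambda_t\xi)(s)=\xi(t^{-1}s)$ and $(\pi(a)\xi)(s)=\alpha_{s^{-1}}(a)(\xi(s))$. For $f\in\ell^1(G,A)$ let $\tilde\pi(f)=\sum_{s\in G}\pi(f(s))\lambda_s$; the reduced crossed product $A\rtimes_{\alpha,r}G$ is the norm closure of $\tilde\pi(\ell^1(G,A))$. A bounded map $F:G\to\mathrm{CB}(A)$ is a Herz-Schur $(A,G,\alpha)$-multiplier if the map $S_F:\tilde\pi(f)\mapsto\tilde\pi(F\cdot f)$, where $(F\cdot f)(t)=F(t)(f(t))$, is completely bounded (and $S_F$ also denotes its extension to $A\rtimes_{\alpha,r}G$); it is completely compact if $S_F$ is completely compact. A completely bounded map $\Psi:\mathcal{X}\to\mathcal{Z}$ between operator spaces is completely compact if for every $\epsilon>0$ there is a finite dimensional subspace $\mathcal{Y}\subseteq\mathcal{Z}$ such that $\mathrm{dist}(\Psi^{(m)}(x),M_m(\mathcal{Y}))<\epsilon$ for all $m\in\mathbb{N}$ and all $x\in M_m(\mathcal{X})$ with $\|x\|\le1$. *)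

(* Defs.v *)
From HB Require Import structures.
From mathcomp Require Import all_boot all_order all_algebra.
From mathcomp Require Import finmap complex.
From mathcomp Require Import all_classical all_reals.
From mathcomp Require Import ereal topology normedtype sequences esum.
From mathcomp Require analysis.showcase.summability.
From mathcomp Require Import ring lra.

Set Implicit Arguments.
Unset Strict Implicit.
Unset Printing Implicit Defensive.

Import Order.TTheory GRing.Theory Num.Theory.
Import numFieldNormedType.Exports.

Local Open Scope classical_set_scope.
Local Open Scope ring_scope.

Section RealNorm.
Variables (R : realType) (V : normedModType R[i]).
Implicit Types x y : V.

(* In a normedModType over R[i] the library norm `|x| is a nonnegative element
   of R[i]; nrm x is the same number read in R. *)
Definition nrm x : R := complex.Re `|x|.

Lemma nrmE x : (nrm x)%:C%C = `|x|.
Proof. by rewrite /nrm RRe_real// normr_real. Qed.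

Lemma nrm_ge0 x : 0 <= nrm x.
Proof. by rewrite -ler0c nrmE. Qed.

Lemma nrmD x y : nrm (x + y) <= nrm x + nrm y.
Proof. by rewrite -lecR rmorphD /= !nrmE ler_normD. Qed.

Lemma nrmZ (a : R[i]) x : nrm (a *: x) = Normc.normc a * nrm x.
Proof. by apply: (@complexI R); rewrite rmorphM /= !nrmE normrZ. Qed.

Lemma nrm0 : nrm 0 = 0.
Proof. by rewrite /nrm normr0. Qed.

Lemma nrm0_eq0 x : nrm x = 0 -> x = 0.
Proof. by move=> x0; apply/normr0_eq0; rewrite -nrmE x0. Qed.

Lemma nrmN x : nrm (- x) = nrm x.
Proof. by rewrite /nrm normrN. Qed.

End RealNorm.


Lemma ge0_esumZl (R : realType) (I : choiceType) (D : set I) (f : I -> \bar R)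
    (c : R) : (forall i, 0 <= f i)%E -> 0 <= c ->
  (\esum_(i in D) (c%:E * f i) = c%:E * \esum_(i in D) f i)%E.
Proof.
move=> f0 c0; rewrite /esum -ereal_supZl//; last first.
  apply/set0P; exists (\sum_(i \in set0) f i)%E; exists set0 => //.
  exact: fsets_set0.
congr ereal_sup; apply/seteqP; split => x /=.
  move=> [A [finA AD] <-]; exists (\sum_(i \in A) f i)%E; first by exists A.
  by rewrite ge0_mule_fsumr.
move=> [_ [A [finA AD] <-] <-]; exists A => //.
by rewrite ge0_mule_fsumr.
Qed.

Section Ell2.
Variables (R : realType) (I : choiceType) (V : normedModType R[i]).
Implicit Types f g : I -> V.

Definition sqsum f : \bar R := (\esum_(i in [set: I]) (nrm (f i) ^+ 2)%:E)%E.

Definition square_summable : {pred I -> V} := fun f => (sqsum f < +oo)%E.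

Lemma sqsum_ge0 f : (0 <= sqsum f)%E.
Proof. by apply: esum_ge0 => i _; rewrite lee_fin sqr_ge0. Qed.

Lemma sqsum_fin f : f \in square_summable -> sqsum f = (fine (sqsum f))%:E.
Proof. by move=> ff; rewrite fineK// ge0_fin_numE// sqsum_ge0. Qed.

Lemma sqsumZ (a : R[i]) f :
  sqsum (a *: f) = ((Normc.normc a ^+ 2)%:E * sqsum f)%E.
Proof.
rewrite /sqsum -ge0_esumZl ?sqr_ge0//.
  by apply: eq_esum => i _; rewrite nrmZ exprMn EFinM.
by move=> i; rewrite lee_fin sqr_ge0.
Qed.

Lemma sqsum0 : sqsum 0 = 0%E.
Proof. by apply: esum1 => i _; rewrite nrm0 expr0n. Qed.

Lemma sqsum_ge f i : ((nrm (f i) ^+ 2)%:E <= sqsum f)%E.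
Proof.
apply: esum_ge; exists [set i]; first by split.
by rewrite fsbig_set1.
Qed.

Lemma sqsum0_eq0 f : sqsum f = 0%E -> f = 0.
Proof.
move=> f0; apply/funext => i; apply: nrm0_eq0; apply/eqP.
rewrite -sqrf_eq0 eq_le sqr_ge0 andbT.
by have := sqsum_ge f i; rewrite f0 lee_fin.
Qed.

Lemma sqsum_minkowski f g (a b : R) : 0 <= a -> 0 <= b ->
  (sqsum f <= (a ^+ 2)%:E)%E -> (sqsum g <= (b ^+ 2)%:E)%E ->
  (sqsum (f + g)%R <= ((a + b) ^+ 2)%:E)%E.
Proof.
move=> a0 b0 fa gb.
have [a00|an0] := eqVneq a 0.
  have -> : f = 0.
    apply: sqsum0_eq0; apply/eqP; rewrite eq_le sqsum_ge0 andbT.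
    by rewrite (le_trans fa)// a00 expr0n.
  by rewrite add0r a00 add0r.
have [b00|bn0] := eqVneq b 0.
  have -> : g = 0.
    apply: sqsum0_eq0; apply/eqP; rewrite eq_le sqsum_ge0 andbT.
    by rewrite (le_trans gb)// b00 expr0n.
  by rewrite addr0 b00 addr0.
have {an0}a0 : 0 < a by rewrite lt_neqAle eq_sym an0.
have {bn0}b0 : 0 < b by rewrite lt_neqAle eq_sym bn0.
have c1 : 0 <= 1 + b / a by rewrite addr_ge0// divr_ge0// ltW.
have c2 : 0 <= 1 + a / b by rewrite addr_ge0// divr_ge0// ltW.
have -> : (a + b) ^+ 2 = (1 + b / a) * a ^+ 2 + (1 + a / b) * b ^+ 2.
  by field; rewrite !gt_eqF.
rewrite EFinD (EFinM (1 + b / a)) (EFinM (1 + a / b)).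
apply: (@le_trans _ _ ((1 + b / a)%:E * sqsum f + (1 + a / b)%:E * sqsum g)%E).
  rewrite /sqsum -!ge0_esumZl//; try by move=> i; rewrite lee_fin sqr_ge0.
  rewrite -esumD; try by move=> i _; rewrite mule_ge0// lee_fin// sqr_ge0.
  apply: le_esum => i _; rewrite -!EFinM -EFinD lee_fin.
  set x := nrm (f i); set y := nrm (g i).
  apply: (@le_trans _ _ ((x + y) ^+ 2)).
    by rewrite ler_sqr ?nnegrE ?addr_ge0 ?nrm_ge0// nrmD.
  rewrite -subr_ge0.
  have -> : (1 + b / a) * x ^+ 2 + (1 + a / b) * y ^+ 2 - (x + y) ^+ 2
      = (b * x - a * y) ^+ 2 / (a * b).
    by field; rewrite !gt_eqF.
  by rewrite divr_ge0 ?sqr_ge0// mulr_ge0// ltW.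
by apply: leeD; apply: lee_pmul; rewrite ?sqsum_ge0// lee_fin.
Qed.

Lemma square_summable_submod : submod_closed square_summable.
Proof.
split; first by rewrite unfold_in sqsum0.
move=> a f g fS gS.
have aS : a *: f \in square_summable.
  by rewrite unfold_in sqsumZ (sqsum_fin fS) -EFinM ltry.
rewrite unfold_in.
apply: le_lt_trans (ltry ((Num.sqrt (fine (sqsum (a *: f))) +
  Num.sqrt (fine (sqsum g))) ^+ 2)).
apply: sqsum_minkowski; rewrite ?sqrtr_ge0//.
  by rewrite sqr_sqrtr ?fine_ge0 ?sqsum_ge0// -sqsum_fin.
by rewrite sqr_sqrtr ?fine_ge0 ?sqsum_ge0// -sqsum_fin.
Qed.

HB.instance Definition _ :=
  GRing.isSubmodClosed.Build R[i] (I -> V) square_summable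
    square_summable_submod.

Record ell2 := Ell2 { ell2_fun :> I -> V; _ : ell2_fun \in square_summable }.

HB.instance Definition _ := [isSub for ell2_fun].
HB.instance Definition _ := [Choice of ell2 by <:].
HB.instance Definition _ := [SubChoice_isSubLmodule of ell2 by <:].

Implicit Types xi eta : ell2.

Definition ell2_norm xi : R := Num.sqrt (fine (sqsum xi)).

Lemma ell2P xi : (xi : I -> V) \in square_summable.
Proof. exact: valP. Qed.

Lemma ell2_norm_sq xi : sqsum xi = (ell2_norm xi ^+ 2)%:E.
Proof. by rewrite /ell2_norm sqr_sqrtr ?fine_ge0 ?sqsum_ge0 -?sqsum_fin// ell2P. Qed.

Lemma ell2_norm_le xi (c : R) : 0 <= c ->
  (ell2_norm xi <= c) = (sqsum xi <= (c ^+ 2)%:E)%E.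
Proof.
move=> c0; rewrite ell2_norm_sq lee_fin ler_sqr ?nnegrE//.
exact: sqrtr_ge0.
Qed.

Let normD xi eta :
  (ell2_norm (xi + eta))%:C%C <= (ell2_norm xi)%:C%C + (ell2_norm eta)%:C%C.
Proof.
rewrite -rmorphD lecR /= ell2_norm_le ?addr_ge0 ?sqrtr_ge0//.
by apply: sqsum_minkowski; rewrite ?sqrtr_ge0// -ell2_norm_sq.
Qed.

Let normZ (a : R[i]) xi :
  (ell2_norm (a *: xi))%:C%C = `|a| * (ell2_norm xi)%:C%C.
Proof.
have -> : `|a| = (Normc.normc a)%:C%C by [].
rewrite -rmorphM /=; congr (_ %:C)%C.
rewrite /ell2_norm /= sqsumZ (sqsum_fin (ell2P xi)) -EFinM /=.
rewrite sqrtrM ?sqr_ge0// sqrtr_sqr ger0_norm//.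
by rewrite -ler0c; exact: (normr_ge0 a).
Qed.

Let norm0_eq0 xi : (ell2_norm xi)%:C%C = 0 :> R[i] -> xi = 0.
Proof.
move=> /(congr1 (@complex.Re _)) /= x0; apply: val_inj => /=.
by apply: sqsum0_eq0; rewrite ell2_norm_sq x0 expr0n.
Qed.

HB.instance Definition _ :=
  Lmodule_isNormed.Build R[i] ell2 normD normZ norm0_eq0.

Lemma nrm_ell2 xi : nrm xi = Num.sqrt (fine (sqsum xi)).
Proof. by []. Qed.

End Ell2.

Arguments square_summable {R} I V.


Section BoundedOperators.
Variables (R : realType) (H K : normedModType R[i]).

Definition bounded_linear : {pred H -> K} := fun T =>
  `[< linear T /\ exists c : R, forall x, nrm (T x) <= c * nrm x >].

Lemma bounded_linear_submod : submod_closed bounded_linear.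
Proof.
split.
  apply/asboolP; split; first by move=> a x y; rewrite /= scaler0 addr0.
  by exists 0 => x; rewrite /= nrm0 mul0r.
move=> a S T /asboolP[linS [c Sc]] /asboolP[linT [d Td]]; apply/asboolP; split.
  move=> b x y; rewrite !fctE linS linT.
  by rewrite !scalerDr !scalerA [b * a]mulrC addrACA.
exists (Normc.normc a * c + d) => x; rewrite fctE (le_trans (nrmD _ _))//.
rewrite mulrDl lerD// nrmZ -mulrA ler_wpM2l//.
by rewrite -ler0c; exact: (normr_ge0 a).
Qed.

HB.instance Definition _ :=
  GRing.isSubmodClosed.Build R[i] (H -> K) bounded_linear
    bounded_linear_submod.

Record bop := Bop { bop_fun :> H -> K; _ : bop_fun \in bounded_linear }.

HB.instance Definition _ := [isSub for bop_fun].
HB.instance Definition _ := [Choice of bop by <:].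
HB.instance Definition _ := [SubChoice_isSubLmodule of bop by <:].

Implicit Types S T : bop.

Definition opnorm T : R := sup [set nrm (T x) | x in [set x | nrm x <= 1]].

Lemma bopP T : linear T /\ exists c : R, forall x, nrm (T x) <= c * nrm x.
Proof. by apply/asboolP; exact: (valP T). Qed.

HB.instance Definition _ T := GRing.isLinear.Build R[i] H K *:%R T (bopP T).1.

Lemma opnorm_has_sup T :
  has_sup [set nrm (T x) | x in [set x | nrm x <= 1]].
Proof.
split; first by exists (nrm (T 0)); exists 0 => //=; rewrite nrm0 ler01.
have [_ [c Tc]] := bopP T; exists `|c| => _ [x /= x1 <-].
rewrite (le_trans (Tc x))// (le_trans (ler_wpM2r (nrm_ge0 x) (ler_norm c)))//.
by rewrite ler_piMr.
Qed.

Lemma opnorm_ub T x : nrm x <= 1 -> nrm (T x) <= opnorm T.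
Proof.
move=> x1; apply: (ub_le_sup (opnorm_has_sup T).2).
by exists x.
Qed.

Lemma opnorm_ge0 T : 0 <= opnorm T.
Proof. by rewrite (le_trans (nrm_ge0 (T 0)))// opnorm_ub// nrm0 ler01. Qed.

Lemma opnorm_bound T x : nrm (T x) <= opnorm T * nrm x.
Proof.
have [->|x0] := eqVneq x 0; first by rewrite linear0 !nrm0 mulr0.
have n0 : 0 < nrm x.
  rewrite lt_neqAle nrm_ge0 andbT eq_sym; apply: contra_neq x0.
  exact: nrm0_eq0.
have nc : Normc.normc ((nrm x)^-1)%:C%C = (nrm x)^-1.
  by rewrite /= expr0n addr0 sqrtr_sqr ger0_norm// invr_ge0 ltW.
have := @opnorm_ub T (((nrm x)^-1)%:C%C *: x).
rewrite linearZ /= !nrmZ nc mulVf ?gt_eqF// => /(_ (lexx _)).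
by rewrite ler_pdivrMl// mulrC.
Qed.

Lemma opnorm_le T (c : R) : 0 <= c ->
  (forall x, nrm (T x) <= c * nrm x) -> opnorm T <= c.
Proof.
move=> c0 Tc; apply: ge_sup; first exact: (opnorm_has_sup T).1.
by move=> _ [x /= x1 <-]; rewrite (le_trans (Tc x))// ler_piMr.
Qed.

Let normD S T : (opnorm (S + T))%:C%C <= (opnorm S)%:C%C + (opnorm T)%:C%C.
Proof.
rewrite -rmorphD lecR /=; apply: opnorm_le; rewrite ?addr_ge0 ?opnorm_ge0//.
move=> x; rewrite (le_trans (nrmD (S x) (T x)))// mulrDl.
by rewrite lerD ?opnorm_bound.
Qed.

Let opnormZ_le (a : R[i]) T : opnorm (a *: T) <= Normc.normc a * opnorm T.
Proof.
have a0 : 0 <= Normc.normc a by rewrite -ler0c; exact: (normr_ge0 a).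
apply: opnorm_le; first by rewrite mulr_ge0 ?opnorm_ge0.
by move=> x; rewrite [X in nrm X]/(a *: T x) nrmZ -mulrA ler_wpM2l// opnorm_bound.
Qed.

Let normZ (a : R[i]) T : (opnorm (a *: T))%:C%C = `|a| * (opnorm T)%:C%C.
Proof.
have -> : `|a| = (Normc.normc a)%:C%C by [].
rewrite -rmorphM /=; congr (_ %:C)%C; apply/eqP; rewrite eq_le opnormZ_le/=.
have [->|a0] := eqVneq a 0.
  by rewrite [Normc.normc 0]Normc.normc0 mul0r opnorm_ge0.
have na0 : 0 < Normc.normc a.
  by rewrite -ltcR; change (0 < `|a|); rewrite normr_gt0.
have := opnormZ_le a^-1 (a *: T).
by rewrite scalerA mulVf// scale1r Normc.normcV -ler_pdivrMl ?invr_gt0// invrK.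
Qed.

Let norm0_eq0 T : (opnorm T)%:C%C = 0 :> R[i] -> T = 0.
Proof.
move=> /(congr1 (@complex.Re _)) /= T0; apply: val_inj; apply/funext => x /=.
apply: nrm0_eq0; apply/eqP; rewrite eq_le nrm_ge0 andbT.
by have := opnorm_bound T x; rewrite T0 mul0r.
Qed.

HB.instance Definition _ :=
  Lmodule_isNormed.Build R[i] bop normD normZ norm0_eq0.

Lemma nrm_bop T : nrm T = opnorm T.
Proof. by []. Qed.

End BoundedOperators.

Arguments bounded_linear {R} H K.

Section Composition.
Variables (R : realType) (H K L : normedModType R[i]).

Lemma bop_comp_subproof (S : bop K L) (T : bop H K) :
  (S \o T : H -> L) \in bounded_linear H L.
Proof.
apply/asboolP; split; first by move=> a x y /=; rewrite !linearP.
exists (opnorm S * opnorm T) => x /=.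
by rewrite (le_trans (opnorm_bound S _))// -mulrA ler_wpM2l ?opnorm_ge0 ?opnorm_bound.
Qed.

Definition bop_comp (S : bop K L) (T : bop H K) : bop H L :=
  Bop (bop_comp_subproof S T).

End Composition.

Notation "S \oB T" := (bop_comp S T) (at level 40, left associativity).

Section Ell2Operators.
Variables (R : realType) (I J : choiceType) (V W : normedModType R[i]).

(* The bounded operator that acts on the underlying functions by phi. The two
   insubd default to 0 when phi does not map square-summable functions to
   square-summable ones, or is not linear and bounded; see ell2_opE. *)
Definition ell2_op (phi : (I -> V) -> J -> W) : bop (ell2 I V) (ell2 J W) :=
  insubd (0 : bop (ell2 I V) (ell2 J W))
    (fun xi : ell2 I V => insubd (0 : ell2 J W) (phi xi)).

Lemma ell2_opE (phi : (I -> V) -> J -> W) (c : R) : 0 <= c ->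
    (forall (a : R[i]) (xi eta : ell2 I V) j,
      phi (a *: (xi : I -> V) + (eta : I -> V)) j
        = a *: phi xi j + phi eta j) ->
    (forall xi : ell2 I V, sqsum (phi xi) <= (c ^+ 2)%:E * sqsum xi)%E ->
  forall (xi : ell2 I V) j, ell2_op phi xi j = phi xi j.
Proof.
move=> c0 lin bnd.
have ss (xi : ell2 I V) : phi xi \in square_summable J W.
  rewrite unfold_in (le_lt_trans (bnd xi))// (sqsum_fin (ell2P xi)) -EFinM.
  exact: ltry.
have vE (xi : ell2 I V) : (insubd (0 : ell2 J W) (phi xi) : J -> W) = phi xi.
  by rewrite -[LHS]/(val _) insubdK.
have bl : (fun xi : ell2 I V => insubd (0 : ell2 J W) (phi xi)) \in
    bounded_linear (ell2 I V) (ell2 J W).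
  apply/asboolP; split.
    move=> a xi eta; apply: val_inj; apply/funext => j.
    rewrite [LHS](congr1 (fun f => f j) (vE _)).
    transitivity (a *: phi xi j + phi eta j); first exact: lin.
    symmetry; transitivity (a *: (insubd (0 : ell2 J W) (phi xi) : J -> W) j +
      (insubd (0 : ell2 J W) (phi eta) : J -> W) j); first by [].
    by rewrite (vE xi) (vE eta).
  exists c => xi; rewrite [X in X <= _]/(ell2_norm _) ell2_norm_le.
    by rewrite vE exprMn EFinM -ell2_norm_sq.
  by rewrite mulr_ge0// nrm_ge0.
move=> xi j.
have -> : ell2_op phi xi = insubd (0 : ell2 J W) (phi xi).
  by rewrite -[ell2_op phi xi]/(val (ell2_op phi) xi) insubdK.
by rewrite vE.
Qed.

End Ell2Operators.

Section Translations.
Variables (R : realType) (G : groupType) (V : normedModType R[i]).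

Definition lambda (t : G) : bop (ell2 G V) (ell2 G V) :=
  ell2_op (fun xi s => xi (t^-1 * s)%g).

Lemma lambdaE (t : G) (xi : ell2 G V) s : lambda t xi s = xi (t^-1 * s)%g.
Proof.
apply: (@ell2_opE R G G V V _ 1) => //= eta.
rewrite expr1n mul1e /sqsum.
have bij : set_bij [set: G] [set: G] (fun s : G => (t^-1 * s)%g).
  split => //; first by move=> x y _ _; exact: mulgI.
  by move=> x _; exists (t * x)%g => //; rewrite mulKg.
by rewrite (@reindex_esum R G G setT setT _
  (fun s => (nrm (eta s) ^+ 2)%:E) bij).
Qed.

End Translations.

Notation B_ell2 R G := (bop (ell2 G R[i]^o) (ell2 G R[i]^o)).

Section Multiplications.
Variables (R : realType) (G : groupType).
Implicit Types (a b : G -> R[i]) (s t : G).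

Notation B := (B_ell2 R G).

Definition mulop a : B := ell2_op (fun xi s => a s *: xi s).

Definition c0 : set (G -> R[i]) :=
  [set a | forall e : R[i], 0 < e -> finite_set [set s | e <= `|a s|]].

Definition ltrans t a : G -> R[i] := fun s => a (t^-1 * s)%g.

Definition c0_mulops : set B := mulop @` c0.

(* The action on operators recovers the symbol a of M_a, which is unique by
   mulop_inj; c0_actE gives the defining equation of the action. *)
Definition c0_symbol (x : B) : G -> R[i] := xget 0 [set a | c0 a /\ mulop a = x].

Definition c0_act t (x : B) : B := mulop (ltrans t (c0_symbol x)).

Lemma c0_bounded a : c0 a -> exists2 c : R, 0 <= c & forall s, Normc.normc (a s) <= c.
Proof.
move=> /(_ 1 ltr01) fin.
pose A := fset_set [set s | 1 <= `|a s|].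
exists (1 + \sum_(s <- A) Normc.normc (a s)).
  rewrite addr_ge0// sumr_ge0// => s _.
  by rewrite -ler0c; exact: (normr_ge0 (a s)).
have n0 s : 0 <= Normc.normc (a s) by rewrite -ler0c; exact: (normr_ge0 (a s)).
move=> s; have [sA|sA] := boolP (s \in A).
  rewrite (big_fsetD1 s)//= addrCA lerDl addr_ge0// sumr_ge0//.
rewrite (@le_trans _ _ 1)//; last by rewrite lerDl sumr_ge0.
move: sA; rewrite in_fset_set// notin_setE /= => /negP.
have -> : (1 <= `|a s|) = (1 <= Normc.normc (a s)) by rewrite -lecR.
by rewrite -ltNge => /ltW.
Qed.

Lemma mulopE a (xi : ell2 G R[i]^o) s : c0 a -> mulop a xi s = a s * xi s.
Proof.
move=> /c0_bounded [c c_ge0 ac].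
apply: (@ell2_opE R G G R[i]^o R[i]^o _ c) => //= [k x y j|x].
  by rewrite scalerDr !scalerA mulrC.
rewrite /sqsum -ge0_esumZl ?sqr_ge0//; last by move=> i; rewrite lee_fin sqr_ge0.
apply: le_esum => i _; rewrite -EFinM lee_fin nrmZ exprMn ler_wpM2r ?sqr_ge0//.
rewrite ler_sqr ?nnegrE// -ler0c; exact: (normr_ge0 (a i)).
Qed.

Lemma delta_subproof s :
  (fun t => (t == s)%:R : R[i]^o) \in square_summable G R[i]^o.
Proof.
rewrite unfold_in /sqsum.
rewrite (_ : esum _ _ = \esum_(i in [set s]) 1%:E)%E; last first.
  rewrite [RHS]esum_mkcond; apply: eq_esum => t _.
  have [->|ts] := eqVneq t s.
    by rewrite mem_set// /nrm normr1 /= expr1n.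
  rewrite memNset; last by move=> /= ?; move/eqP: ts.
  by rewrite /nrm normr0 expr0n.
by rewrite esum_set1// ltry.
Qed.

Definition delta s : ell2 G R[i]^o := Ell2 (delta_subproof s).

Lemma mulop_inj a b : c0 a -> c0 b -> mulop a = mulop b -> a = b.
Proof.
move=> ca cb ab; apply/funext => s.
have ds : delta s s = 1 by rewrite /= eqxx.
have h1 := mulopE (delta s) s ca.
have h2 := mulopE (delta s) s cb.
rewrite ds mulr1 in h1.
rewrite ds mulr1 in h2.
rewrite -h1.
rewrite -h2.
rewrite ab.
by [].
Qed.

Lemma c0_actE t a : c0 a -> c0_act t (mulop a) = mulop (ltrans t a).
Proof.
move=> ca; rewrite /c0_act; congr (mulop (ltrans t _)).
rewrite /c0_symbol; case: xgetP => [b _ [cb]|/(_ a)]; first exact: mulop_inj.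
by case; split.
Qed.

Lemma ltrans_c0 t a : c0 a -> c0 (ltrans t a).
Proof.
move=> ca e e0; have := finite_image (fun s => (t * s)%g) (ca e e0).
apply: sub_finite_set => s /= es; exists (t^-1 * s)%g => //.
by rewrite mulVKg.
Qed.

Lemma c0_act_bounded (x : B) : c0_mulops x ->
  exists c : R, forall s, opnorm (c0_act s x) <= c.
Proof.
move=> [a ca <-]; have [c c_ge0 ac] := c0_bounded ca.
exists c => s; rewrite c0_actE//; apply: opnorm_le => // xi.
rewrite [X in X <= _]/(ell2_norm _) ell2_norm_le; last first.
  by rewrite mulr_ge0// nrm_ge0.
have -> : nrm xi = ell2_norm xi by exact: nrm_ell2.
rewrite exprMn EFinM -ell2_norm_sq /sqsum -ge0_esumZl ?sqr_ge0//; last first.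
  by move=> i; rewrite lee_fin sqr_ge0.
apply: le_esum => t _; rewrite mulopE; last exact: ltrans_c0.
rewrite -EFinM lee_fin [nrm _]nrmZ exprMn ler_wpM2r ?sqr_ge0//.
rewrite ler_sqr ?nnegrE//; first exact: ac.
by rewrite -ler0c; exact: (normr_ge0 (ltrans s a t)).
Qed.

End Multiplications.

Arguments c0_mulops R G : clear implicits.
Arguments c0_act R G : clear implicits.

Section MatrixAmplifications.
Variables (R : realType) (H K : normedModType R[i]).

(* M_m(B(H, K)) acts on H^m = ell2 'I_m H. *)
Definition ampl m (x : 'M[bop H K]_m) : bop (ell2 'I_m H) (ell2 'I_m K) :=
  ell2_op (fun xi i => \sum_(j < m) x i j (xi j)).

Definition mxnorm m (x : 'M[bop H K]_m) : R := opnorm (ampl x).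

Lemma sqsum_ord m (V : normedModType R[i]) (f : 'I_m -> V) :
  sqsum f = (\sum_(i < m) nrm (f i) ^+ 2)%:E.
Proof.
rewrite /sqsum esum_fset; first last.
- by move=> i _; rewrite lee_fin sqr_ge0.
- exact: finite_finset.
rewrite -sumEFin [RHS]bigfs ?index_enum_uniq//; last first.
  by move=> i _; rewrite mem_index_enum.
suff -> : [set: 'I_m] = [set` xpredT] by [].
by apply/seteqP; split.
Qed.

Lemma amplE m (x : 'M[bop H K]_m) (xi : ell2 'I_m H) i :
  ampl x xi i = \sum_(j < m) x i j (xi j).
Proof.
pose r i := \sum_(j < m) opnorm (x i j).
have r0 k : 0 <= r k by apply: sumr_ge0 => j _; exact: opnorm_ge0.
have s0 : 0 <= \sum_(k < m) r k by exact: sumr_ge0.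
apply: (@ell2_opE R 'I_m 'I_m H K _ (\sum_(k < m) r k)) => //.
  move=> a u v k; rewrite scaler_sumr -big_split /=.
  by apply: eq_bigr => j _; rewrite linearP.
move=> u; rewrite ell2_norm_sq sqsum_ord -EFinM lee_fin -exprMn.
have nr k : nrm (\sum_(j < m) x k j (u j)) <= r k * ell2_norm u.
  rewrite /r mulr_suml.
  apply: (@le_trans _ _ (\sum_(j < m) nrm (x k j (u j)))).
    elim/big_ind2: _ => [|y1 y2 z1 z2 h1 h2|//]; first by rewrite nrm0.
    by rewrite (le_trans (nrmD _ _))// lerD.
  apply: ler_sum => j _; rewrite (le_trans (opnorm_bound _ _))//.
  rewrite ler_wpM2l ?opnorm_ge0//.
  rewrite -ler_sqr ?nnegrE ?nrm_ge0 ?sqrtr_ge0// -lee_fin -ell2_norm_sq.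
  exact: sqsum_ge.
apply: (@le_trans _ _ (\sum_(k < m) (r k * ell2_norm u) ^+ 2)).
  apply: ler_sum => k _; rewrite ler_sqr ?nnegrE ?nrm_ge0//.
  by rewrite mulr_ge0// sqrtr_ge0.
under eq_bigr do rewrite exprMn.
rewrite -mulr_suml exprMn ler_wpM2r ?sqr_ge0// expr2 mulr_suml.
apply: ler_sum => k _; rewrite expr2 ler_wpM2l//.
by rewrite (bigD1 k)//= lerDl sumr_ge0.
Qed.

End MatrixAmplifications.

(* Operator spaces are linear subspaces X of some B(H), given as sets; a map
   X -> Z is a function B(H) -> B(K) whose values off X are irrelevant. *)
Section CompletelyBoundedMaps.
Variables (R : realType) (H K : normedModType R[i]).
Implicit Types (X : set (bop H H)) (Y Z : set (bop K K)).
Implicit Types (Psi : bop H H -> bop K K).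

Definition mx_over (L : normedModType R[i]) (X : set (bop L L)) m :
  set 'M[bop L L]_m := [set x | forall i j, X (x i j)].

Definition linear_on X Psi := forall (a : R[i]) x y, X x -> X y ->
  Psi (a *: x + y) = a *: Psi x + Psi y.

(* The completely bounded norm of Psi on X is at most c. *)
Definition cb_bound X Psi (c : R) := forall m (x : 'M[bop H H]_m),
  mx_over X x -> mxnorm (map_mx Psi x) <= c * mxnorm x.

Definition completely_bounded X Z Psi :=
  [/\ forall x, X x -> Z (Psi x), linear_on X Psi & exists c, cb_bound X Psi c].

Definition finite_dim_subspace Y := exists n (y : 'I_n -> bop K K),
  Y = [set \sum_(i < n) a i *: y i | a in [set: 'I_n -> R[i]]].

Definition mxdist Y m (x : 'M[bop K K]_m) : R :=
  inf [set mxnorm (x - y) | y in mx_over Y (m := m)].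

Definition completely_compact X Z Psi := completely_bounded X Z Psi /\
  forall e : R, 0 < e -> exists Y, [/\ finite_dim_subspace Y, Y `<=` Z &
    forall m (x : 'M[bop H H]_m), mx_over X x -> mxnorm x <= 1 ->
      mxdist Y (map_mx Psi x) < e].

End CompletelyBoundedMaps.

(* A C*-dynamical system is given by A, a set of operators on H, and
   alpha : G -> B(H) -> B(H), of which only the restriction to A matters. *)
Section CrossedProduct.
Variables (R : realType) (G : groupType) (H : normedModType R[i]).
Variables (A : set (bop H H)) (alpha : G -> bop H H -> bop H H).
Implicit Types (f : G -> bop H H) (F : G -> bop H H -> bop H H).

Notation B := (bop (ell2 G H) (ell2 G H)).

Definition pi_rep (a : bop H H) : B :=
  ell2_op (fun xi s => alpha s^-1%g a (xi s)).

Lemma pi_repE (a : bop H H) (c : R) : (forall s, opnorm (alpha s a) <= c) ->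
  forall (xi : ell2 G H) s, pi_rep a xi s = alpha s^-1%g a (xi s).
Proof.
move=> ac; have c_ge0 : 0 <= c by rewrite (le_trans _ (ac 1%g))// opnorm_ge0.
apply: (@ell2_opE R G G H H _ c) => // [k x y s|x]; first by rewrite linearP.
rewrite /sqsum -ge0_esumZl ?sqr_ge0//; last by move=> i; rewrite lee_fin sqr_ge0.
apply: le_esum => s _; rewrite -EFinM lee_fin -exprMn.
rewrite ler_sqr ?nnegrE ?mulr_ge0 ?nrm_ge0//.
by rewrite (le_trans (opnorm_bound _ _))// ler_wpM2r ?nrm_ge0.
Qed.

Definition l1 : set (G -> bop H H) := [set f |
  (forall s, A (f s)) /\ (\esum_(s in [set: G]) (opnorm (f s))%:E < +oo)%E].

Definition pi_tilde f : B :=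
  summability.sum (fun s => pi_rep (f s) \oB lambda H s).

Definition crossed_product : set B := closure (pi_tilde @` l1).

Definition pmul F f : G -> bop H H := fun t => F t (f t).

Definition extends_SF F (S : B -> B) :=
  forall f, l1 f -> S (pi_tilde f) = pi_tilde (pmul F f).

Definition herz_schur_multiplier F :=
  (exists c, forall s, cb_bound A (F s) c) /\
  exists S, extends_SF F S /\
    completely_bounded (pi_tilde @` l1) (pi_tilde @` l1) S.

(* The map S of the second conjunct is the continuous extension of S_F to the
   reduced crossed product. *)
Definition cc_herz_schur_multiplier F := herz_schur_multiplier F /\
  exists S, extends_SF F S /\
    completely_compact crossed_product crossed_product S.

End CrossedProduct.

Lemma c0_pi_repE (R : realType) (G : groupType) (x : B_ell2 R G) :
    c0_mulops R G x ->
  forall (xi : ell2 G (ell2 G R[i]^o)) s,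
    pi_rep (c0_act R G) x xi s = c0_act R G s^-1%g x (xi s).
Proof. by move=> /c0_act_bounded [c xc]; exact: (pi_repE xc). Qed.

Section Haagerup.
Variables (R : realType) (G : groupType).

Notation B := (B_ell2 R G).

Definition inner (xi eta : ell2 G R[i]^o) : R[i] :=
  summability.sum (fun s => xi s * (eta s : R[i])^* : R[i]^o).

Definition adjoint (T : B) : B :=
  get [set S : B | forall xi eta, inner (T xi) eta = inner xi (S eta)].

Definition compact_op : set B :=
  [set T : B | precompact (T @` [set xi | nrm xi <= 1])].

(* The sequences (a, b) for which sum_i a_i (x) b_i is an element of the
   Haagerup tensor product. *)
Definition haagerup_series (X : set B) (u : (nat -> B) * (nat -> B)) :=
  [/\ forall i, X (u.1 i), forall i, X (u.2 i),
      cvgn (series (fun i => u.1 i \oB adjoint (u.1 i))) &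
      cvgn (series (fun i => adjoint (u.2 i) \oB u.2 i))].

Definition Gamma (u : (nat -> B) * (nat -> B)) (x : B) : B :=
  limn (series (fun i => u.1 i \oB x \oB u.2 i)).

Definition haagerup_conj (s : G) (u : (nat -> B) * (nat -> B)) :
    (nat -> B) * (nat -> B) :=
  (u.1, fun i => lambda R[i]^o s \oB u.2 i \oB lambda R[i]^o s^-1%g).

End Haagerup.

Arguments compact_op R G : clear implicits.

(* Main.v *)
(** The crossed product of C by translations is a copy of K: up to the unitary
    (s, r) |-> (s r, r) of ell2 (G x G), the operator pi(a) lambda_t is
    (a lambda_t) (x) 1; the map x |-> x (x) 1 is [twist], and compression to the
    slice r = 1 is its left inverse [cmp].

    If u = sum_i a_i (x) b_i represents F, then S_F is the copy of Gamma_u, since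
    Gamma_{u_s}(a) = Gamma_u(a lambda_s) lambda_s^-1; it is completely bounded by
    the row and column norms of u, and completely compact because truncating the
    a_i and b_i to a finite set of coordinates changes it little.

    Conversely, let Phi be the copy of S_F on matrix units. Complete compactness
    gives a finite T such that Phi is uniformly close to P_T Phi P_T. A matrix
    coefficient of Phi is a bounded functional supported on a single diagonal,
    hence an absolutely convergent one, so the domain can be truncated to
    finitely many matrix units as well. Thus Phi is a rapidly converging limit of
    maps D_n living on finite matrices; the differences D_{n+1} - D_n factor as
    sum_k a_k x b_k with norm control by the finite-dimensional Haagerup-Paulsen-
    Wittstock theorem, and concatenating these factorizations gives u.

    The finite-dimensional factorization, up to a factor 2, comes from separating
    the tensor from the convex cone of the triples
    (sum a a^*, sum b^* b, sum a (x) b): a separating functional yields positive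
    forms dominating a bilinear form, and testing the complete bound on the
    resulting matrix contradicts the separation. *)
Require Import Defs.
From HB Require Import structures.
From mathcomp Require Import all_boot all_order all_algebra.
From mathcomp Require Import finmap complex.
From mathcomp Require Import all_classical all_reals.
From mathcomp Require Import ereal topology normedtype sequences esum.
From mathcomp Require analysis.showcase.summability.
From mathcomp Require Import ring lra.

Set Implicit Arguments.
Unset Strict Implicit.
Unset Printing Implicit Defensive.

Import Order.TTheory GRing.Theory Num.Theory.
Import numFieldNormedType.Exports.

Local Open Scope classical_set_scope.
Local Open Scope ring_scope.

(** * Sums, matrix norms and compactness on ell2 *)

(** Complete compactness gives a finite-dimensional [Y] with no basis adapted to G, and every
    estimate must hold on all M_m at once. Since [Y] lies in the crossed product, its compressions
    are compact operators; they are truncated uniformly in m because scalar functionals, unlike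
    general bounded maps, have no growth under amplification. Truncating the domain works through
    the coefficients because F(s) maps C into itself: Phi then preserves each diagonal s t^-1 = p
    q^-1, a coefficient of Phi is a sum over p alone, and unimodular combinations along one diagonal
    are contractions that reveal its l1 norm. For the convergence of u only the geometric decay of
    D_{n+1} - D_n matters, which leaves room for the factor 2. That room is what allows an
    approximate separation: the cone is not shown to be closed, so the distance to it may not be
    attained and the functional obtained is only nearly polar; a multiple of the identity,
    proportional to the defect, is added to both forms to make them invertible, and the tensor is
    first approximated and then corrected by small matrix units. *)

Section NormFacts.
Variables (R : realType) (V : normedModType R[i]).
Implicit Types x y z : V.

Lemma nrmBC x y : nrm (x - y) = nrm (y - x).
Proof. by rewrite -nrmN opprB. Qed.

Lemma nrmB x y : nrm (x - y) <= nrm x + nrm y.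
Proof. by rewrite -(nrmN y) nrmD. Qed.

Lemma nrm_triangle z x y : nrm (x - y) <= nrm (x - z) + nrm (z - y).
Proof. by rewrite -[x - y](subrKA z) nrmD. Qed.

Lemma nrm_dist x y : `|nrm x - nrm y| <= nrm (x - y).
Proof.
rewrite ler_norml; apply/andP; split.
  rewrite lerNl opprB lerBlDr nrmBC (le_trans _ (nrmD _ _))//.
  by rewrite subrK.
by rewrite lerBlDr (le_trans _ (nrmD _ _))// subrK.
Qed.

Lemma nrm_sum (I : Type) (r : seq I) (P : pred I) (f : I -> V) :
  nrm (\sum_(i <- r | P i) f i) <= \sum_(i <- r | P i) nrm (f i).
Proof.
elim/big_ind2: _ => [|y1 y2 z1 z2 h1 h2|//]; first by rewrite nrm0.
by rewrite (le_trans (nrmD _ _))// lerD.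
Qed.

Lemma nrm_small_eq0 x : (forall e : R, 0 < e -> nrm x <= e) -> x = 0.
Proof.
move=> h; apply: nrm0_eq0; apply/eqP; rewrite eq_le nrm_ge0 andbT.
by apply/ler_addgt0Pr => e e0; rewrite add0r h.
Qed.

End NormFacts.

Lemma normc_ge0 (R : realType) (a : R[i]) : 0 <= Normc.normc a.
Proof. by rewrite -ler0c; exact: (normr_ge0 a). Qed.

Lemma nrm_normc (R : realType) (a : R[i]^o) : nrm a = Normc.normc a.
Proof. by []. Qed.

(** * Convergence with real tolerances *)

Section Limits.
Variables (R : realType) (V : normedModType R[i]).
Implicit Types (u v : nat -> V) (l x : V).

(** The tolerance is a real number although norms live in R[i], so that order arguments stay in R;
    the weak inequality passes to limits. [tendsP] translates to filters. *)
Definition tends u l := forall e : R, 0 < e ->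
  exists N, forall n, (N <= n)%N -> nrm (u n - l) <= e.

Definition cauchy_seq u := forall e : R, 0 < e ->
  exists N, forall m n, (N <= m)%N -> (N <= n)%N -> nrm (u m - u n) <= e.

Definition seq_complete := forall u, cauchy_seq u -> exists l, tends u l.

Lemma tendsP u l : tends u l <-> u @ \oo --> l.
Proof.
split=> [ul|/cvgrPdist_le ul].
  apply/cvgrPdist_le => e e0.
  have er : e = (complex.Re e)%:C%C by rewrite RRe_real// gtr0_real.
  have e0' : 0 < complex.Re e by rewrite -ltcR -er.
  have [N hN] := ul _ e0'; exists N => // n /= Nn.
  by rewrite distrC er -nrmE lecR hN.
move=> e e0; have [|N _ hN] := ul e%:C%C; first by rewrite ltcR.
by exists N => n Nn; rewrite -lecR nrmE distrC; exact: hN.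
Qed.

Lemma tends_lim u l : tends u l -> limn u = l.
Proof. by move/tendsP; apply: cvg_lim; exact: norm_hausdorff. Qed.

Lemma tends_uniq u l l' : tends u l -> tends u l' -> l = l'.
Proof. by move=> /tends_lim <- /tends_lim <-. Qed.

Lemma tends_is_cvg u l : tends u l -> cvgn u.
Proof. by move=> /tendsP ul; apply/cvg_ex; exists l. Qed.

Lemma is_cvg_tends u : cvgn u -> tends u (limn u).
Proof. by move=> ?; apply/tendsP. Qed.

Lemma tends_cauchy u l : tends u l -> cauchy_seq u.
Proof.
move=> ul e e0; have [|N hN] := ul (e / 2); first by rewrite divr_gt0.
exists N => m n Nm Nn; rewrite (le_trans (nrm_triangle l _ _))//.
by rewrite (splitr e) lerD ?hN// nrmBC hN.
Qed.

Lemma tends_cst l : tends (fun=> l) l.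
Proof. by move=> e e0; exists 0%N => n _; rewrite subrr nrm0 ltW. Qed.

Lemma tends_nrm_le u l (c : R) N :
  tends u l -> (forall n, (N <= n)%N -> nrm (u n) <= c) -> nrm l <= c.
Proof.
move=> ul uc; apply/ler_addgt0Pr => e e0; have [M hM] := ul e e0.
rewrite -[l](subrK (u (maxn M N))) (le_trans (nrmD _ _))// addrC lerD//.
  by rewrite uc// leq_maxr.
by rewrite nrmBC hM// leq_maxl.
Qed.

Lemma tendsD u v l k : tends u l -> tends v k -> tends (fun n => u n + v n) (l + k).
Proof. by move=> /tendsP h1 /tendsP h2; apply/tendsP; exact: cvgD. Qed.

Lemma tendsZ (a : R[i]) u l : tends u l -> tends (fun n => a *: u n) (a *: l).
Proof. by move=> /tendsP h; apply/tendsP; exact: cvgZr. Qed.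

Lemma tends_ext u v l : (forall n, u n = v n) -> tends u l -> tends v l.
Proof. by move=> uv; have -> : v = u by apply/funext. Qed.

End Limits.

Lemma tends_bop (R : realType) (V W : normedModType R[i]) (T : bop V W) u l :
  tends u l -> tends (fun n => T (u n)) (T l).
Proof.
move=> ul e e0; have t0 : 0 < opnorm T + 1 by rewrite ltr_wpDl ?opnorm_ge0.
have [|N hN] := ul (e / (opnorm T + 1)); first by rewrite divr_gt0.
exists N => n Nn; rewrite -linearB (le_trans (opnorm_bound _ _))//.
rewrite (@le_trans _ _ ((opnorm T + 1) * nrm (u n - l)))//.
  by rewrite ler_wpM2r ?nrm_ge0// lerDl.
by rewrite -ler_pdivlMl// mulrC hN.
Qed.

Lemma sum_fset_split (V : nmodType) (I : choiceType) (f : I -> V)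
    (A B : {fset I}) : (A `<=` B)%fset ->
  \sum_(i <- B) f i = \sum_(i <- A) f i + \sum_(i <- (B `\` A)%fset) f i.
Proof.
move=> AB; rewrite [LHS](big_fsetID _ (mem A)) /=; congr (_ + _).
  apply: eq_fbigl => i; rewrite !inE /= andbC.
  by case: (boolP (i \in A)) => //= /(fsubsetP AB) ->.
by apply: eq_fbigl => i; rewrite !inE /= andbC.
Qed.

(** * Unordered sums *)

Section UnorderedSums.
Local Open Scope fset_scope.
Local Open Scope ring_scope.
Variables (R : realType) (V : normedModType R[i]) (I : choiceType).
Implicit Types (f g : I -> V) (l : V) (A B : {fset I}).

(** Convergence along the finite subsets of I ordered by inclusion. Unlike the total function
    [summability.sum], the predicate records that the limit exists. *)
Definition hsum f l := forall e : R, 0 < e ->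
  exists A, forall B, A `<=` B -> nrm (\sum_(i <- B) f i - l) <= e.

Lemma hsumP f l : hsum f l -> summability.sum f = l.
Proof.
move=> fl; rewrite /summability.sum; have tf := @summability.totally_filter I.
apply: cvg_lim; first exact: norm_hausdorff.
apply/cvgrPdist_le => e e0.
have er : e = (complex.Re e)%:C%C by rewrite RRe_real// gtr0_real.
have e0' : 0 < complex.Re e by rewrite -ltcR -er.
have [A hA] := fl _ e0'; exists A => // B /= AB.
rewrite distrC er -nrmE lecR /summability.partial_sum.
by rewrite -(big_seq_fsetE _ _ xpredT) /= hA.
Qed.

Lemma hsum_uniq f l l' : hsum f l -> hsum f l' -> l = l'.
Proof. by move=> /hsumP <- /hsumP <-. Qed.

Lemma hsum_ext f g l : (forall i, f i = g i) -> hsum f l -> hsum g l.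
Proof. by move=> fg; have -> : g = f by apply/funext. Qed.

Lemma hsum_fin f A : (forall i, i \notin A -> f i = 0) -> hsum f (\sum_(i <- A) f i).
Proof.
move=> f0 e e0; exists A => B AB.
rewrite (@big_fset_incl _ _ _ _ A B f AB) ?subrr ?nrm0 ?ltW// => i iB iA.
by rewrite f0.
Qed.

Lemma hsum_nrm_le f l (c : R) : hsum f l ->
  (forall A, nrm (\sum_(i <- A) f i) <= c) -> nrm l <= c.
Proof.
move=> fl fc; apply/ler_addgt0Pr => e e0; have [A hA] := fl e e0.
have := hA A (fsubset_refl _); rewrite nrmBC => h.
rewrite -[l](subrK (\sum_(i <- A) f i)) (le_trans (nrmD _ _))// addrC lerD//.
Qed.

Lemma hsumD f g l k : hsum f l -> hsum g k -> hsum (fun i => f i + g i) (l + k).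
Proof.
move=> fl gk e e0; have e2 : 0 < e / 2 by rewrite divr_gt0.
have [A hA] := fl _ e2; have [A' hA'] := gk _ e2; exists (A `|` A') => B.
rewrite fsubUset => /andP[AB A'B]; rewrite big_split /= opprD addrACA.
by rewrite (le_trans (nrmD _ _))// (splitr e) lerD// ?hA ?hA'.
Qed.

(** [A] almost attains the supremum of the finite partial sums, so a set disjoint from it can add at
    most the gap. *)
Lemma bounded_sum_tail (g : I -> R) (M : R) : (forall i, 0 <= g i) ->
  (forall A, \sum_(i <- A) g i <= M) -> forall e : R, 0 < e ->
  exists A, forall B, [disjoint B & A]%fset -> \sum_(i <- B) g i <= e.
Proof.
move=> g0 gM e e0; pose S := [set \sum_(i <- A) g i | A in [set: {fset I}]]%classic.
have hs : has_sup S.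
  by split; [exists (\sum_(i <- fset0) g i); exists fset0|exists M => _ [A _ <-]].
have [_ [A _ <-] hA] := sup_adherent e0 hs.
exists A => B dAB; rewrite -(lerD2l (\sum_(i <- A) g i)).
have /fsetDidPl BA := dAB.
have -> : \sum_(i <- A) g i + \sum_(i <- B) g i = \sum_(i <- A `|` B) g i.
  rewrite (@sum_fset_split _ _ g A (A `|` B)) ?fsubsetUl//; congr (_ + _).
  apply: eq_fbigl => i.
  by rewrite -{1}BA !inE; case: (i \in A) => //=.
apply: (@le_trans _ _ (sup S)); last by rewrite -lerBlDr ltW.
by apply: (ub_le_sup hs.2); exists (A `|` B).
Qed.

(** Completeness is only sequential, so the limit of the net is taken along the increasing sets
    [S n]. Partial sums over two sets containing [T n] differ by terms outside [T n], hence by at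
    most 2 / (n + 1). *)
Lemma hsum_of_abs f (M : R) : seq_complete V ->
  (forall A, \sum_(i <- A) nrm (f i) <= M) -> exists l, hsum f l.
Proof.
move=> cV fM.
have tl := bounded_sum_tail (fun i => nrm_ge0 (f i)) fM.
have e0 n : 0 < n.+1%:R^-1 :> R by rewrite invr_gt0 ltr0n.
have [T hT] := choice (fun n => tl _ (e0 n)).
pose S n := (\bigcup_(k <- iota 0 n.+1) T k)%fset.
have TS n m : (n <= m)%N -> T n `<=` S m.
  by move=> nm; apply: bigfcup_sup => //; rewrite mem_iota add0n ltnS.
have key n B : T n `<=` B -> forall B', T n `<=` B' ->
   nrm (\sum_(i <- B) f i - \sum_(i <- B') f i) <= n.+1%:R^-1 + n.+1%:R^-1.
  move=> h1 B' h2; rewrite (sum_fset_split f h1) (sum_fset_split f h2).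
  rewrite opprD addrACA subrr add0r (le_trans (nrmB _ _))// lerD//.
    by rewrite (le_trans (nrm_sum _ _ _))// hT//; apply/fdisjointP => i /fsetDP[].
  by rewrite (le_trans (nrm_sum _ _ _))// hT//; apply/fdisjointP => i /fsetDP[].
have small (e : R) : 0 < e -> exists n, n.+1%:R^-1 + n.+1%:R^-1 <= e.
  move=> e0'; have e2 : 0 < e / 2 by rewrite divr_gt0.
  have [n hn] := ltr_add_invr e2; exists n.
  by rewrite (splitr e) lerD// ltW// -[X in X < _]add0r.
have [u hu] : exists l, tends (fun n => \sum_(i <- S n) f i) l.
  apply: cV => e /small[n hn]; exists n => p q np nq.
  by rewrite (le_trans _ hn)// key// TS.
exists u => e e0'; have [|n hn] := small (e / 2); first by rewrite divr_gt0.
have [|N hN] := hu (e / 2); first by rewrite divr_gt0.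
exists (T n) => B TB; pose m := maxn n N.
rewrite (le_trans (nrm_triangle (\sum_(i <- S m) f i) _ _))// (splitr e) lerD//.
  by rewrite (le_trans _ hn)// key// TS// leq_maxl.
by rewrite hN// leq_maxr.
Qed.

End UnorderedSums.

Lemma hsum_bop (R : realType) (V W : normedModType R[i]) (I : choiceType)
    (T : bop V W) (f : I -> V) l : hsum f l -> hsum (fun i => T (f i)) (T l).
Proof.
move=> ul e e0; have t0 : 0 < opnorm T + 1 by rewrite ltr_wpDl ?opnorm_ge0.
have [|A hA] := ul (e / (opnorm T + 1)); first by rewrite divr_gt0.
exists A => B AB; rewrite -linear_sum -linearB (le_trans (opnorm_bound _ _))//.
rewrite (@le_trans _ _ ((opnorm T + 1) * nrm (\sum_(i <- B) f i - l)))//.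
  by rewrite ler_wpM2r ?nrm_ge0// lerDl.
by rewrite -ler_pdivlMl// mulrC hA.
Qed.

(** * The space ell2 and its completeness *)

Section SquareSums.
Variables (R : realType) (I : choiceType) (V : normedModType R[i]).
Implicit Types (f : I -> V) (xi eta : ell2 I V) (A : {fset I}).

Lemma sqsum_leP f (c : R) :
  (sqsum f <= c%:E)%E <-> forall A, \sum_(i <- A) nrm (f i) ^+ 2 <= c.
Proof.
split=> [fc A|fc].
  rewrite -lee_fin (le_trans _ fc)// /sqsum; apply: esum_ge.
  exists [set` A]; first by split => //; exact: finite_fset.
  by rewrite fsbig_finite ?finite_fset//= set_fsetK sumEFin.
apply: ge_ereal_sup => _ [X [finX _] <-].
by rewrite fsbig_finite//= sumEFin lee_fin fc.
Qed.

Lemma ell2_nrm_leP xi (c : R) : 0 <= c ->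
  nrm xi <= c <-> forall A, \sum_(i <- A) nrm (xi i) ^+ 2 <= c ^+ 2.
Proof. by move=> c0; rewrite -sqsum_leP -ell2_norm_le. Qed.

Lemma ell2_sum_le xi A : \sum_(i <- A) nrm (xi i) ^+ 2 <= nrm xi ^+ 2.
Proof. by have /ell2_nrm_leP := lexx (nrm xi); apply; rewrite nrm_ge0. Qed.

Lemma ell2_coord_le xi i : nrm (xi i) <= nrm xi.
Proof.
rewrite -ler_sqr ?nnegrE ?nrm_ge0//; have := ell2_sum_le xi [fset i]%fset.
by rewrite big_seq_fset1.
Qed.

Lemma ell2_ex f (c : R) : (forall A, \sum_(i <- A) nrm (f i) ^+ 2 <= c) ->
  exists xi : ell2 I V, xi = f :> (I -> V).
Proof.
move=> /sqsum_leP fc; have fs : f \in square_summable I V.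
  by rewrite unfold_in (le_lt_trans fc) ?ltry.
by exists (Ell2 fs).
Qed.

Lemma ell2_eq xi eta : (forall i, xi i = eta i) -> xi = eta.
Proof. by move=> h; apply: val_inj; apply/funext. Qed.

Lemma ell2DE xi eta i : (xi + eta) i = xi i + eta i. Proof. by []. Qed.
Lemma ell2BE xi eta i : (xi - eta) i = xi i - eta i. Proof. by []. Qed.
Lemma ell2ZE (a : R[i]) xi i : (a *: xi) i = a *: xi i. Proof. by []. Qed.
Lemma ell2ZDE (a : R[i]) xi eta i : (a *: xi + eta) i = a *: xi i + eta i.
Proof. by []. Qed.
Lemma ell2_sumE (J : Type) (r : seq J) (P : pred J) (F : J -> ell2 I V) i :
  (\sum_(j <- r | P j) F j) i = \sum_(j <- r | P j) F j i.
Proof. by elim/big_ind2: _ => // x1 y1 x2 y2 <- <-. Qed.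

Lemma ell2_nrm_fin xi A : (forall i, i \notin A -> xi i = 0) ->
  nrm xi ^+ 2 = \sum_(i <- A) nrm (xi i) ^+ 2.
Proof.
move=> x0; apply/eqP; rewrite eq_le ell2_sum_le andbT.
have s0 : 0 <= \sum_(i <- A) nrm (xi i) ^+ 2 by apply: sumr_ge0 => i _; exact: sqr_ge0.
rewrite -[leRHS]sqr_sqrtr// ler_sqr ?nnegrE ?nrm_ge0 ?sqrtr_ge0//.
apply/ell2_nrm_leP => [|B]; first exact: sqrtr_ge0.
rewrite sqr_sqrtr// (@big_fset_incl _ _ _ _ A (A `|` B)%fset) ?fsubsetUl//.
  rewrite (@sum_fset_split _ _ _ B (A `|` B)%fset) ?fsubsetUr//.
  by rewrite lerDl sumr_ge0// => i _; exact: sqr_ge0.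
by move=> i _ /x0 ->; rewrite nrm0 expr0n.
Qed.

(** Coordinates converge because [V] is complete. The Cauchy estimate passes to the limit on each
    finite [A] separately, which gives both square-summability of the difference from one term and
    norm convergence. *)
Lemma ell2_complete : seq_complete V -> seq_complete (ell2 I V).
Proof.
move=> cV u cu.
have /choice[f hf] : forall i, exists l, tends (fun n => u n i) l.
  move=> i; apply: cV => e e0.
  have [N hN] := cu e e0; exists N => m n Nm Nn.
  by rewrite (le_trans _ (hN m n Nm Nn))// -ell2BE ell2_coord_le.
have key (e : R) n A : 0 <= e -> (exists N, forall m, (N <= m)%N -> nrm (u m - u n) <= e) ->
    \sum_(i <- A) nrm (f i - u n i) ^+ 2 <= e ^+ 2.
  move=> e0 [N hN].
  have ct : (fun m => \sum_(i <- A) nrm (u m i - u n i) ^+ 2) @ \oo -->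
      \sum_(i <- A) nrm (f i - u n i) ^+ 2.
    apply: cvg_big => [|i _]; first exact: add_continuous.
    have ci : (fun m => nrm (u m i - u n i)) @ \oo --> nrm (f i - u n i).
      apply/cvgrPdist_le => d d0; have [M hM] := hf i d d0.
      exists M => // m /= Mm; rewrite (le_trans (nrm_dist _ _))//.
      by rewrite opprB addrA subrK nrmBC hM.
    by rewrite expr2; apply: (cvg_trans _ (cvgM ci ci)); rewrite -exprfctE.
  rewrite -(cvg_lim (@Rhausdorff R) ct); apply: limr_le; first exact: (cvgP _ ct).
  exists N => // m /= Nm; rewrite (le_trans (ell2_sum_le (u m - u n) A))//.
  by rewrite ler_sqr ?nnegrE ?nrm_ge0 ?hN.
have [N1 hN1] := cu 1 ltr01.
have [d dE] : exists d : ell2 I V, d = (fun i => f i - u N1 i) :> (I -> V).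
  apply: (@ell2_ex _ (1 ^+ 2)) => A; apply: key => //.
  by exists N1 => m h; exact: hN1.
exists (d + u N1) => e e0; have [N hN] := cu e e0; exists N => n Nn.
rewrite nrmBC; apply/ell2_nrm_leP; first exact: ltW.
move=> A; apply: (le_trans _ (@key e n A (ltW e0) _)); last first.
  by exists N => m Nm; exact: hN.
by apply: ler_sum => i _; rewrite ell2BE ell2DE dE subrK.
Qed.

End SquareSums.

Section OperatorFacts.
Variables (R : realType) (H K : normedModType R[i]).
Implicit Types S T : bop H K.

Lemma bopDE S T x : (S + T) x = S x + T x. Proof. by []. Qed.
Lemma bopBE S T x : (S - T) x = S x - T x. Proof. by []. Qed.
Lemma bopZE (a : R[i]) T x : (a *: T) x = a *: T x. Proof. by []. Qed.
Lemma bopZDE (a : R[i]) S T x : (a *: S + T) x = a *: S x + T x.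
Proof. by []. Qed.
Lemma bop_sumE (J : Type) (r : seq J) (P : pred J) (F : J -> bop H K) x :
  (\sum_(j <- r | P j) F j) x = \sum_(j <- r | P j) F j x.
Proof. by elim/big_ind2: _ => // x1 y1 x2 y2 <- <-. Qed.

Lemma bop_lin T (a : R[i]) x y : T (a *: x + y) = a *: T x + T y.
Proof. exact: (bopP T).1. Qed.

Lemma bop_eq S T : (forall x, S x = T x) -> S = T.
Proof. by move=> h; apply: val_inj; apply/funext. Qed.

Lemma bop_ex (f : H -> K) (c : R) :
  (forall (a : R[i]) x y, f (a *: x + y) = a *: f x + f y) ->
  (forall x, nrm (f x) <= c * nrm x) -> exists T : bop H K, forall x, T x = f x.
Proof.
move=> lf fc; have fb : f \in bounded_linear H K.
  by apply/asboolP; split => //; exists c.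
by exists (Bop fb).
Qed.

Lemma opnorm_leP T (c : R) : 0 <= c ->
  nrm T <= c <-> forall x, nrm (T x) <= c * nrm x.
Proof.
move=> c0; split=> [Tc x|]; last exact: opnorm_le.
by rewrite (le_trans (opnorm_bound T x))// ler_wpM2r ?nrm_ge0.
Qed.

Lemma opnorm_le_unit T (c : R) :
  (forall x, nrm x <= 1 -> nrm (T x) <= c) -> nrm T <= c.
Proof.
move=> Tc; apply: ge_sup; first exact: (opnorm_has_sup T).1.
by move=> _ [x /= x1 <-]; exact: Tc.
Qed.

Lemma nrm_bopP T x : nrm (T x) <= nrm T * nrm x.
Proof. exact: opnorm_bound. Qed.

Lemma bop_complete : seq_complete K -> seq_complete (bop H K).
Proof.
move=> cK u cu.
have bnd (e : R) : 0 < e -> exists N, forall m n, (N <= m)%N -> (N <= n)%N ->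
    forall x, nrm (u m x - u n x) <= e * nrm x.
  move=> e0; have [N hN] := cu e e0; exists N => m n Nm Nn x.
  exact: ((opnorm_leP (u m - u n) (ltW e0)).1 (hN m n Nm Nn) x).
have /choice[f hf] : forall x, exists l, tends (fun n => u n x) l.
  move=> x; apply: cK => e e0.
  have x0 : 0 < nrm x + 1 by rewrite ltr_wpDl ?nrm_ge0.
  have [|N hN] := bnd (e / (nrm x + 1)); first by rewrite divr_gt0.
  exists N => m n Nm Nn; rewrite (le_trans (hN m n Nm Nn x))// -mulrA -[leRHS]mulr1.
  by rewrite ler_wpM2l ?(ltW e0)// ler_pdivrMl// mulr1 lerDl.
have fu (e : R) : 0 < e -> exists N, forall n, (N <= n)%N ->
    forall x, nrm (f x - u n x) <= e * nrm x.
  move=> e0; have [N hN] := bnd e e0; exists N => n Nn x.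
  have h := tendsD (hf x) (@tends_cst _ _ (- u n x)).
  by apply: (tends_nrm_le (N := N) h) => m Nm; exact: hN.
have [N hN] := fu 1 ltr01.
have [T hT] : exists T : bop H K, forall x, T x = f x.
  apply: (@bop_ex _ (1 + nrm (u N))) => [a x y|x].
    apply: tends_uniq (hf (a *: x + y)) _.
    apply: (tends_ext _ (tendsD (tendsZ a (hf x)) (hf y))) => n.
    by rewrite linearP.
  rewrite -[f x](subrK (u N x)) (le_trans (nrmD _ _))// mulrDl lerD//.
    by rewrite hN.
  exact: nrm_bopP.
exists T => e e0; have [M hM] := fu e e0; exists M => n Mn; rewrite nrmBC.
by apply/opnorm_leP => [|x]; [exact: ltW|rewrite bopBE hT hM].
Qed.

End OperatorFacts.

Section CompositionFacts.
Variable (R : realType).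
Implicit Types H K L : normedModType R[i].

Lemma bop_compE H K L (S : bop K L) (T : bop H K) x : (S \oB T) x = S (T x).
Proof. by []. Qed.

Lemma nrm_comp H K L (S : bop K L) (T : bop H K) : nrm (S \oB T) <= nrm S * nrm T.
Proof.
apply/opnorm_leP => [|x]; first by rewrite mulr_ge0 ?nrm_ge0.
rewrite bop_compE (le_trans (nrm_bopP _ _))// -mulrA ler_wpM2l ?nrm_ge0//.
exact: nrm_bopP.
Qed.

Lemma bop_compA H K L M (U : bop L M) (S : bop K L) (T : bop H K) :
  U \oB (S \oB T) = U \oB S \oB T.
Proof. exact: bop_eq. Qed.

Lemma compBl H K L (S S' : bop K L) (T : bop H K) :
  (S - S') \oB T = S \oB T - S' \oB T.
Proof. exact: bop_eq. Qed.

Lemma compBr H K L (S : bop K L) (T T' : bop H K) :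
  S \oB (T - T') = S \oB T - S \oB T'.
Proof. by apply: bop_eq => x; rewrite !(bop_compE, bopBE) linearB. Qed.

Lemma compDl H K L (S S' : bop K L) (T : bop H K) :
  (S + S') \oB T = S \oB T + S' \oB T.
Proof. exact: bop_eq. Qed.

Lemma compDr H K L (S : bop K L) (T T' : bop H K) :
  S \oB (T + T') = S \oB T + S \oB T'.
Proof. by apply: bop_eq => x; rewrite !(bop_compE, bopDE) linearD. Qed.

Lemma compZl H K L (a : R[i]) (S : bop K L) (T : bop H K) :
  (a *: S) \oB T = a *: (S \oB T).
Proof. exact: bop_eq. Qed.

Lemma compZr H K L (a : R[i]) (S : bop K L) (T : bop H K) :
  S \oB (a *: T) = a *: (S \oB T).
Proof. by apply: bop_eq => x; rewrite !(bop_compE, bopZE) linearZ. Qed.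

Lemma comp_suml H K L (J : Type) (r : seq J) (P : pred J) (F : J -> bop K L)
    (T : bop H K) :
  (\sum_(j <- r | P j) F j) \oB T = \sum_(j <- r | P j) (F j \oB T).
Proof. by apply: bop_eq => x; rewrite !(bop_compE, bop_sumE). Qed.

Lemma comp_sumr H K L (J : Type) (r : seq J) (P : pred J) (F : J -> bop H K)
    (S : bop K L) :
  S \oB (\sum_(j <- r | P j) F j) = \sum_(j <- r | P j) (S \oB F j).
Proof.
by apply: bop_eq => x; rewrite bop_compE !bop_sumE linear_sum.
Qed.

End CompositionFacts.

Lemma normc_ge_Im (R : realType) (z : R[i]) : `|complex.Im z| <= Normc.normc z.
Proof. by case: z => a b /=; rewrite -sqrtr_sqr ler_wsqrtr// lerDr sqr_ge0. Qed.

Lemma normc_le_ReIm (R : realType) (z : R[i]) :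
  Normc.normc z <= `|complex.Re z| + `|complex.Im z|.
Proof.
case: z => a b /=; rewrite -[leRHS]ger0_norm ?addr_ge0// -sqrtr_sqr ler_wsqrtr//.
by rewrite sqrrD !real_normK ?num_real// lerD2r lerDl mulrn_wge0// mulr_ge0.
Qed.

Lemma complex_complete (R : realType) : seq_complete (R[i]^o : normedModType R[i]).
Proof.
move=> u cu.
have rc (v : nat -> R) : (forall m n, `|v m - v n| <= nrm (u m - u n)) ->
    exists l : R, forall e : R, 0 < e -> exists N, forall n, (N <= n)%N -> `|v n - l| <= e.
  move=> vu; suff /cvg_ex[l /cvgrPdist_le vl] : cvgn v.
    exists l => e e0; have [N _ hN] := vl e e0; exists N => n Nn.
    by rewrite distrC; exact: hN.
  apply/cauchy_cvgP/cauchy_ballP => e e0.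
  have [|N hN] := cu (e / 2); first by rewrite divr_gt0.
  exists (v @` [set n | (N <= n)%N], v @` [set n | (N <= n)%N]).
    by split; exists N => // n /= Nn; exists n.
  move=> [_ _] /= [[m Nm <-] [n Nn <-]]; rewrite /ball /= (le_lt_trans (vu m n))//.
  by rewrite (le_lt_trans (hN m n Nm Nn))// ltr_pdivrMr// ltr_pMr// ltr1n.
have [|a ha] := rc (fun n => complex.Re (u n)).
  move=> m n; rewrite -lecR nrmE -raddfB; exact: normc_ge_Re.
have [|b hb] := rc (fun n => complex.Im (u n)).
  move=> m n; rewrite -raddfB; exact: normc_ge_Im (u m - u n).
exists (a +i* b)%C => e e0.
have e2 : 0 < e / 2 by rewrite divr_gt0.
have [N hN] := ha _ e2; have [M hM] := hb _ e2.
exists (maxn N M) => n; rewrite geq_max => /andP[Nn Mn].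
rewrite [X in X <= _](_ : _ = Normc.normc (u n - (a +i* b)%C))// (le_trans (normc_le_ReIm _))//.
by rewrite !raddfB (splitr e) lerD ?hN ?hM.
Qed.

Lemma normcN1 (R : realType) : Normc.normc (-1 : R[i]) = 1.
Proof. by rewrite -[LHS]nrm_normc nrmN nrm_normc Normc.normc1. Qed.

Section FiniteSums.
Variables (R : realType) (m : nat) (V : normedModType R[i]).

Lemma ell2_ord_ex (f : 'I_m -> V) : exists xi : ell2 'I_m V, xi = f :> ('I_m -> V).
Proof.
apply: (@ell2_ex _ _ _ _ (\sum_(i < m) nrm (f i) ^+ 2)) => A.
have -> : \sum_(i < m) nrm (f i) ^+ 2 = \sum_(i <- [fset i in 'I_m]%fset) nrm (f i) ^+ 2.
  rewrite big_seq_fsetE /= -(big_seq_fsetE _ _ xpredT (fun i => nrm (f i) ^+ 2)) /=.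
  by rewrite eq_big_imfset//= big_map big_enum.
rewrite (@sum_fset_split _ _ _ A [fset i in 'I_m]%fset); last first.
  by apply/fsubsetP => i _; rewrite !inE.
by rewrite lerDl sumr_ge0// => i _; exact: sqr_ge0.
Qed.

Lemma ell2_ord_nrm (xi : ell2 'I_m V) : nrm xi ^+ 2 = \sum_(i < m) nrm (xi i) ^+ 2.
Proof. by apply: EFin_inj; rewrite -sqsum_ord -ell2_norm_sq. Qed.

End FiniteSums.

Lemma bopZD_ell2E (R : realType) (I : choiceType) (H V : normedModType R[i])
    (a : R[i]) (S T : bop H (ell2 I V)) x i :
  (a *: S + T) x i = a *: S x i + T x i.
Proof. by rewrite (bopZDE a S T) (ell2ZDE a (S x) (T x)). Qed.

Opaque ell2_op ampl.

(** * Norms of operator matrices *)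

Section MatrixNorm.
Variables (R : realType) (H K : normedModType R[i]) (m : nat).
Implicit Types x y z : 'M[bop H K]_m.

Lemma mxnorm_ge0 x : 0 <= mxnorm x.
Proof. exact: opnorm_ge0. Qed.

(** Together with [mxnorm_le], the working description of the norm on M_m(B(H, K)), by plain
    families of vectors. *)
Lemma mxnormP x (xi : 'I_m -> H) :
  \sum_(i < m) nrm (\sum_(j < m) x i j (xi j)) ^+ 2
    <= mxnorm x ^+ 2 * \sum_(j < m) nrm (xi j) ^+ 2.
Proof.
have [f fE] := ell2_ord_ex xi; have := opnorm_bound (ampl x) f.
rewrite -ler_sqr ?nnegrE ?nrm_ge0//; last by rewrite mulr_ge0 ?nrm_ge0// opnorm_ge0.
rewrite exprMn !ell2_ord_nrm fE; under eq_bigr do rewrite amplE.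
by rewrite fE.
Qed.

Lemma mxnorm_le x (c : R) : 0 <= c ->
  (forall xi : 'I_m -> H, \sum_(i < m) nrm (\sum_(j < m) x i j (xi j)) ^+ 2
    <= c ^+ 2 * \sum_(j < m) nrm (xi j) ^+ 2) -> mxnorm x <= c.
Proof.
move=> c0 h; apply: opnorm_le => // f.
rewrite -ler_sqr ?nnegrE ?nrm_ge0//; last by rewrite mulr_ge0 ?nrm_ge0.
rewrite exprMn !ell2_ord_nrm; under eq_bigr do rewrite amplE.
exact: h.
Qed.

Lemma mxnorm_entry x i j : nrm (x i j) <= mxnorm x.
Proof.
apply: opnorm_le => [|v]; first exact: mxnorm_ge0.
rewrite -ler_sqr ?nnegrE ?nrm_ge0 ?mulr_ge0 ?mxnorm_ge0 ?nrm_ge0//.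
have := mxnormP x (fun k => if k == j then v else 0).
rewrite exprMn; set s := (X in _ <= _ * X).
have -> : s = nrm v ^+ 2.
  rewrite /s (bigD1 j)//= eqxx big1 ?addr0// => k /negbTE ->.
  by rewrite nrm0 expr0n.
apply: le_trans; rewrite (bigD1 i)//= (_ : \sum_(k < m) x i k _ = x i j v).
  by rewrite lerDl sumr_ge0// => k _; exact: sqr_ge0.
rewrite (bigD1 j)//= eqxx big1 ?addr0// => k /negbTE ->.
by rewrite linear0.
Qed.

Lemma mxnormZD (a : R[i]) x y z : (forall i j, z i j = a *: x i j + y i j) ->
  mxnorm z <= Normc.normc a * mxnorm x + mxnorm y.
Proof.
move=> zE; have e : ampl z = a *: ampl x + ampl y.
  apply: bop_eq => xi; apply: ell2_eq => i.
  rewrite (bopZD_ell2E a (ampl x) (ampl y) xi i).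
  refine (etrans (amplE z xi i) (etrans _ (congr2 (fun u v : K => a *: u + v)
    (esym (amplE x xi i)) (esym (amplE y xi i))))).
  rewrite scaler_sumr -big_split /=.
  by apply: eq_bigr => j _; rewrite zE.
change (nrm (ampl z) <= Normc.normc a * nrm (ampl x) + nrm (ampl y)).
rewrite e -nrmZ; exact: nrmD.
Qed.

Lemma mxnormD x y : mxnorm (x + y) <= mxnorm x + mxnorm y.
Proof.
rewrite -[mxnorm x]mul1r -[X in X * _ + _](Normc.normc1 R).
by apply: mxnormZD => i j; rewrite mxE scale1r.
Qed.

Lemma mxnorm0 : mxnorm (0 : 'M[bop H K]_m) = 0.
Proof.
apply/eqP; rewrite eq_le mxnorm_ge0 andbT mxnorm_le// => xi.
rewrite big1 ?expr0n ?mul0r// => i _; rewrite big1 ?nrm0 ?expr0n//.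
by move=> j _; rewrite mxE.
Qed.

Lemma mxnormZ (a : R[i]) x z : (forall i j, z i j = a *: x i j) ->
  mxnorm z <= Normc.normc a * mxnorm x.
Proof.
move=> zE; rewrite -[leRHS]addr0 -mxnorm0.
by apply: mxnormZD => i j; rewrite mxE addr0.
Qed.

Lemma mxnormB x y : mxnorm (x - y) <= mxnorm x + mxnorm y.
Proof.
rewrite [leRHS]addrC -[mxnorm y]mul1r -[X in X * _ + _](normcN1 R).
by apply: mxnormZD => i j; rewrite !mxE scaleN1r addrC.
Qed.

Lemma mxnorm_sum (J : Type) (r : seq J) (P : pred J) (F : J -> 'M[bop H K]_m) :
  mxnorm (\sum_(j <- r | P j) F j) <= \sum_(j <- r | P j) mxnorm (F j).
Proof.
elim/big_ind2: _ => [|y1 y2 z1 z2 h1 h2|//]; first by rewrite mxnorm0.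
by rewrite (le_trans (mxnormD _ _))// lerD.
Qed.

End MatrixNorm.

Section MatrixComposition.
Variables (R : realType) (m : nat).
Implicit Types H K L : normedModType R[i].

Lemma mxnorm_comp_l H K L (S : bop K L) (x : 'M[bop H K]_m) :
  mxnorm (map_mx (bop_comp S) x) <= nrm S * mxnorm x.
Proof.
apply: mxnorm_le => [|xi]; first by rewrite mulr_ge0 ?nrm_ge0 ?mxnorm_ge0.
rewrite exprMn -mulrA.
apply: (@le_trans _ _ (nrm S ^+ 2 * \sum_(i < m) nrm (\sum_(j < m) x i j (xi j)) ^+ 2)).
  rewrite mulr_sumr; apply: ler_sum => i _; rewrite -exprMn.
  rewrite ler_sqr ?nnegrE ?nrm_ge0 ?mulr_ge0 ?nrm_ge0//.
  rewrite (_ : \sum_(j < m) _ = S (\sum_(j < m) x i j (xi j))) ?nrm_bopP//.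
  by rewrite linear_sum; apply: eq_bigr => j _; rewrite mxE.
by rewrite ler_wpM2l ?sqr_ge0 ?mxnormP.
Qed.

Lemma mxnorm_comp_r H K L (T : bop H K) (x : 'M[bop K L]_m) :
  mxnorm (map_mx (fun z => z \oB T) x) <= mxnorm x * nrm T.
Proof.
apply: mxnorm_le => [|xi]; first by rewrite mulr_ge0 ?nrm_ge0 ?mxnorm_ge0.
rewrite exprMn -mulrA.
apply: (@le_trans _ _ (mxnorm x ^+ 2 * \sum_(j < m) nrm (T (xi j)) ^+ 2)).
  rewrite (le_trans _ (mxnormP x (fun j => T (xi j))))//.
  by apply: ler_sum => i _; under eq_bigr do rewrite mxE.
rewrite ler_wpM2l ?sqr_ge0// mulr_sumr; apply: ler_sum => i _; rewrite -exprMn.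
by rewrite ler_sqr ?nnegrE ?nrm_ge0 ?mulr_ge0 ?nrm_ge0// nrm_bopP.
Qed.

End MatrixComposition.

(** * Row and column bounds *)

Section RowColumn.
Variables (R : realType) (H K : normedModType R[i]).

(* The norm of the row operator (a_k)_{k in r} is at most sqrt C; dually for
   columns. *)
Definition row_bound (J : Type) (r : seq J) (a : J -> bop H K) (C : R) :=
  forall z : J -> H,
    nrm (\sum_(k <- r) a k (z k)) ^+ 2 <= C * \sum_(k <- r) nrm (z k) ^+ 2.

Definition col_bound (J : Type) (r : seq J) (b : J -> bop H K) (D : R) :=
  forall xi : H, \sum_(k <- r) nrm (b k xi) ^+ 2 <= D * nrm xi ^+ 2.

End RowColumn.

(** The map is a row times an amplification of z times a column. The row bound is applied for each i
    to the vectors sum_j x_ij b_k xi_j, then the matrix bound for each k, then the column bound for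
    each j. *)
Lemma row_col_mxnorm (R : realType) (H K L M : normedModType R[i]) (J : Type)
    (r : seq J) (a : J -> bop L M) (b : J -> bop H K) (C D : R) m
    (x : 'M[bop K L]_m) : 0 <= C -> 0 <= D -> row_bound r a C -> col_bound r b D ->
  mxnorm (map_mx (fun z => \sum_(k <- r) a k \oB z \oB b k) x)
    <= Num.sqrt (C * D) * mxnorm x.
Proof.
move=> C0 D0 hr hc; apply: mxnorm_le => [|xi].
  by rewrite mulr_ge0 ?mxnorm_ge0 ?sqrtr_ge0.
rewrite exprMn sqr_sqrtr ?mulr_ge0//.
apply: (@le_trans _ _ (C * \sum_(i < m) \sum_(k <- r) nrm (\sum_(j < m) x i j (b k (xi j))) ^+ 2)).
  rewrite mulr_sumr; apply: ler_sum => i _.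
  rewrite (_ : \sum_(j < m) _ = \sum_(k <- r) a k (\sum_(j < m) x i j (b k (xi j)))).
    exact: hr.
  under [RHS]eq_bigr do rewrite linear_sum.
  rewrite exchange_big; apply: eq_bigr => j _.
  by rewrite mxE bop_sumE.
rewrite -mulrA -(mulrA C) ler_wpM2l// exchange_big /= (mulrCA D) mulr_sumr.
apply: (@le_trans _ _ (mxnorm x ^+ 2 * \sum_(k <- r) \sum_(j < m) nrm (b k (xi j)) ^+ 2)).
  by rewrite mulr_sumr; apply: ler_sum => k _; exact: mxnormP.
rewrite ler_wpM2l ?sqr_ge0// exchange_big; apply: ler_sum => j _.
exact: hc.
Qed.

Lemma row_col_nrm (R : realType) (H K L M : normedModType R[i]) (J : Type)
    (r : seq J) (a : J -> bop L M) (b : J -> bop H K) (C D : R)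
    (x : bop K L) : 0 <= C -> 0 <= D -> row_bound r a C -> col_bound r b D ->
  nrm (\sum_(k <- r) a k \oB x \oB b k) <= Num.sqrt (C * D) * nrm x.
Proof.
move=> C0 D0 hr hc; apply: opnorm_le => [|xi].
  by rewrite mulr_ge0 ?nrm_ge0 ?sqrtr_ge0.
rewrite -ler_sqr ?nnegrE ?mulr_ge0 ?nrm_ge0 ?sqrtr_ge0//.
rewrite !exprMn sqr_sqrtr ?mulr_ge0// bop_sumE.
apply: (le_trans (hr (fun k => x (b k xi)))); rewrite -(mulrA (C * D)) -(mulrA C) ler_wpM2l//.
apply: (@le_trans _ _ (nrm x ^+ 2 * \sum_(k <- r) nrm (b k xi) ^+ 2)).
  rewrite mulr_sumr; apply: ler_sum => k _; rewrite -exprMn.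
  by rewrite ler_sqr ?nnegrE ?nrm_ge0 ?mulr_ge0 ?nrm_ge0// nrm_bopP.
by rewrite mulrCA ler_wpM2l ?sqr_ge0.
Qed.

(** Induction on the list; the cross term is absorbed by 2 S a b <= A b^2 + D a^2, a consequence of
    S^2 <= A D. *)
Lemma cauchy_schwarz_real (R : realType) (J : Type) (r : seq J) (x y : J -> R) :
  (\sum_(j <- r) x j * y j) ^+ 2 <= (\sum_(j <- r) x j ^+ 2) * \sum_(j <- r) y j ^+ 2.
Proof.
elim: r => [|j r]; first by rewrite !big_nil mul0r expr0n.
have sq0 (z : J -> R) : 0 <= \sum_(k <- r) z k ^+ 2.
  by apply: sumr_ge0 => k _; exact: sqr_ge0.
move: (sq0 x) (sq0 y); rewrite !big_cons.
set A := \sum_(k <- r) x k ^+ 2; set D := \sum_(k <- r) y k ^+ 2.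
set S := \sum_(k <- r) x k * y k.
move=> A0 D0 SAD; set a := x j; set b := y j.
have h : 2 * (S * (a * b)) <= A * b ^+ 2 + D * a ^+ 2.
  have r0 : 0 <= A * b ^+ 2 + D * a ^+ 2 by apply: addr_ge0; apply: mulr_ge0 => //; exact: sqr_ge0.
  rewrite (le_trans (ler_norm _))// -ler_sqr ?nnegrE// real_normK ?num_real//.
  apply: (@le_trans _ _ (4 * (A * D) * (a * b) ^+ 2)).
    rewrite [leLHS](_ : _ = 4 * S ^+ 2 * (a * b) ^+ 2); last by ring.
    by rewrite ler_wpM2r ?sqr_ge0// ler_wpM2l.
  rewrite -subr_ge0 [leRHS](_ : _ = (A * b ^+ 2 - D * a ^+ 2) ^+ 2); last by ring.
  exact: sqr_ge0.
rewrite -subr_ge0.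
have -> : (a ^+ 2 + A) * (b ^+ 2 + D) - (a * b + S) ^+ 2
    = (A * D - S ^+ 2) + (A * b ^+ 2 + D * a ^+ 2 - 2 * (S * (a * b))) by ring.
by rewrite addr_ge0 ?subr_ge0.
Qed.

Lemma cauchy_schwarz_complex (R : realType) (J : Type) (r : seq J) (x y : J -> R[i]^o) :
  nrm (\sum_(j <- r) (x j * y j : R[i]^o)) ^+ 2
    <= (\sum_(j <- r) nrm (x j) ^+ 2) * \sum_(j <- r) nrm (y j) ^+ 2.
Proof.
apply: (le_trans _ (cauchy_schwarz_real r (fun j => nrm (x j)) (fun j => nrm (y j)))).
rewrite ler_sqr ?nnegrE ?nrm_ge0 ?sumr_ge0// => [|j _]; last first.
  by rewrite mulr_ge0 ?nrm_ge0.
rewrite (le_trans (nrm_sum _ _ _))//; apply: ler_sum => j _.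
by rewrite (nrmZ (x j) (y j)).
Qed.

Lemma nrm_conj (R : realType) (z : R[i]) : nrm (z^* : R[i]^o) = nrm (z : R[i]^o).
Proof. by apply: (@complexI R); rewrite !nrmE; exact: normcJ. Qed.

Lemma nrmM (R : realType) (z w : R[i]) : nrm (z * w : R[i]^o) = nrm (z : R[i]^o) * nrm (w : R[i]^o).
Proof. exact: nrmZ. Qed.

Lemma mul_conj (R : realType) (z : R[i]) : z * z^* = (nrm (z : R[i]^o) ^+ 2)%:C%C.
Proof. by rewrite rmorphXn /= nrmE; symmetry; exact: sqr_normc. Qed.

Lemma nrm1 (R : realType) : nrm (1 : R[i]^o) = 1.
Proof. by rewrite nrm_normc Normc.normc1. Qed.

Lemma nrm_bool (R : realType) (b : bool) : nrm (b%:R : R[i]^o) = b%:R.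
Proof. by case: b; rewrite ?nrm1 ?nrm0. Qed.

Lemma nrm_real (R : realType) (x : R) : nrm (x%:C%C : R[i]^o) = `|x|.
Proof. by rewrite nrm_normc /= expr0n addr0 sqrtr_sqr. Qed.

(** * Inner product and adjoints on ell2 G *)

Section InnerProduct.
Variables (R : realType) (G : groupType).
Notation ell := (ell2 G R[i]^o).
Notation B := (B_ell2 R G).
Implicit Types (xi eta zeta : ell) (T S : B) (s t : G).

Lemma deltaE s t : delta R s t = (t == s)%:R. Proof. by []. Qed.

Lemma nrm_delta s : nrm (delta R s) = 1.
Proof.
apply/eqP; rewrite -(@eqrXn2 _ 2) ?nrm_ge0// expr1n.
rewrite (@ell2_nrm_fin _ _ _ _ [fset s]%fset); last first.
  by move=> t; rewrite inE deltaE => /negbTE ->.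
by rewrite big_seq_fset1 deltaE eqxx nrm1 expr1n.
Qed.

Lemma sum_deltaE (D : {fset G}) (c : G -> R[i]) t :
  (\sum_(s <- D) c s *: delta R s) t = (t \in D)%:R * c t.
Proof.
rewrite ell2_sumE; have [tD|tD] := boolP (t \in D).
  rewrite (bigD1_seq t tD (fset_uniq D)) (_ : \sum_(i <- D | i != t) _ = 0).
    refine (etrans (addr0 _) _).
    by rewrite mul1r ell2ZE deltaE eqxx; exact: mulr1.
  apply: big1 => s /negbTE st.
  by rewrite ell2ZE deltaE eq_sym st scaler0.
rewrite mul0r big1_fset// => s sD _; rewrite ell2ZE deltaE.
by case: eqP => [ts|_]; [rewrite ts sD in tD|rewrite scaler0].
Qed.

Lemma ell2_tail xi (e : R) : 0 < e -> exists A : {fset G},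
  forall D : {fset G}, [disjoint D & A]%fset -> \sum_(s <- D) nrm (xi s) ^+ 2 <= e.
Proof.
apply: bounded_sum_tail => [s|]; first exact: sqr_ge0.
exact: ell2_sum_le.
Qed.

Lemma delta_hsum xi : hsum (fun s => xi s *: delta R s) xi.
Proof.
move=> e e0; have [A hA] := ell2_tail xi (exprn_gt0 2 e0); exists A => D AD.
apply/ell2_nrm_leP => [|X]; first exact: ltW.
apply: (@le_trans _ _ (\sum_(s <- (X `\` D)%fset) nrm (xi s) ^+ 2)); last first.
  apply: hA; apply/fdisjointP => s; rewrite inE => /andP[sD _].
  by apply: contra sD; exact: (fsubsetP AD).
have -> : \sum_(s <- (X `\` D)%fset) nrm (xi s) ^+ 2 =
    \sum_(s <- (X `\` D)%fset) nrm ((\sum_(s <- D) xi s *: delta R s - xi) s) ^+ 2.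
  apply: eq_big_seq => s; rewrite inE => /andP[/negbTE sD _].
  by rewrite ell2BE sum_deltaE sD mul0r sub0r nrmN.
rewrite (@big_fset_incl _ _ _ _ (X `\` D)%fset X) ?fsubsetDl// => s sX.
rewrite inE sX andbT negbK => sD.
by rewrite ell2BE sum_deltaE sD mul1r subrr nrm0 expr0n.
Qed.

Lemma inner_hsum xi eta : hsum (fun s => xi s * (eta s : R[i])^* : R[i]^o) (inner xi eta).
Proof.
have [l hl] : exists l : R[i]^o, hsum (fun s => xi s * (eta s : R[i])^* : R[i]^o) l.
  apply: (@hsum_of_abs _ _ _ _ (nrm xi ^+ 2 + nrm eta ^+ 2)).
    exact: complex_complete.
  move=> A; apply: (@le_trans _ _ (\sum_(s <- A) (nrm (xi s) ^+ 2 + nrm (eta s) ^+ 2))).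
    apply: ler_sum => s _; rewrite nrmM nrm_conj.
    set a := nrm _; set b := nrm _; rewrite -subr_ge0.
    have -> : a ^+ 2 + b ^+ 2 - a * b = ((a - b) ^+ 2 + (a ^+ 2 + b ^+ 2)) / 2 by field.
    by rewrite divr_ge0// !addr_ge0 ?sqr_ge0.
  by rewrite big_split lerD ?ell2_sum_le.
by rewrite /inner (hsumP hl).
Qed.

Lemma innerZD (a : R[i]) xi eta zeta :
  inner (a *: xi + eta) zeta = a * inner xi zeta + inner eta zeta.
Proof.
apply: (hsum_uniq (inner_hsum (a *: xi + eta) zeta)).
have [Ta TaE] : exists T : bop R[i]^o R[i]^o, forall z, T z = a *: z.
  apply: (@bop_ex _ _ _ ( *:%R a) (Normc.normc a)) => [b x y|x].
    by rewrite scalerDr !scalerA mulrC.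
  by rewrite nrmZ.
have h := hsum_bop Ta (inner_hsum xi zeta); rewrite TaE in h.
apply: (hsum_ext _ (hsumD h (inner_hsum eta zeta))) => s.
by rewrite TaE ell2DE ell2ZE mulrDl -mulrA.
Qed.

Lemma inner_conj xi eta : inner eta xi = (inner xi eta)^*.
Proof.
apply: (hsum_uniq (inner_hsum eta xi)) => e e0.
have [A hA] := inner_hsum xi eta e0; exists A => D /hA.
rewrite -nrm_conj rmorphB rmorph_sum /=; congr (nrm (_ - _) <= _).
by apply: eq_bigr => s _; rewrite rmorphM /= conjCK mulrC.
Qed.

Lemma inner_self xi : inner xi xi = (nrm xi ^+ 2)%:C%C.
Proof.
apply: (hsum_uniq (inner_hsum xi xi)) => e e0.
have [A hA] := ell2_tail xi e0; exists A => D AD.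
under eq_bigr do rewrite mul_conj.
rewrite -rmorph_sum -rmorphB nrm_real ler_norml /=; apply/andP; split; last first.
  by rewrite (le_trans _ (ltW e0))// subr_le0 ell2_sum_le.
rewrite lerBrDr [leLHS]addrC lerBlDr.
set s := \sum_(i <- D) _.
have s0 : 0 <= s + e by rewrite addr_ge0 ?sumr_ge0 ?(ltW e0)// => i _; exact: sqr_ge0.
rewrite -[s + e]sqr_sqrtr// ler_sqr ?nnegrE ?nrm_ge0 ?sqrtr_ge0//.
apply/ell2_nrm_leP => [|X]; first exact: sqrtr_ge0.
rewrite sqr_sqrtr//.
apply: (@le_trans _ _ (\sum_(i <- (D `|` X)%fset) nrm (xi i) ^+ 2)).
  rewrite (@sum_fset_split _ _ _ X (D `|` X)%fset) ?fsubsetUr// lerDl.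
  by rewrite sumr_ge0// => i _; exact: sqr_ge0.
rewrite (@sum_fset_split _ _ _ D (D `|` X)%fset) ?fsubsetUl// lerD2l hA//.
apply/fdisjointP => i; rewrite inE => /andP[iD _].
by apply: contra iD; exact: (fsubsetP AD).
Qed.

Lemma inner_le xi eta : nrm (inner xi eta : R[i]^o) <= nrm xi * nrm eta.
Proof.
apply: (hsum_nrm_le (inner_hsum xi eta)) => A.
rewrite -ler_sqr ?nnegrE ?nrm_ge0 ?mulr_ge0 ?nrm_ge0//.
apply: (le_trans (cauchy_schwarz_complex _ _ _)); rewrite exprMn.
apply: ler_pM; rewrite ?ell2_sum_le//; try by apply: sumr_ge0 => i _; exact: sqr_ge0.
by under eq_bigr do rewrite nrm_conj; exact: ell2_sum_le.
Qed.

Lemma inner_fun_ex eta : exists f : bop ell R[i]^o, forall xi, f xi = inner xi eta.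
Proof.
apply: (@bop_ex R ell R[i]^o (fun xi => (inner xi eta : R[i]^o)) (nrm eta)) => [a x y|x].
  exact: innerZD.
by rewrite mulrC inner_le.
Qed.

Lemma inner_suml (J : Type) (r : seq J) (F : J -> ell) eta :
  inner (\sum_(j <- r) F j) eta = \sum_(j <- r) inner (F j) eta.
Proof.
have [f fE] := inner_fun_ex eta; rewrite -fE linear_sum.
by apply: eq_bigr => j _; exact: fE.
Qed.

Lemma innerZl (a : R[i]) xi zeta : inner (a *: xi) zeta = a * inner xi zeta.
Proof.
have [f fE] := inner_fun_ex zeta; by rewrite -(fE (a *: xi)) linearZ /= fE.
Qed.

Lemma inner_delta xi s : inner xi (delta R s) = xi s.
Proof.
apply: (hsum_uniq (inner_hsum xi (delta R s))).
have := @hsum_fin _ _ _ (fun t => xi t * (delta R s t : R[i])^* : R[i]^o) [fset s]%fset.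
rewrite big_seq_fset1 deltaE eqxx rmorph1 mulr1; apply => t.
by rewrite inE deltaE => /negbTE ->; rewrite rmorph0 mulr0.
Qed.

Lemma delta_inner eta s : inner (delta R s) eta = (eta s : R[i])^*.
Proof. by rewrite inner_conj inner_delta. Qed.

(** Testing on the basis forces the coordinates of S eta. They are square-summable because over a
    finite set they form a vector v with |v|^2 = <T v, eta> <= |T| |eta| |v|. *)
Lemma adjoint_ex T : exists S, forall xi eta, inner (T xi) eta = inner xi (S eta).
Proof.
have ex eta : exists zeta : ell, zeta = (fun s => inner eta (T (delta R s))) :> (G -> R[i]^o).
  apply: (@ell2_ex _ _ _ _ ((nrm T * nrm eta) ^+ 2)) => A.
  set c := fun s => inner eta (T (delta R s)).
  set N := \sum_(s <- A) _.
  have N0 : 0 <= N by apply: sumr_ge0 => s _; exact: sqr_ge0.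
  pose v : ell := \sum_(s <- A) c s *: delta R s.
  have nv : nrm v ^+ 2 = N.
    rewrite (@ell2_nrm_fin _ _ _ v A) => [|s /negbTE sA]; last first.
      by rewrite sum_deltaE sA mul0r.
    by apply: eq_big_seq => s sA; rewrite sum_deltaE sA mul1r.
  have iv : inner (T v) eta = N%:C%C.
    rewrite linear_sum inner_suml rmorph_sum; apply: eq_bigr => s _.
    by rewrite linearZ /= innerZl (inner_conj eta); exact: mul_conj.
  have : N <= nrm T * nrm eta * nrm v.
    have := inner_le (T v) eta; rewrite iv nrm_real ger0_norm// => /le_trans; apply.
    by rewrite mulrAC ler_wpM2r ?nrm_ge0// nrm_bopP.
  rewrite -nv; have [->|v0] := eqVneq (nrm v) 0.
    by rewrite expr0n sqr_ge0.
  have {}v0 : 0 < nrm v by rewrite lt_neqAle eq_sym v0 nrm_ge0.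
  rewrite expr2 ler_pM2r// => h.
  by rewrite -expr2 ler_sqr ?nnegrE ?mulr_ge0 ?nrm_ge0.
have [f fE] := choice ex.
have fi xi eta : inner (T xi) eta = inner xi (f eta).
  have [g gE] := inner_fun_ex eta.
  have h := hsum_bop g (hsum_bop T (delta_hsum xi)); rewrite gE in h.
  apply: (hsum_uniq h); apply: (hsum_ext _ (inner_hsum xi (f eta))) => s.
  by rewrite gE fE linearZ innerZl -inner_conj.
have fb eta : nrm (f eta) <= nrm T * nrm eta.
  have [->|v0] := eqVneq (nrm (f eta)) 0; first by rewrite mulr_ge0 ?nrm_ge0.
  have {}v0 : 0 < nrm (f eta) by rewrite lt_neqAle eq_sym v0 nrm_ge0.
  rewrite -(ler_pM2r v0) -expr2.
  have := inner_le (T (f eta)) eta.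
  rewrite fi inner_self nrm_real ger0_norm ?sqr_ge0// => /le_trans; apply.
  by rewrite mulrAC ler_wpM2r ?nrm_ge0// nrm_bopP.
have [|S SE] := @bop_ex _ _ _ f (nrm T) _ fb.
  move=> a x y; apply: ell2_eq => s.
  by rewrite fE ell2DE ell2ZE fE fE innerZD.
by exists S => xi eta; rewrite SE fi.
Qed.

Lemma adjointP T xi eta : inner (T xi) eta = inner xi (adjoint T eta).
Proof.
have /= := @getPex _ [set S : B | forall xi eta, inner (T xi) eta = inner xi (S eta)].
by apply; exact: adjoint_ex.
Qed.

Lemma adjointPl T xi eta : inner (adjoint T xi) eta = inner xi (T eta).
Proof. by rewrite inner_conj -adjointP -inner_conj. Qed.

Lemma inner_eq xi eta : (forall zeta, inner zeta xi = inner zeta eta) -> xi = eta.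
Proof.
move=> h; apply: ell2_eq => s; have := h (delta R s); rewrite !delta_inner => /(congr1 Num.conj).
by rewrite !conjCK.
Qed.

Lemma adjoint_uniq T S : (forall xi eta, inner (T xi) eta = inner xi (S eta)) -> adjoint T = S.
Proof.
by move=> h; apply: bop_eq => eta; apply: inner_eq => xi; rewrite -adjointP h.
Qed.

End InnerProduct.

Section RowColumnAdjoint.
Variables (R : realType) (G : groupType).
Notation ell := (ell2 G R[i]^o).
Notation B := (B_ell2 R G).
Variables (J : Type) (r : seq J).
Implicit Types (a b : J -> B) (C D : R).

Lemma inner_sum_le (u v : J -> ell) :
  nrm (\sum_(k <- r) inner (u k) (v k) : R[i]^o) ^+ 2
    <= (\sum_(k <- r) nrm (u k) ^+ 2) * \sum_(k <- r) nrm (v k) ^+ 2.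
Proof.
apply: (le_trans _ (cauchy_schwarz_real r (fun j => nrm (u j)) (fun j => nrm (v j)))).
have s0 : 0 <= \sum_(j <- r) nrm (u j) * nrm (v j).
  by apply: sumr_ge0 => j _; rewrite mulr_ge0 ?nrm_ge0.
rewrite ler_sqr ?nnegrE ?nrm_ge0// (le_trans (nrm_sum _ _ _))//.
by apply: ler_sum => j _; exact: inner_le.
Qed.

Lemma inner_sum_self (f g : J -> B) xi :
  (forall k, inner (f k xi) xi = inner (g k xi) (g k xi)) ->
  \sum_(k <- r) nrm (g k xi) ^+ 2 <= nrm (\sum_(k <- r) f k) * nrm xi ^+ 2.
Proof.
move=> fg; have e : inner ((\sum_(k <- r) f k) xi) xi =
    (\sum_(k <- r) nrm (g k xi) ^+ 2)%:C%C.
  rewrite bop_sumE inner_suml rmorph_sum; apply: eq_bigr => k _.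
  by rewrite fg inner_self.
have s0 : 0 <= \sum_(k <- r) nrm (g k xi) ^+ 2.
  by apply: sumr_ge0 => k _; exact: sqr_ge0.
have := inner_le ((\sum_(k <- r) f k) xi) xi; rewrite e nrm_real ger0_norm//.
by move=> /le_trans; apply; rewrite expr2 mulrA ler_wpM2r ?nrm_ge0// nrm_bopP.
Qed.

Lemma sqr_cancel (x y : R) : 0 <= x -> 0 <= y -> x ^+ 2 <= y * x -> x <= y.
Proof.
move=> x0 y0; have [->//|xn] := eqVneq x 0.
by rewrite expr2 ler_pM2r// lt_neqAle eq_sym xn.
Qed.

(** For v = sum a_k z_k one has |v|^2 = sum <z_k, a_k^* v>, and the a_k^* v have total square norm
    at most C |v|^2. Cauchy-Schwarz bounds |v|^4 by a multiple of |v|^2, and one factor cancels. *)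
Lemma row_bound_of_nrm a C :
  nrm (\sum_(k <- r) a k \oB adjoint (a k)) <= C -> row_bound r a C.
Proof.
move=> aC z; set v := \sum_(k <- r) a k (z k).
have C0 : 0 <= C by rewrite (le_trans _ aC) ?nrm_ge0.
have z0 : 0 <= \sum_(k <- r) nrm (z k) ^+ 2 by apply: sumr_ge0 => k _; exact: sqr_ge0.
apply: sqr_cancel; rewrite ?sqr_ge0 ?mulr_ge0//.
have -> : (nrm v ^+ 2) ^+ 2 = nrm (\sum_(k <- r) inner (z k) (adjoint (a k) v) : R[i]^o) ^+ 2.
  congr (_ ^+ 2); have := inner_self v; rewrite {1}/v inner_suml.
  under eq_bigr do rewrite adjointP.
  by move=> ->; rewrite nrm_real ger0_norm ?sqr_ge0.
apply: (le_trans (inner_sum_le _ _)); rewrite -mulrA mulrCA ler_wpM2l//.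
have h := @inner_sum_self (fun k => a k \oB adjoint (a k)) (fun k => adjoint (a k)) v
  (fun k => adjointP (a k) (adjoint (a k) v) v).
apply: (le_trans h).
by rewrite ler_wpM2r ?sqr_ge0.
Qed.

Lemma col_bound_of_nrm b D :
  nrm (\sum_(k <- r) adjoint (b k) \oB b k) <= D -> col_bound r b D.
Proof.
move=> bD xi; have h := @inner_sum_self (fun k => adjoint (b k) \oB b k) b xi
  (fun k => adjointPl (b k) (b k xi) xi).
apply: (le_trans h).
by rewrite ler_wpM2r ?sqr_ge0.
Qed.

(** For T the sum, |T xi|^2 = sum <b_k xi, b_k T xi>; the column bound is used at xi and at T xi,
    and a factor |T xi|^2 cancels. *)
Lemma nrm_of_col_bound b D : 0 <= D -> col_bound r b D ->
  nrm (\sum_(k <- r) adjoint (b k) \oB b k) <= D.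
Proof.
move=> D0 bD; apply/opnorm_leP => // xi; set T := \sum_(k <- r) _.
rewrite -ler_sqr ?nnegrE ?mulr_ge0 ?nrm_ge0//.
apply: sqr_cancel; rewrite ?sqr_ge0//.
have e : (nrm (T xi) ^+ 2)%:C%C = \sum_(k <- r) inner (b k xi) (b k (T xi)).
  rewrite -inner_self {1}/T bop_sumE inner_suml; apply: eq_bigr => k _.
  by rewrite bop_compE adjointPl.
have -> : (nrm (T xi) ^+ 2) ^+ 2 = nrm (\sum_(k <- r) inner (b k xi) (b k (T xi)) : R[i]^o) ^+ 2.
  by rewrite -e nrm_real ger0_norm ?sqr_ge0.
apply: (le_trans (inner_sum_le _ _)).
have -> : (D * nrm xi) ^+ 2 * nrm (T xi) ^+ 2 = (D * nrm xi ^+ 2) * (D * nrm (T xi) ^+ 2).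
  by ring.
by apply: ler_pM; rewrite ?bD//; apply: sumr_ge0 => k _; exact: sqr_ge0.
Qed.

End RowColumnAdjoint.

(** * Tails of series *)

Section BoundTails.
Variables (R : realType) (V : normedModType R[i]).

(** The Cauchy criterion for an arbitrary size predicate on intervals of indices. The same tail
    statement can then be read for norms of sums and for row or column bounds. *)
Definition tail_small (P : seq nat -> R -> Prop) :=
  (exists2 M : R, 0 <= M & forall m n, P (index_iota m n) M) /\
  forall e : R, 0 < e -> exists N, forall m n, (N <= m)%N -> P (index_iota m n) e.

Lemma series_tail (f : nat -> V) : cvgn (series f) ->
  tail_small (fun r c => nrm (\sum_(k <- r) f k) <= c).
Proof.
move=> /is_cvg_tends/tends_cauchy cf.
have tl (e : R) : 0 < e -> exists N, forall m n, (N <= m)%N ->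
    nrm (\sum_(m <= k < n) f k) <= e.
  move=> e0; have [N hN] := cf e e0; exists N => m n Nm.
  have [nm|mn] := leqP n m; first by rewrite big_geq// nrm0 ltW.
  have := hN n m (leq_trans Nm (ltnW mn)) Nm.
  by rewrite !seriesEnat /= (big_cat_nat (n := m) (p := n))//= 1?ltnW// addrAC subrr add0r.
split=> //; have [N hN] := tl 1 ltr01.
exists (\sum_(0 <= k < N) nrm (f k) + 1) => [|m n].
  by rewrite addr_ge0 ?sumr_ge0// => k _; exact: nrm_ge0.
rewrite -/(\sum_(m <= k < n) f k).
have [Nm|mN] := leqP N m.
  by rewrite (le_trans (hN _ _ Nm))// lerDr sumr_ge0// => k _; exact: nrm_ge0.
have sub m' n' : (n' <= N)%N -> \sum_(m' <= k < n') nrm (f k) <= \sum_(0 <= k < N) nrm (f k).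
  move=> n'N; have [h|h] := leqP n' m'.
    by rewrite big_geq// sumr_ge0// => k _; exact: nrm_ge0.
  rewrite (big_cat_nat (n := m') (p := N))//=; last exact: leq_trans (ltnW h) n'N.
  rewrite (big_cat_nat (m := m') (n := n') (p := N))//= 1?ltnW//.
  rewrite addrCA lerDl addr_ge0// sumr_ge0// => k _; exact: nrm_ge0.
have [Nn|nN] := leqP N n.
  rewrite (big_cat_nat (n := N))//= 1?ltnW// (le_trans (nrmD _ _))// lerD ?hN//.
  by rewrite (le_trans (nrm_sum _ _ _))// sub.
rewrite (le_trans (nrm_sum _ _ _))// (le_trans (sub _ _ (ltnW nN)))//.
by rewrite lerDl.
Qed.

Lemma series_cvg_of_tail (f : nat -> V) : seq_complete V ->
  tail_small (fun r c => nrm (\sum_(k <- r) f k) <= c) -> cvgn (series f).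
Proof.
move=> cV [_ tl]; have [|l] := cV (series f); last exact: tends_is_cvg.
move=> e e0; have [N hN] := tl e e0; exists N => m n.
wlog mn : m n / (m <= n)%N => [hw Nm Nn|Nm Nn].
  have [mn|/ltnW nm] := leqP m n; first exact: hw.
  by rewrite nrmBC hw.
rewrite nrmBC !seriesEnat /= (big_cat_nat (n := m) (p := n))//=.
by rewrite addrAC subrr add0r; exact: hN.
Qed.

Lemma tail_small_imp (P Q : seq nat -> R -> Prop) :
  (forall r c, 0 <= c -> P r c -> Q r c) -> tail_small P -> tail_small Q.
Proof.
move=> PQ [[M M0 hM] tl]; split; first by exists M => // m n; exact: PQ.
move=> e e0; have [N hN] := tl e e0; exists N => m n Nm.
by apply: PQ; [exact: ltW|exact: hN].
Qed.

End BoundTails.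

Lemma nbhs_nrm (R : realType) (V : normedModType R[i]) (x : V) (e : R) : 0 < e ->
  nbhs x [set y | nrm (y - x) <= e].
Proof.
move=> e0; have /cvgrPdist_le/(_ e%:C%C) := @cvg_id _ (nbhs x).
rewrite ltcR => /(_ e0); apply: filterS => y.
by rewrite distrC -nrmE lecR.
Qed.

Lemma bopB (R : realType) (H K : normedModType R[i]) (T : bop H K) x y :
  T (x - y) = T x - T y.
Proof. exact: linearB. Qed.

Lemma sub_telescope3 (V : zmodType) (a b c d : V) :
  a - d = (a - b) + (b - c) + (c - d).
Proof. by rewrite !subrKA. Qed.

(** * Coordinate projections, matrix units and truncation of compact operators *)

HB.lock Definition cproj (R : realType) (G : groupType) (A : {fset G}) : B_ell2 R G :=
  mulop (fun s => (s \in A)%:R).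

(** The matrix unit e_{p,q}, written as a multiplication operator times a translation, the form in
    which elements of the crossed product arise. *)
HB.lock Definition unitop (R : realType) (G : groupType) (p q : G) : B_ell2 R G :=
  mulop (fun s => (s == p)%:R) \oB lambda R[i]^o (p * q^-1)%g.

Arguments cproj {R G} A.
Arguments unitop {R G} p q.

Section UnitsAndProjections.
Variables (R : realType) (G : groupType).
Notation ell := (ell2 G R[i]^o).
Notation B := (B_ell2 R G).
Notation cproj := (@cproj R G).
Notation unitop := (@unitop R G).
Implicit Types (xi eta : ell) (T S : B) (p q s t : G) (A D : {fset G}).

Lemma fin_c0 A (a : G -> R[i]) : (forall s, s \notin A -> a s = 0) -> c0 a.
Proof.
move=> a0 e e0; apply: (sub_finite_set _ (finite_fset A)) => s /= es.
by apply: contraTT es => /a0 ->; rewrite normr0 lt_geF.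
Qed.

Lemma c0_ind A : c0 (fun s => (s \in A)%:R : R[i]).
Proof. by apply: (@fin_c0 A) => s /negbTE ->. Qed.

Lemma c0_ind1 p : c0 (fun s => (s == p)%:R : R[i]).
Proof. by apply: (@fin_c0 [fset p]%fset) => s; rewrite inE => /negbTE ->. Qed.

Lemma projE A xi s : cproj A xi s = (s \in A)%:R * xi s.
Proof. by rewrite cproj.unlock mulopE//; exact: c0_ind. Qed.

Lemma unitopE p q xi s : unitop p q xi s = (s == p)%:R * xi q.
Proof.
rewrite unitop.unlock bop_compE mulopE; last exact: c0_ind1.
rewrite lambdaE; case: eqP => [->|_]; last by rewrite !mul0r.
by congr (_ * xi _); apply: (mulgI (p * q^-1)%g); rewrite mulVKg mulgVK.
Qed.

Definition mxcoef (T : B) p q : R[i] := T (delta R q) p.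

Lemma mxcoef_unitop p q s t : mxcoef (unitop p q) s t = (s == p)%:R * (q == t)%:R.
Proof. by rewrite /mxcoef unitopE. Qed.

Lemma mxcoef_le T p q : Normc.normc (mxcoef T p q) <= nrm T.
Proof.
rewrite -nrm_normc (le_trans (ell2_coord_le _ _))//.
by rewrite (le_trans (nrm_bopP _ _))// nrm_delta mulr1.
Qed.

Lemma nrm_lambda (V : normedModType R[i]) t : nrm (lambda V t) <= 1.
Proof.
apply/opnorm_leP => // xi; rewrite mul1r; apply/ell2_nrm_leP => [|A].
  exact: nrm_ge0.
under eq_bigr do rewrite lambdaE.
apply: (le_trans _ (ell2_sum_le xi [fset t^-1 * s | s in A]%g%fset)).
rewrite big_imfset //= => u v _ _; exact: mulgI.
Qed.

Lemma nrm_proj A : nrm (cproj A) <= 1.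
Proof.
apply/opnorm_leP => // xi; rewrite mul1r; apply/ell2_nrm_leP => [|D].
  exact: nrm_ge0.
apply: (le_trans _ (ell2_sum_le xi D)); apply: ler_sum => s _.
rewrite projE; case: (s \in A); rewrite ?mul1r// mul0r nrm0 expr0n; exact: sqr_ge0.
Qed.

Lemma proj_tail xi (e : R) : 0 < e ->
  exists A, forall D, (A `<=` D)%fset -> nrm (xi - cproj D xi) <= e.
Proof.
move=> e0; have [A hA] := ell2_tail xi (exprn_gt0 2 e0); exists A => D AD.
apply/ell2_nrm_leP => [|X]; first exact: ltW.
apply: (le_trans _ (hA (X `\` D)%fset _)); last first.
  apply/fdisjointP => s; rewrite inE => /andP[sD _].
  by apply: contra sD; exact: (fsubsetP AD).
rewrite -(@big_fset_incl _ _ _ _ (X `\` D)%fset X) ?fsubsetDl//; last first.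
  move=> s sX; rewrite inE sX andbT negbK => sD.
  by rewrite (ell2BE xi (cproj D xi)) (projE D xi s) sD mul1r subrr nrm0 expr0n.
rewrite le_eqVlt; apply/orP; left; apply/eqP; apply: eq_big_seq => s.
by rewrite inE => /andP[/negbTE sD _]; rewrite (ell2BE xi (cproj D xi)) (projE D xi s) sD mul0r subr0.
Qed.

(** The projections converge strongly to 1 and are contractions, so they converge uniformly on the
    compact closure of the image of the unit ball; the near-covering form of compactness yields one
    [A] for the whole set. *)
Lemma compact_trunc_l T : compact_op R G T -> forall e : R, 0 < e ->
  exists A, forall D, (A `<=` D)%fset -> nrm (T - cproj D \oB T) <= e.
Proof.
move=> cT e e0; have e2 : 0 < e / 3 by rewrite divr_gt0.
move: cT; rewrite /compact_op /= precompactE => /compact_near_coveringP cT.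
have [|A _ hA] := @cT _ summability.totally (fun D x => nrm (x - cproj D x) <= e)
  summability.totally_filter; last first.
  exists A => D AD; apply: opnorm_le_unit => xi x1.
  rewrite (bopBE T (cproj D \oB T) xi) (bop_compE (cproj D) T xi).
  by apply: (hA D AD); apply: subset_closure; exists xi.
move=> x _; have [A hA] := proj_tail x e2.
exists ([set y | nrm (y - x) <= e / 3], [set D | (A `<=` D)%fset]).
  by split; [exact: nbhs_nrm|exists A].
move=> [y D] /= [yx AD]; rewrite (_ : y - _ = (y - x) + (x - cproj D x) + cproj D (x - y)).
  have -> : e = e / 3 + e / 3 + e / 3 by field.
  rewrite (le_trans (nrmD _ _))// lerD//.
    by rewrite (le_trans (nrmD _ _))// lerD// hA.
  rewrite (le_trans (nrm_bopP _ _))// nrmBC (le_trans _ yx)//.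
  by rewrite ler_piMl ?nrm_ge0 ?nrm_proj.
by rewrite linearB addrA subrKA subrK.
Qed.

(* The adjoint turns right truncation of T into truncation of the vectors
   [adjoint T delta_s], of which only finitely many matter after truncating
   on the left. *)
Lemma compact_trunc_r T : compact_op R G T -> forall e : R, 0 < e ->
  exists A, forall D, (A `<=` D)%fset -> nrm (T - T \oB cproj D) <= e.
Proof.
move=> cT e e0; have e2 : 0 < e / 3 by rewrite divr_gt0.
have [A hA] := compact_trunc_l cT e2; have {}hA := hA A (fsubset_refl A).
(* Each of the |A| coordinates gets an equal share of e / 3; the successor covers the case of an
   empty [A]. *)
pose d := e / 3 / (size A).+1%:R.
have d0 : 0 < d by rewrite divr_gt0.
have /choice[f hf] : forall s, exists X : {fset G}, forall D, (X `<=` D)%fset ->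
    nrm (adjoint T (delta R s) - cproj D (adjoint T (delta R s))) <= d.
  by move=> s; exact: proj_tail.
exists (\bigcup_(s <- A) f s)%fset => D fD.
have -> : T - T \oB cproj D = (T - cproj A \oB T) + (cproj A \oB T - cproj A \oB T \oB cproj D)
    + (cproj A \oB T - T) \oB cproj D.
  by rewrite (compBl (cproj A \oB T) T (cproj D)); exact: sub_telescope3.
have -> : e = e / 3 + e / 3 + e / 3 by field.
apply: (le_trans (nrmD _ _)); apply: lerD; last first.
  apply: (le_trans (nrm_comp _ _)); rewrite nrmBC; apply: (le_trans _ hA).
  by rewrite ler_piMr ?nrm_ge0 ?nrm_proj.
apply: (le_trans (nrmD _ _)); apply: (lerD hA).
apply/opnorm_leP => [|xi]; first exact: ltW.
have -> : (cproj A \oB T - cproj A \oB T \oB cproj D) xi = cproj A (T (xi - cproj D xi)).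
  by rewrite (bopB T) (bopB (cproj A)).
set eta := xi - cproj D xi.
have -> : cproj A (T eta) = \sum_(s <- A) T eta s *: delta R s.
  by apply: ell2_eq => s; rewrite (projE A (T eta) s) sum_deltaE.
rewrite (le_trans (nrm_sum _ _ _))//.
apply: (@le_trans _ _ (\sum_(s <- A) d * nrm xi)); last first.
  rewrite big_const_seq count_predT iter_addr_0 -[leLHS]mulr_natl mulrA ler_wpM2r ?nrm_ge0//.
  rewrite /d mulrCA ler_piMr ?(ltW e2)// ler_pdivrMr// mul1r ler_nat.
  exact: leqnSn.
rewrite big_seq [leRHS]big_seq; apply: ler_sum => s sA.
rewrite nrmZ nrm_delta mulr1 -nrm_normc -inner_delta adjointP.
set v := adjoint T (delta R s).
(* The projection is self-adjoint, so the truncation moves from xi to the fixed vector v, where it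
   is small uniformly in xi. *)
have -> : inner eta v = inner xi (v - cproj D v).
  have pd x y : inner (cproj D x) y = inner x (cproj D y).
    apply: (hsum_uniq (inner_hsum _ _)); apply: hsum_ext (inner_hsum _ _) => t.
    by rewrite (projE D x t) (projE D y t) rmorphM rmorph_nat mulrCA mulrA.
  have sub x y : x - y = (-1) *: y + x :> ell by rewrite scaleN1r addrC.
  rewrite (inner_conj (v - cproj D v) xi) /eta (sub v) (sub xi) !innerZD pd.
  by rewrite rmorphD rmorphM rmorphN1 /= -(inner_conj (cproj D v)) -(inner_conj v).
rewrite (le_trans (inner_le _ _))// mulrC ler_wpM2r ?nrm_ge0// hf//.
by rewrite (fsubset_trans _ fD)//; exact: bigfcup_sup.
Qed.

End UnitsAndProjections.

Lemma mxnorm_le_unif (R : realType) (H K : normedModType R[i]) m (z : 'M[bop H K]_m)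
    (e : R) : 0 <= e -> (forall i j, nrm (z i j) <= e) -> mxnorm z <= m%:R * e.
Proof.
move=> e0 ze; apply: mxnorm_le => [|xi]; first by rewrite mulr_ge0.
apply: (@le_trans _ _ (\sum_(i < m) e ^+ 2 * (\sum_(j < m) 1 * nrm (xi j)) ^+ 2)).
  apply: ler_sum => i _; rewrite -exprMn ler_sqr ?nnegrE ?nrm_ge0//; last first.
    by rewrite mulr_ge0 ?sumr_ge0// => j _; rewrite mul1r nrm_ge0.
  apply: (le_trans (nrm_sum _ _ _)); rewrite mulr_sumr; apply: ler_sum => j _.
  by rewrite mul1r (le_trans (nrm_bopP _ _))// ler_wpM2r ?nrm_ge0.
rewrite sumr_const card_ord -[leLHS]mulr_natl.
have -> : (m%:R * e) ^+ 2 = m%:R * (e ^+ 2 * m%:R) by ring.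
rewrite -mulrA ler_wpM2l ?ler0n// -mulrA ler_wpM2l ?sqr_ge0//.
apply: (le_trans (cauchy_schwarz_real _ _ _)).
by rewrite expr1n sumr_const card_ord.
Qed.

(** For fixed m entrywise convergence is norm convergence, so a bound uniform in n survives with the
    same constant. *)
Lemma mxnorm_tends_le (R : realType) (H K : normedModType R[i]) m
    (x : nat -> 'M[bop H K]_m) (y : 'M[bop H K]_m) (c : R) N :
  (forall i j, tends (fun n => x n i j) (y i j)) ->
  (forall n, (N <= n)%N -> mxnorm (x n) <= c) -> mxnorm y <= c.
Proof.
move=> xy xc; apply/ler_addgt0Pr => e e0.
have d0 : 0 < e / m.+1%:R by rewrite divr_gt0.
have /choice[f hf] : forall i, exists N, forall j n, (N <= n)%N ->
    nrm (x n i j - y i j) <= e / m.+1%:R.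
  move=> i; have /choice[g hg] : forall j, exists N, forall n, (N <= n)%N ->
      nrm (x n i j - y i j) <= e / m.+1%:R by move=> j; exact: xy.
  exists (\max_(j < m) g j)%N => j n gn; apply: hg.
  by rewrite (leq_trans _ gn)//; exact: (leq_bigmax j).
pose n := maxn N (\max_(i < m) f i)%N.
have xn : mxnorm (x n) <= c by apply: xc; exact: leq_maxl.
have -> : y = x n - (x n - y) by rewrite opprB addrC subrK.
apply: (le_trans (mxnormB _ _)); apply: lerD => //.
apply: (le_trans (mxnorm_le_unif (ltW d0) _)) => [i j|].
  rewrite !mxE; apply: hf; rewrite (leq_trans _ (leq_maxr _ _))//.
  exact: (leq_bigmax i).
rewrite mulrCA ler_piMr ?(ltW e0)// ler_pdivrMr// mul1r ler_nat.
exact: leqnSn.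
Qed.

Lemma mx_addsubE (V : zmodType) m n (x y z : 'M[V]_(m, n)) i j :
  (x + y - z) i j = x i j + y i j - z i j.
Proof. by rewrite !mxE. Qed.

Lemma comp_trunc_split (R : realType) (H : normedModType R[i]) (P a z b : bop H H) :
  (a - P \oB a) \oB z \oB b + (P \oB a) \oB z \oB (b - b \oB P)
    = a \oB z \oB b - P \oB (a \oB z \oB b) \oB P.
Proof.
apply: bop_eq => x.
change (a (z (b x)) - P (a (z (b x))) + P (a (z (b x - b (P x)))) =
  a (z (b x)) - P (a (z (b (P x))))).
by rewrite (bopB z) (bopB a) (bopB P) subrKA.
Qed.

(** * The completely bounded map of a Haagerup series *)

Section GammaSeries.
Variables (R : realType) (G : groupType).
Notation B := (B_ell2 R G).
Variables (a b : nat -> B).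
Hypothesis ha : tail_small (fun r (c : R) => row_bound r a c).
Hypothesis hb : tail_small (fun r (c : R) => col_bound r b c).

Lemma B_complete : seq_complete B.
Proof. by apply: bop_complete; apply: ell2_complete; exact: complex_complete. Qed.

Lemma gamma_tail_small (x : B) :
  tail_small (fun r (c : R) => nrm (\sum_(k <- r) a k \oB x \oB b k) <= c).
Proof.
have [[Ma Ma0 hMa] ta] := ha; have [[Mb Mb0 hMb] tb] := hb.
split.
  exists (Num.sqrt (Ma * Mb) * nrm x) => [|m n].
    by rewrite mulr_ge0 ?sqrtr_ge0 ?nrm_ge0.
  exact: row_col_nrm.
move=> e e0; have x0 : 0 < nrm x + 1 by rewrite ltr_wpDl ?nrm_ge0.
have d0 : 0 < e / (nrm x + 1) by rewrite divr_gt0.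
have [N hN] := ta _ d0; have [M hM] := tb _ d0.
exists (maxn N M) => m n; rewrite geq_max => /andP[Nm Mm].
apply: (le_trans (row_col_nrm _ (ltW d0) (ltW d0) (hN m n Nm) (hM m n Mm))).
rewrite -expr2 sqrtr_sqr ger0_norm ?(ltW d0)// -mulrA -[leRHS]mulr1.
by rewrite ler_wpM2l ?(ltW e0)// ler_pdivrMl// mulr1 lerDl.
Qed.

Definition gamma_partial n (x : B) : B := \sum_(k <- index_iota 0 n) a k \oB x \oB b k.

Lemma gamma_tends (x : B) : tends (fun n => gamma_partial n x) (Gamma (a, b) x).
Proof.
have := is_cvg_tends (series_cvg_of_tail B_complete (gamma_tail_small x)).
by apply: tends_ext => n; rewrite seriesEnat.
Qed.

Lemma gamma_linear (c : R[i]) (x y : B) :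
  Gamma (a, b) (c *: x + y) = c *: Gamma (a, b) x + Gamma (a, b) y.
Proof.
apply: tends_uniq (gamma_tends (c *: x + y)) _.
apply: (tends_ext _ (tendsD (tendsZ c (gamma_tends x)) (gamma_tends y))) => n.
rewrite /gamma_partial scaler_sumr -big_split /=; apply: eq_bigr => k _.
by rewrite compDr compDl compZr compZl.
Qed.

Lemma gamma_mxnorm : exists2 M : R, 0 <= M &
  forall m (x : 'M[B]_m), mxnorm (map_mx (Gamma (a, b)) x) <= M * mxnorm x.
Proof.
have [[Ma Ma0 hMa] _] := ha; have [[Mb Mb0 hMb] _] := hb.
exists (Num.sqrt (Ma * Mb)) => [|m x]; first exact: sqrtr_ge0.
apply: (@mxnorm_tends_le _ _ _ _ (fun n => map_mx (gamma_partial n) x) _ _ 0%N).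
  move=> i j; rewrite mxE; apply: (tends_ext _ (gamma_tends (x i j))) => n.
  by rewrite mxE.
by move=> n _; exact: row_col_mxnorm.
Qed.

(** A tail of the series is again a row times z times a column, with both bounds at most e. The
    remainder is therefore small in completely bounded norm and not only pointwise. *)
Lemma gamma_partial_approx (e : R) : 0 < e -> exists N, forall m (x : 'M[B]_m),
  mxnorm (map_mx (fun z => Gamma (a, b) z - gamma_partial N z) x) <= e * mxnorm x.
Proof.
move=> e0; have [_ ta] := ha; have [_ tb] := hb.
have [N hN] := ta _ e0; have [M hM] := tb _ e0.
pose p := maxn N M; exists p => m x.
apply: (@mxnorm_tends_le _ _ _ _
  (fun n => map_mx (fun z => gamma_partial n z - gamma_partial p z) x) _ _ p).
  move=> i j; rewrite mxE.
  have h := tendsD (gamma_tends (x i j)) (@tends_cst _ _ (- gamma_partial p (x i j))).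
  by apply: (tends_ext _ h) => n; rewrite mxE.
move=> n pn; have h := @row_col_mxnorm _ _ _ _ _ _ (index_iota p n) a b e e m x
  (ltW e0) (ltW e0) (hN _ _ (leq_maxl _ _)) (hM _ _ (leq_maxr _ _)).
have se : Num.sqrt (e * e) = e by rewrite -expr2 sqrtr_sqr ger0_norm ?(ltW e0).
rewrite se in h.
have -> : map_mx (fun z => gamma_partial n z - gamma_partial p z) x =
    map_mx (fun z => \sum_(k <- index_iota p n) a k \oB z \oB b k) x.
  apply/matrixP => i j; rewrite [LHS]mxE [RHS]mxE /gamma_partial.
  have -> : index_iota 0 n = index_iota 0 p ++ index_iota p n.
    by rewrite /index_iota !subn0 -{2}[p]add0n -iotaD subnKC.
  by rewrite big_cat /= addrAC subrr add0r.
exact: h.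
Qed.

(** Finitely many terms suffice up to a small completely bounded error. Each of them is compressed
    by truncating a_k on the left and b_k on the right, with one [A] for all. *)
Lemma gamma_trunc : (forall k, compact_op R G (a k)) -> (forall k, compact_op R G (b k)) ->
  forall e : R, 0 < e -> exists A : {fset G}, forall m (x : 'M[B]_m),
    mxnorm (map_mx (fun z => Gamma (a, b) z
      - cproj A \oB Gamma (a, b) z \oB cproj A) x) <= e * mxnorm x.
Proof.
move=> ca cb e e0; have e3 : 0 < e / 3 by rewrite divr_gt0.
have [N hN] := gamma_partial_approx e3.
pose w := \sum_(k <- index_iota 0 N) (nrm (a k) + nrm (b k)).
have w0 : 0 <= w by apply: sumr_ge0 => k _; rewrite addr_ge0 ?nrm_ge0.
(* Truncating the k-th term costs d (|a_k| + |b_k|); these costs must add up to at most e / 3. *)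
pose d := e / 3 / (w + 1).
have d0 : 0 < d by rewrite divr_gt0// ltr_wpDl.
have /choice[f hf] : forall k, exists A : {fset G}, forall D, (A `<=` D)%fset ->
    nrm (a k - cproj D \oB a k) <= d /\ nrm (b k - b k \oB cproj D) <= d.
  move=> k; have [A hA] := compact_trunc_l (ca k) d0.
  have [A' hA'] := compact_trunc_r (cb k) d0.
  exists (A `|` A')%fset => D; rewrite fsubUset => /andP[h1 h2].
  by split; [exact: hA|exact: hA'].
pose A := (\bigcup_(k <- index_iota 0 N) f k)%fset; exists A => m x.
pose y k := map_mx (fun z => (a k - cproj A \oB a k) \oB z \oB b k
   + (cproj A \oB a k) \oB z \oB (b k - b k \oB cproj A)) x.
pose r := map_mx (fun z => Gamma (a, b) z - gamma_partial N z) x.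
pose r' := map_mx (fun z => z \oB cproj A) (map_mx (bop_comp (cproj A)) r).
have -> : map_mx (fun z => Gamma (a, b) z - cproj A \oB Gamma (a, b) z \oB cproj A) x =
    r + \sum_(k <- index_iota 0 N) y k - r'.
  apply/matrixP => i j; rewrite mx_addsubE summxE [LHS]mxE.
  have -> : r i j = Gamma (a, b) (x i j) - gamma_partial N (x i j) by rewrite mxE.
  have -> : r' i j = cproj A \oB (Gamma (a, b) (x i j) - gamma_partial N (x i j)) \oB cproj A.
    by rewrite [LHS]mxE mxE mxE.
  rewrite compBr compBl.
  have -> : \sum_(k <- index_iota 0 N) y k i j = gamma_partial N (x i j)
     - cproj A \oB gamma_partial N (x i j) \oB cproj A.
    rewrite /gamma_partial comp_sumr comp_suml -sumrB; apply: eq_bigr => k _.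
    by rewrite mxE; exact: comp_trunc_split.
  by rewrite opprB; exact: sub_telescope3.
have e3m : e * mxnorm x = e / 3 * mxnorm x + e / 3 * mxnorm x + e / 3 * mxnorm x by field.
have hr' : mxnorm r' <= e / 3 * mxnorm x.
  apply: (le_trans (mxnorm_comp_r _ _)).
  apply: (@le_trans _ _ (mxnorm (map_mx (bop_comp (cproj A)) r))).
    by rewrite ler_piMr ?mxnorm_ge0 ?nrm_proj.
  apply: (le_trans (mxnorm_comp_l _ _)).
  apply: (le_trans _ (hN m x)).
  by rewrite ler_piMl ?mxnorm_ge0 ?nrm_proj.
apply: (le_trans (mxnormB _ _)); rewrite e3m; apply: lerD => //.
apply: (le_trans (mxnormD _ _)); apply: lerD; first exact: hN.
apply: (le_trans (mxnorm_sum _ _ _)).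
apply: (@le_trans _ _ (\sum_(k <- index_iota 0 N) d * (nrm (a k) + nrm (b k)) * mxnorm x)).
  rewrite big_seq [leRHS]big_seq; apply: ler_sum => k kN.
  have fA : (f k `<=` A)%fset by exact: bigfcup_sup.
  have [h1 h2] := hf k A fA.
  have -> : y k = map_mx (fun z => z \oB b k) (map_mx (bop_comp (a k - cproj A \oB a k)) x)
     + map_mx (fun z => z \oB (b k - b k \oB cproj A)) (map_mx (bop_comp (cproj A \oB a k)) x).
    by apply/matrixP => i j; rewrite !mxE.
  rewrite mulrDr mulrDl [leRHS]addrC; apply: (le_trans (mxnormD _ _)); apply: lerD.
    apply: (le_trans (mxnorm_comp_r _ _)); rewrite mulrAC ler_wpM2r ?nrm_ge0//.
    apply: (le_trans (mxnorm_comp_l _ _)); by rewrite ler_wpM2r ?mxnorm_ge0.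
  apply: (le_trans (mxnorm_comp_r _ _)); rewrite mulrC -mulrA.
  apply: ler_pM; rewrite ?nrm_ge0 ?mxnorm_ge0//.
  apply: (le_trans (mxnorm_comp_l _ _)); rewrite ler_wpM2r ?mxnorm_ge0//.
  apply: (le_trans (nrm_comp _ _)).
  by rewrite ler_piMl ?nrm_ge0 ?nrm_proj.
rewrite -mulr_suml ler_wpM2r ?mxnorm_ge0// -mulr_sumr -/w /d.
rewrite -mulrA -[leRHS]mulr1 ler_wpM2l ?(ltW e3)// mulrC.
by rewrite ler_pdivrMr ?mul1r ?lerDl// ltr_wpDl.
Qed.

End GammaSeries.

(** * From the Haagerup tensor product to multipliers *)

Section DoubleSums.
Variable R : realType.

Lemma esum_swap (I J : choiceType) (a : I -> J -> \bar R) : (forall i j, 0 <= a i j)%E ->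
  (\esum_(i in [set: I]) \esum_(j in [set: J]) a i j
    = \esum_(j in [set: J]) \esum_(i in [set: I]) a i j)%E.
Proof.
move=> a0; rewrite !esum_esum//.
have bij : set_bij ([set: J] `*`` (fun=> [set: I])) ([set: I] `*`` (fun=> [set: J]))
    (fun k : J * I => (k.2, k.1)).
  split; first by [].
    by move=> [x y] [x' y'] _ _ [-> ->].
  by move=> [x y] _; exists (y, x).
exact: (@reindex_esum R _ _ _ _ _ (fun k : I * J => a k.1 k.2) bij).
Qed.

(** The substitution q = s r for fixed r, which makes (s, r) |-> (s r, r) an isometry. *)
Lemma esum_twist (G : groupType) (a : G -> G -> \bar R) : (forall i j, 0 <= a i j)%E ->
  (\esum_(s in [set: G]) \esum_(r in [set: G]) a r (s * r)%g
    = \esum_(r in [set: G]) \esum_(q in [set: G]) a r q)%E.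
Proof.
move=> a0; rewrite esum_swap//; apply: eq_esum => r _.
have bij : set_bij [set: G] [set: G] (fun s : G => (s * r)%g).
  split => //; first by move=> x y _ _; exact: mulIg.
  by move=> x _; exists (x * r^-1)%g => //; rewrite mulgVK.
by rewrite [RHS](@reindex_esum R _ _ _ _ _ (a r) bij).
Qed.

Lemma ell2_nrm_esum (I : choiceType) (V : normedModType R[i]) (xi : ell2 I V) :
  (\esum_(i in [set: I]) (nrm (xi i) ^+ 2)%:E)%E = (nrm xi ^+ 2)%:E.
Proof. exact: (ell2_norm_sq xi). Qed.

Lemma ell22_nrm_esum (I J : choiceType) (V : normedModType R[i])
    (xi : ell2 I (ell2 J V)) :
  (\esum_(i in [set: I]) \esum_(j in [set: J]) (nrm (xi i j) ^+ 2)%:E)%E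
    = (nrm xi ^+ 2)%:E.
Proof.
by rewrite -ell2_nrm_esum; apply: eq_esum => i _; exact: (ell2_nrm_esum (xi i)).
Qed.

Lemma ell22_ex (I J : choiceType) (V : normedModType R[i]) (f : I -> J -> V) (c : R) :
  0 <= c ->
  (\esum_(i in [set: I]) \esum_(j in [set: J]) (nrm (f i j) ^+ 2)%:E <= (c ^+ 2)%:E)%E ->
  exists xi : ell2 I (ell2 J V), (forall i j, xi i j = f i j) /\ nrm xi <= c.
Proof.
move=> c0 fc.
have /choice[g gE] : forall i, exists xi : ell2 J V, xi = f i :> (J -> V).
  move=> i; apply: (@ell2_ex _ _ _ _ (c ^+ 2)); apply/sqsum_leP.
  apply: (le_trans _ fc); apply: esum_ge; exists [set i] => //.
  by rewrite fsbig_set1.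
have gs : (sqsum g <= (c ^+ 2)%:E)%E.
  apply: (le_trans _ fc); rewrite le_eqVlt; apply/orP; left; apply/eqP.
  by apply: eq_esum => i _; rewrite -ell2_nrm_esum gE.
have [xi xiE] : exists xi : ell2 I (ell2 J V), xi = g :> (I -> ell2 J V).
  by apply: (@ell2_ex _ _ _ _ (c ^+ 2)); apply/sqsum_leP.
exists xi; split; first by move=> i j; rewrite xiE gE.
by rewrite [X in X <= _](_ : _ = ell2_norm xi)// ell2_norm_le// xiE.
Qed.

End DoubleSums.

Lemma ell22ZDE (R : realType) (I J : choiceType) (V : normedModType R[i]) (c : R[i])
    (x y : ell2 I (ell2 J V)) i j : (c *: x + y) i j = c *: x i j + y i j.
Proof. by rewrite (ell2ZDE c x y) (ell2ZDE c (x i) (y i)). Qed.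

(** * The copy of B(ell2 G) inside B(ell2 (G x G)) *)

Section Slices.
Variables (R : realType) (G : groupType).
Notation ell := (ell2 G R[i]^o).
Notation H := (ell2 G ell).
Notation B := (B_ell2 R G).
Implicit Types (xi : H) (r s q : G).

Lemma slice_ex r : exists T : bop H ell, forall xi q, T xi q = xi (q * r^-1)%g r.
Proof.
have /choice[f fE] : forall xi, exists zeta : ell,
    zeta = (fun q => xi (q * r^-1)%g r) :> (G -> R[i]^o).
  move=> xi; apply: (@ell2_ex _ _ _ _ (nrm xi ^+ 2)) => A.
  apply: (le_trans _ (ell2_sum_le xi [fset (q * r^-1)%g | q in A]%fset)).
  rewrite big_imfset /=; last by move=> u v _ _; exact: mulIg.
  apply: ler_sum => q _; rewrite ler_sqr ?nnegrE ?nrm_ge0//.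
  exact: ell2_coord_le.
have [|x|T TE] := @bop_ex _ _ _ f 1.
- move=> c x y; apply: ell2_eq => q.
  have gE u : f u q = u (q * r^-1)%g r by rewrite fE.
  refine (etrans (gE (c *: x + y)) (etrans (ell22ZDE c x y _ r) (etrans _
    (esym (ell2ZDE c (f x) (f y) q))))).
  exact: (congr2 (fun u v : R[i]^o => c *: u + v) (esym (gE x)) (esym (gE y))).
- rewrite mul1r; apply/ell2_nrm_leP => [|A]; first exact: nrm_ge0.
  apply: (le_trans _ (ell2_sum_le x [fset (q * r^-1)%g | q in A]%fset)).
  rewrite big_imfset /=; last by move=> u v _ _; exact: mulIg.
  apply: ler_sum => q _; rewrite ler_sqr ?nnegrE ?nrm_ge0// fE.
  exact: ell2_coord_le.
by exists T => xi q; rewrite TE fE.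
Qed.

(** The part of xi with second coordinate r after the change of variables, on which x (x) 1 acts as
    x. *)
Definition slice r : bop H ell := projT1 (cid (slice_ex r)).

Lemma sliceE r xi q : slice r xi q = xi (q * r^-1)%g r.
Proof. by rewrite /slice; case: (cid _). Qed.

Lemma slice_nrm xi :
  (\esum_(r in [set: G]) (nrm (slice r xi) ^+ 2)%:E)%E = (nrm xi ^+ 2)%:E.
Proof.
rewrite -ell22_nrm_esum.
transitivity (\esum_(r in [set: G]) \esum_(q in [set: G])
    (nrm (xi (q * r^-1)%g r) ^+ 2)%:E)%E.
  by apply: eq_esum => r _; rewrite -ell2_nrm_esum; apply: eq_esum => q _; rewrite sliceE.
rewrite -(@esum_twist _ _ (fun r q => (nrm (xi (q * r^-1)%g r) ^+ 2)%:E)); last first.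
  by move=> i j; rewrite lee_fin sqr_ge0.
by apply: eq_esum => s _; apply: eq_esum => r _; rewrite mulgK.
Qed.

(* The operator x (x) 1 transported by (s, r) |-> (s r, r). *)
Lemma twist_ex (x : B) : exists y : bop H H,
  forall xi s r, y xi s r = x (slice r xi) (s * r)%g.
Proof.
have ex xi : exists eta : H, (forall s r, eta s r = x (slice r xi) (s * r)%g) /\
    nrm eta <= nrm x * nrm xi.
  apply: ell22_ex; first by rewrite mulr_ge0 ?nrm_ge0.
  rewrite (@esum_twist _ _ (fun r q => (nrm (x (slice r xi) q) ^+ 2)%:E)); last first.
    by move=> i j; rewrite lee_fin sqr_ge0.
  rewrite exprMn EFinM -slice_nrm -ge0_esumZl ?sqr_ge0//; last first.
    by move=> i; rewrite lee_fin sqr_ge0.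
  apply: le_esum => r _; rewrite (ell2_nrm_esum (x (slice r xi))) -EFinM lee_fin.
  by rewrite -exprMn ler_sqr ?nnegrE ?mulr_ge0 ?nrm_ge0// nrm_bopP.
have [f fE] := choice ex.
have [||y yE] := @bop_ex _ _ _ f (nrm x).
- move=> c u v; apply: ell2_eq => s; apply: ell2_eq => r.
  have l : x (slice r (c *: u + v)) = c *: x (slice r u) + x (slice r v).
    by rewrite linearP linearP.
  refine (etrans ((fE _).1 s r) (etrans (congr1 (fun h : ell => h (s * r)%g) l) _)).
  refine (etrans (ell2ZDE c (x (slice r u)) (x (slice r v)) _) (etrans _
    (esym (ell22ZDE c (f u) (f v) s r)))).
  exact: (congr2 (fun u v : R[i]^o => c *: u + v) (esym ((fE u).1 s r))
    (esym ((fE v).1 s r))).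
- by move=> u; exact: (fE u).2.
by exists y => xi s r; rewrite yE (fE xi).1.
Qed.

Definition twist_op (x : B) : bop H H := projT1 (cid (twist_ex x)).

Lemma twist_opE x xi s r : twist_op x xi s r = x (slice r xi) (s * r)%g.
Proof. by rewrite /twist_op; case: (cid _) => y /= ->. Qed.

Lemma twist_op_linear (c : R[i]) (x y : B) :
  twist_op (c *: x + y) = c *: twist_op x + twist_op y.
Proof.
apply: bop_eq => xi; apply: ell2_eq => s; apply: ell2_eq => r.
refine (etrans (twist_opE _ _ _ _) (etrans (bopZD_ell2E c x y (slice r xi) _) _)).
refine (etrans _ (esym (congr1 (fun h : H => h s r) (bopZDE c (twist_op x) (twist_op y) xi)))).
refine (etrans _ (esym (ell22ZDE c (twist_op x xi) (twist_op y xi) s r))).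
exact: (congr2 (fun u v : R[i]^o => c *: u + v) (esym (twist_opE x xi s r))
  (esym (twist_opE y xi s r))).
Qed.

(** Since x (x) 1 acts slice by slice, the bound by [mxnorm x] is applied in each slice r and summed
    over r. *)
Lemma mxnorm_twist_op m (x : 'M[B]_m) : mxnorm (map_mx twist_op x) <= mxnorm x.
Proof.
apply: mxnorm_le => [|Xi]; first exact: mxnorm_ge0.
rewrite -lee_fin -sumEFin.
pose v i r : ell := \sum_(j < m) x i j (slice r (Xi j)).
have v0 i r : (0 <= (nrm (v i r) ^+ 2)%:E)%E by rewrite lee_fin sqr_ge0.
have lE i : (nrm (\sum_(j < m) map_mx twist_op x i j (Xi j)) ^+ 2)%:E =
    (\esum_(r in [set: G]) (nrm (v i r) ^+ 2)%:E)%E.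
  rewrite -ell22_nrm_esum.
  transitivity (\esum_(r in [set: G]) \esum_(q in [set: G]) (nrm (v i r q) ^+ 2)%:E)%E.
    rewrite -(@esum_twist _ _ (fun r q => (nrm (v i r q) ^+ 2)%:E)); last first.
      by move=> r q; rewrite lee_fin sqr_ge0.
    apply: eq_esum => s _; apply: eq_esum => r _; congr (nrm _ ^+ 2)%:E.
    rewrite ell2_sumE ell2_sumE /v ell2_sumE; apply: eq_bigr => j _.
    by rewrite mxE twist_opE.
  by apply: eq_esum => r _; exact: ell2_nrm_esum.
under eq_bigr do rewrite lE.
rewrite -esum_sum//.
have -> : (mxnorm x ^+ 2 * \sum_(j < m) nrm (Xi j) ^+ 2)%:E =
    (\esum_(r in [set: G]) ((mxnorm x ^+ 2)%:E * \sum_(j < m) (nrm (slice r (Xi j)) ^+ 2)%:E))%E.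
  rewrite ge0_esumZl ?sqr_ge0//; last first.
    by move=> r; apply: sume_ge0 => j _; rewrite lee_fin sqr_ge0.
  rewrite esum_sum; last by move=> r j _ _; rewrite lee_fin sqr_ge0.
  rewrite EFinM -sumEFin; congr (_ * _)%E; apply: eq_bigr => j _.
  by rewrite slice_nrm.
apply: le_esum => r _; rewrite sumEFin sumEFin -EFinM lee_fin.
exact: mxnormP.
Qed.

Lemma nrm_twist_op (x : B) : nrm (twist_op x) <= nrm x.
Proof.
have h := mxnorm_twist_op (const_mx x : 'M_1).
apply: (le_trans (_ : _ <= mxnorm (map_mx twist_op (const_mx x : 'M_1)))).
  have := mxnorm_entry (map_mx twist_op (const_mx x : 'M_1)) ord0 ord0.
  by rewrite mxE mxE.
apply: (le_trans h); rewrite -[leRHS]mul1r; apply: mxnorm_le_unif => [|i j].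
  exact: nrm_ge0.
by rewrite mxE.
Qed.

Lemma twist_bop_ex : exists T : bop B (bop H H), forall x, T x = twist_op x.
Proof.
apply: (@bop_ex R B (bop H H) twist_op 1) => [c x y|x]; first exact: twist_op_linear.
by rewrite mul1r nrm_twist_op.
Qed.

(** Packaged as a bounded operator on operators, so that it commutes with unordered sums. *)
Definition twist : bop B (bop H H) := projT1 (cid twist_bop_ex).

Lemma twistE x : twist x = twist_op x.
Proof. by rewrite /twist; case: (cid _). Qed.

Lemma mxnorm_twist m (x : 'M[B]_m) : mxnorm (map_mx twist x) <= mxnorm x.
Proof.
have -> : map_mx twist x = map_mx twist_op x.
  by apply/matrixP => i j; rewrite mxE [RHS]mxE twistE.
exact: mxnorm_twist_op.
Qed.

Lemma emb_ex : exists T : bop ell H,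
  (forall eta s r, T eta s r = (r == 1%g)%:R * eta s) /\ nrm T <= 1.
Proof.
have ex (eta : ell) : exists zeta : H, zeta = (fun s => eta s *: delta R (1%g : G)) :> (G -> ell).
  apply: (@ell2_ex _ _ _ _ (nrm eta ^+ 2)) => A.
  rewrite (le_trans _ (ell2_sum_le eta A))//; apply: ler_sum => s _.
  by rewrite (nrmZ (eta s)) nrm_delta mulr1.
have [f fE] := choice ex.
have fb eta : nrm (f eta) <= 1 * nrm eta.
  rewrite mul1r; apply/ell2_nrm_leP => [|A]; first exact: nrm_ge0.
  rewrite (le_trans _ (ell2_sum_le eta A))//; apply: ler_sum => s _.
  by rewrite fE nrmZ nrm_delta mulr1.
have [|T TE] := @bop_ex _ _ _ f 1 _ fb.
  move=> c x y; apply: ell2_eq => s.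
  have gE u : f u s = u s *: delta R (1%g : G) by rewrite fE.
  refine (etrans (gE _) (etrans _ (esym (ell2ZDE c (f x) (f y) s)))).
  refine (etrans _ (congr2 (fun u v : ell => c *: u + v) (esym (gE x)) (esym (gE y)))).
  by rewrite scalerA -scalerDl.
exists T; split; first by move=> eta s r; rewrite TE fE ell2ZE deltaE; exact: mulrC.
by apply/opnorm_leP => // eta; rewrite TE; exact: fb.
Qed.

Definition emb1 : bop ell H := projT1 (cid emb_ex).

Lemma emb1E eta s r : emb1 eta s r = (r == 1%g)%:R * eta s.
Proof. by rewrite /emb1; case: (cid _) => T /= []. Qed.

Lemma nrm_emb1 : nrm emb1 <= 1.
Proof. by rewrite /emb1; case: (cid _) => T /= []. Qed.

Lemma ev_ex : exists T : bop H ell, (forall xi s, T xi s = xi s 1%g) /\ nrm T <= 1.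
Proof.
have ex xi : exists zeta : ell, zeta = (fun s => xi s 1%g) :> (G -> R[i]^o).
  apply: (@ell2_ex _ _ _ _ (nrm xi ^+ 2)) => A.
  rewrite (le_trans _ (ell2_sum_le xi A))//; apply: ler_sum => s _.
  by rewrite ler_sqr ?nnegrE ?nrm_ge0//; exact: ell2_coord_le.
have [f fE] := choice ex.
have fb xi : nrm (f xi) <= 1 * nrm xi.
  rewrite mul1r; apply/ell2_nrm_leP => [|A]; first exact: nrm_ge0.
  rewrite (le_trans _ (ell2_sum_le xi A))//; apply: ler_sum => s _.
  by rewrite fE ler_sqr ?nnegrE ?nrm_ge0//; exact: ell2_coord_le.
have [|T TE] := @bop_ex _ _ _ f 1 _ fb.
  move=> c x y; apply: ell2_eq => s.
  have gE u : f u s = u s 1%g by rewrite fE.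
  refine (etrans (gE (c *: x + y)) (etrans (ell22ZDE c x y s _) (etrans _
    (esym (ell2ZDE c (f x) (f y) s))))).
  exact: (congr2 (fun u v : R[i]^o => c *: u + v) (esym (gE x)) (esym (gE y))).
exists T; split; first by move=> xi s; rewrite TE fE.
by apply/opnorm_leP => // eta; rewrite TE; exact: fb.
Qed.

Definition ev1 : bop H ell := projT1 (cid ev_ex).

Lemma ev1E xi s : ev1 xi s = xi s 1%g.
Proof. by rewrite /ev1; case: (cid _) => T /= []. Qed.

Lemma nrm_ev1 : nrm ev1 <= 1.
Proof. by rewrite /ev1; case: (cid _) => T /= []. Qed.

(* Compression to the slice r = 1. *)
Definition cmp (y : bop H H) : B := ev1 \oB y \oB emb1.

Lemma cmp_linear (c : R[i]) (x y : bop H H) : cmp (c *: x + y) = c *: cmp x + cmp y.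
Proof. by rewrite /cmp compDr compZr compDl compZl. Qed.

Lemma mxnorm_cmp m (x : 'M[bop H H]_m) : mxnorm (map_mx cmp x) <= mxnorm x.
Proof.
have -> : map_mx cmp x = map_mx (fun z => z \oB emb1) (map_mx (bop_comp ev1) x).
  by apply/matrixP => i j; rewrite mxE [RHS]mxE mxE.
apply: (le_trans (mxnorm_comp_r _ _)).
apply: (@le_trans _ _ (mxnorm (map_mx (bop_comp ev1) x))).
  by rewrite ler_piMr ?mxnorm_ge0 ?nrm_emb1.
apply: (le_trans (mxnorm_comp_l _ _)).
by rewrite ler_piMl ?mxnorm_ge0 ?nrm_ev1.
Qed.

Lemma nrm_cmp y : nrm (cmp y) <= nrm y.
Proof.
apply: (le_trans (nrm_comp _ _)).
apply: (@le_trans _ _ (nrm (ev1 \oB y))); first by rewrite ler_piMr ?nrm_ge0 ?nrm_emb1.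
by apply: (le_trans (nrm_comp _ _)); rewrite ler_piMl ?nrm_ge0 ?nrm_ev1.
Qed.

Lemma cmp_twist x : cmp (twist x) = x.
Proof.
apply: bop_eq => eta; apply: ell2_eq => s.
refine (etrans (ev1E (twist x (emb1 eta)) s) _).
rewrite twistE twist_opE mulg1; congr (x _ s).
apply: ell2_eq => q; rewrite sliceE emb1E eqxx mul1r.
by congr (eta _); rewrite invg1 mulg1.
Qed.

(** At (s, r) both sides equal a(s r) xi(t^-1 s)(r): on the left because alpha_{s^-1}(a)(r) = a(s
    r), on the right because the slice undoes the shift by r. *)
Lemma twist_pi_lambda (a : G -> R[i]) t : c0 a ->
  pi_rep (c0_act R G) (mulop a) \oB lambda ell t = twist (mulop a \oB lambda R[i]^o t).
Proof.
move=> ca; apply: bop_eq => xi; apply: ell2_eq => s; apply: ell2_eq => r.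
rewrite twistE twist_opE.
have h1 := mulopE (lambda R[i]^o t (slice r xi)) (s * r)%g ca.
have h2 := lambdaE t (slice r xi) (s * r)%g.
refine (etrans _ (esym h1)); rewrite h2 sliceE.
have am : c0_mulops R G (mulop a) by exists a.
have h3 := c0_pi_repE am (lambda ell t xi) s.
refine (etrans (congr1 (fun f : ell => f r) h3) _).
rewrite c0_actE// mulopE; last exact: ltrans_c0.
rewrite /ltrans invgK lambdaE; congr (_ * xi _ _).
by rewrite mulgA mulgK.
Qed.

End Slices.

Lemma esum_finP (R : realType) (I : choiceType) (g : I -> R) (c : R) :
  (\esum_(i in [set: I]) (g i)%:E <= c%:E)%E <->
  forall A : {fset I}, \sum_(i <- A) g i <= c.
Proof.
split=> [fc A|fc].
  rewrite -lee_fin (le_trans _ fc)//; apply: esum_ge.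
  exists [set` A]; first by split => //; exact: finite_fset.
  by rewrite fsbig_finite ?finite_fset//= set_fsetK sumEFin.
apply: ge_ereal_sup => _ [X [finX _] <-].
by rewrite fsbig_finite//= sumEFin lee_fin fc.
Qed.

Lemma closure_nrmP (R : realType) (V : normedModType R[i]) (D : set V) (x : V) :
  closure D x <-> forall e : R, 0 < e -> exists2 d, D d & nrm (d - x) <= e.
Proof.
split=> [cx e e0|h W].
  by have [d [Dd /= de]] := cx _ (nbhs_nrm x e0); exists d.
move=> /nbhs_ballP[e /= e0 eW].
have er : e = (complex.Re e)%:C%C by rewrite RRe_real// gtr0_real.
have e0' : 0 < complex.Re e by rewrite -ltcR -er.
have [|d Dd de] := h (complex.Re e / 2); first by rewrite divr_gt0.
exists d; split => //; apply: eW; rewrite -ball_normE /= distrC -nrmE er ltcR.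
by rewrite (le_lt_trans de)// ltr_pdivrMr// ltr_pMr// ltr1n.
Qed.

Lemma bopZ_ell2E (R : realType) (I : choiceType) (H V : normedModType R[i])
    (a : R[i]) (T : bop H (ell2 I V)) x i : (a *: T) x i = a *: T x i.
Proof. by rewrite (bopZE a T) (ell2ZE a (T x)). Qed.

Lemma sum_fset_pick (S : nzRingType) (I : choiceType) (A : {fset I}) s (c : I -> S) :
  \sum_(p <- A) (s == p)%:R * c p = (s \in A)%:R * c s.
Proof.
have [sA|sA] := boolP (s \in A).
  rewrite (bigD1_seq s sA (fset_uniq A)) /= eqxx mul1r big1 ?addr0 ?mul1r//.
  by move=> p /negbTE ps; rewrite eq_sym ps mul0r.
rewrite mul0r big1_fset// => p pA _; case: eqP => [sp|_]; last by rewrite mul0r.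
by rewrite sp pA in sA.
Qed.

(** * The crossed product through operators on ell2 G *)

Section CrossedProductOfC0.
Variables (R : realType) (G : groupType).
Notation ell := (ell2 G R[i]^o).
Notation H := (ell2 G ell).
Notation B := (B_ell2 R G).
Notation C0 := (c0_mulops R G).
Notation act := (c0_act R G).
Notation XD := (pi_tilde act @` l1 C0).
Notation lam := (lambda R[i]^o).
Implicit Types (f : G -> B) (t : G).

Lemma l1_bound f : l1 C0 f -> exists M : R, forall A : {fset G}, \sum_(t <- A) nrm (f t) <= M.
Proof.
move=> [_ fl]; exists (fine (\esum_(s in [set: G]) (opnorm (f s))%:E)%E).
apply/esum_finP; rewrite fineK// ge0_fin_numE//.
by apply: esum_ge0 => i _; rewrite lee_fin opnorm_ge0.
Qed.

Lemma l1_of_bound f (M : R) : (forall t, C0 (f t)) ->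
  (forall A : {fset G}, \sum_(t <- A) nrm (f t) <= M) -> l1 C0 f.
Proof. by move=> fA /esum_finP fM; split => //; rewrite (le_lt_trans fM)// ltry. Qed.

(** The l1 condition makes sum f(t) lambda_t converge absolutely in B(ell2 G), and the bounded map
    [twist] carries the sum to pi_tilde(f). *)
Lemma l1_hsum f : l1 C0 f ->
  exists z : B, hsum (fun t => f t \oB lam t) z /\ pi_tilde act f = twist R G z.
Proof.
move=> fl; have [M hM] := l1_bound fl; have [fA _] := fl.
have [z hz] : exists z : B, hsum (fun t => f t \oB lam t) z.
  apply: (@hsum_of_abs _ _ _ _ M); first exact: B_complete.
  move=> A; apply: (le_trans _ (hM A)); apply: ler_sum => t _.
  apply: (le_trans (nrm_comp _ _)).
  by rewrite ler_piMr ?nrm_ge0 ?nrm_lambda.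
exists z; split => //; rewrite /pi_tilde; apply: hsumP.
apply: (hsum_ext _ (hsum_bop (twist R G) hz)) => t.
have [a ca <-] := fA t; exact/esym/twist_pi_lambda.
Qed.

Lemma mulop_lin (c : R[i]) (a b : G -> R[i]) : c0 a -> c0 b ->
  c0 (fun s => c * a s + b s) /\
  mulop (fun s => c * a s + b s) = c *: mulop a + mulop b.
Proof.
move=> ca cb; have cab : c0 (fun s => c * a s + b s).
  move=> e e0; have n0 : 0 < `|c| + 1 by rewrite ltr_wpDl ?normr_ge0.
  have e1 : 0 < e / 2 / (`|c| + 1) by rewrite !divr_gt0.
  have e2 : 0 < e / 2 by rewrite divr_gt0.
  have fin : finite_set ([set s | e / 2 / (`|c| + 1) <= `|a s|] `|` [set s | e / 2 <= `|b s|]).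
    by rewrite finite_setU; split; [exact: ca e1|exact: cb e2].
  apply: sub_finite_set fin.
  move=> s /= hs; have [h|h] := boolP (e / 2 / (`|c| + 1) <= `|a s|); first by left.
  right; apply: contraTT hs => h'; rewrite -(real_ltNge (normr_real _) (gtr0_real e0)).
  rewrite -(real_ltNge (normr_real _) (gtr0_real e1)) in h.
  rewrite -(real_ltNge (normr_real _) (gtr0_real e2)) in h'.
  apply: (le_lt_trans (ler_normD _ _)); rewrite (splitr e); apply: ltrD => //.
  rewrite normrM; apply: (@le_lt_trans _ _ ((`|c| + 1) * `|a s|)).
    by rewrite ler_wpM2r ?normr_ge0// lerDl.
  by rewrite -ltr_pdivlMl// mulrC.
split=> //; apply: bop_eq => xi; apply: ell2_eq => s.
refine (etrans (mulopE xi s cab) (etrans _ (esym (bopZD_ell2E c (mulop a) (mulop b) xi s)))).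
refine (etrans _ (esym (congr2 (fun u v : R[i]^o => c *: u + v) (mulopE xi s ca) (mulopE xi s cb)))).
by rewrite mulrDl -mulrA.
Qed.

Lemma c0_mulops_lin (c : R[i]) (x y : B) : C0 x -> C0 y -> C0 (c *: x + y).
Proof.
move=> [a ca <-] [b cb <-]; have [cab <-] := mulop_lin c ca cb.
by exists (fun s => c * a s + b s).
Qed.

Lemma l1_lin (c : R[i]) f g : l1 C0 f -> l1 C0 g -> l1 C0 (fun t => c *: f t + g t).
Proof.
move=> fl gl; have [M hM] := l1_bound fl; have [N hN] := l1_bound gl.
apply: (@l1_of_bound _ (Normc.normc c * M + N)) => [t|A].
  by apply: c0_mulops_lin; [exact: fl.1|exact: gl.1].
apply: (@le_trans _ _ (\sum_(t <- A) (Normc.normc c * nrm (f t) + nrm (g t)))).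
  by apply: ler_sum => t _; apply: (le_trans (nrmD _ _)); rewrite nrmZ.
by rewrite big_split /= lerD// -mulr_sumr ler_wpM2l ?normc_ge0.
Qed.

Lemma XD_lin (c : R[i]) x y : XD x -> XD y -> XD (c *: x + y).
Proof.
move=> [f fl <-] [g gl <-]; exists (fun t => c *: f t + g t); first exact: l1_lin.
have [z [hz ->]] := l1_hsum fl; have [w [hw ->]] := l1_hsum gl.
have [v [hv ->]] := l1_hsum (l1_lin c fl gl).
rewrite -(bop_lin (twist R G)); congr (twist R G _); apply: (hsum_uniq hv).
have [Z ZE] : exists Z : bop B B, forall x, Z x = c *: x.
  apply: (@bop_ex R B B ( *:%R c) (Normc.normc c)) => [k s t|s].
    by rewrite scalerDr !scalerA mulrC.
  by rewrite nrmZ.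
have h := hsum_bop Z hz; rewrite ZE in h.
apply: (hsum_ext _ (hsumD h hw)) => t.
by rewrite ZE compDl compZl.
Qed.

Lemma C0_0 : C0 0.
Proof.
exists (fun=> 0); first by apply: (@fin_c0 _ _ fset0).
apply: bop_eq => xi; apply: ell2_eq => s; rewrite mulopE ?mul0r//.
by apply: (@fin_c0 _ _ fset0).
Qed.

Definition single t (x : B) : G -> B := fun s => if s == t then x else 0.

Lemma single_l1 t x : C0 x -> l1 C0 (single t x).
Proof.
move=> Cx; apply: (@l1_of_bound _ (nrm x)) => [s|A].
  by rewrite /single; case: eqP => // _; exact: C0_0.
have [tA|tA] := boolP (t \in A).
  rewrite (bigD1_seq t tA (fset_uniq A)) /= /single eqxx big1 ?addr0// => s /negbTE ->.
  exact: nrm0.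
rewrite big1_fset ?nrm_ge0// => s sA _; rewrite /single.
by case: eqP => [st|_]; [rewrite st (negbTE tA) in sA|exact: nrm0].
Qed.

Lemma pi_tilde_single t x : C0 x -> pi_tilde act (single t x) = twist R G (x \oB lam t).
Proof.
move=> Cx; have [z [hz ->]] := l1_hsum (single_l1 t Cx); congr (twist R G _).
apply: (hsum_uniq hz).
have h := @hsum_fin _ _ _ (fun s => single t x s \oB lam s) [fset t]%fset.
rewrite big_seq_fset1 /single eqxx in h; apply: h => s.
rewrite inE => /negbTE ->; exact: bop_eq.
Qed.

Lemma unitop_mulop p q : unitop p q = mulop (fun s => (s == p)%:R) \oB lam (p * q^-1)%g :> B.
Proof. by rewrite unitop.unlock. Qed.

Lemma twist_unitop_XD p q : XD (twist R G (unitop p q)).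
Proof.
have Cp : C0 (mulop (fun s => (s == p)%:R)) by exists (fun s => (s == p)%:R) => //; exact: c0_ind1.
rewrite unitop_mulop -pi_tilde_single//; exists (single (p * q^-1)%g (mulop (fun s => (s == p)%:R))) => //.
exact: single_l1.
Qed.

Lemma XD_0 : XD 0.
Proof.
exists (single 1%g 0); first by apply: single_l1; exact: C0_0.
rewrite pi_tilde_single; last exact: C0_0.
by rewrite (_ : 0 \oB _ = 0) ?linear0//; exact: bop_eq.
Qed.

Lemma XD_sum (J : Type) (r : seq J) (c : J -> R[i]) (x : J -> bop H H) :
  (forall j, XD (x j)) -> XD (\sum_(j <- r) c j *: x j).
Proof.
move=> Xx; elim: r => [|j r IH]; first by rewrite big_nil; exact: XD_0.
by rewrite big_cons; apply: XD_lin.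
Qed.

Lemma cmp_sub (x y : bop H H) : cmp (x - y) = cmp x - cmp y.
Proof. by rewrite /cmp compBr compBl. Qed.

Lemma cproj_decomp (A : {fset G}) (z : B) :
  cproj A \oB z \oB cproj A = \sum_(p <- A) \sum_(q <- A) mxcoef z p q *: unitop p q.
Proof.
apply: bop_eq => xi; apply: ell2_eq => s.
have -> : (cproj A \oB z \oB cproj A) xi = cproj A (z (cproj A xi)) by [].
rewrite projE.
have -> : cproj A xi = \sum_(q <- A) xi q *: delta R q.
  by apply: ell2_eq => t; rewrite projE sum_deltaE.
rewrite linear_sum ell2_sumE bop_sumE ell2_sumE.
have e p : (\sum_(q <- A) mxcoef z p q *: unitop p q) xi s =
    (s == p)%:R * \sum_(q <- A) (xi q *: z (delta R q)) p.
  rewrite bop_sumE ell2_sumE mulr_sumr; apply: eq_bigr => q _.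
  refine (etrans (bopZ_ell2E (mxcoef z p q) (unitop p q) xi s) _).
  refine (etrans (congr1 (fun u : R[i]^o => mxcoef z p q *: u) (unitopE p q xi s)) _).
  refine (etrans _ (esym (congr1 (fun u : R[i]^o => (s == p)%:R * u)
    (ell2ZE (xi q) (z (delta R q)) p)))).
  exact: (etrans (mulrCA _ _ _) (congr1 (fun u => (s == p)%:R * u) (mulrC _ _))).
under [RHS]eq_bigr do rewrite e.
refine (etrans _ (esym (sum_fset_pick A s (fun p =>
  \sum_(q <- A) (xi q *: z (delta R q)) p)))).
by congr (_ * _); apply: eq_bigr => q _; rewrite linearZ.
Qed.

End CrossedProductOfC0.

Lemma cb_bound_nrm (R : realType) (H K : normedModType R[i]) (A : set (bop H H))
    (f : bop H H -> bop K K) (M : R) x :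
  0 <= M -> cb_bound A f M -> A x -> nrm (f x) <= M * nrm x.
Proof.
move=> M0 fM Ax; have h : mxnorm (map_mx f (const_mx x : 'M_1)) <= M * mxnorm (const_mx x : 'M_1).
  by apply: fM => i j; rewrite mxE.
have h1 : mxnorm (const_mx x : 'M_1) <= nrm x.
  by rewrite -[leRHS]mul1r; apply: mxnorm_le_unif => [|i j]; rewrite ?nrm_ge0// mxE.
have h2 := mxnorm_entry (map_mx f (const_mx x : 'M_1)) ord0 ord0.
rewrite mxE mxE in h2; apply: (le_trans h2); apply: (le_trans h).
exact: ler_wpM2l M0 _ _ h1.
Qed.

(** * The multiplier defined by a Haagerup tensor *)

Section Sufficiency.
Variables (R : realType) (G : groupType).
Notation ell := (ell2 G R[i]^o).
Notation H := (ell2 G ell).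
Notation B := (B_ell2 R G).
Notation C0 := (c0_mulops R G).
Notation act := (c0_act R G).
Notation XD := (pi_tilde act @` l1 C0).
Notation X := (crossed_product C0 act).
Notation lam := (lambda R[i]^o).

Lemma lambdaVK t : lam t^-1%g \oB lam t = lam 1%g :> B.
Proof.
apply: bop_eq => xi; apply: ell2_eq => s; rewrite (bop_compE (lam t^-1%g) (lam t) xi).
refine (etrans (lambdaE _ _ _) (etrans (lambdaE _ _ _) (esym (etrans (lambdaE _ _ _) _)))).
by rewrite invgK invg1 mul1g mulKg.
Qed.

Lemma lambda1_comp (x : B) : x \oB lam 1%g = x.
Proof.
apply: bop_eq => xi; rewrite (bop_compE x (lam 1%g) xi); congr (x _).
by apply: ell2_eq => s; refine (etrans (lambdaE _ _ _) _); rewrite invg1 mul1g.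
Qed.

Lemma lambdaK (x : B) t : x \oB lam t^-1%g \oB lam t = x.
Proof.
apply: (etrans (esym (bop_compA x (lam t^-1%g) (lam t)))).
exact: (etrans (congr1 (bop_comp x) (lambdaVK t)) (lambda1_comp x)).
Qed.

Lemma lambdaKV (x : B) t : x \oB lam t \oB lam t^-1%g = x.
Proof. by rewrite -{1}[t]invgK lambdaK. Qed.

Lemma gamma_conj (a b : nat -> B) s x :
  tail_small (fun r (c : R) => row_bound r a c) ->
  tail_small (fun r (c : R) => col_bound r b c) ->
  Gamma (haagerup_conj s (a, b)) x = Gamma (a, b) (x \oB lam s) \oB lam s^-1%g.
Proof.
move=> ha hb; apply: tends_lim.
have [T TE] : exists T : bop B B, forall y, T y = y \oB lam s^-1%g.
  apply: (@bop_ex R B B (fun y => y \oB lam s^-1%g) 1) => [c y z|y].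
    by rewrite compDl compZl.
  rewrite mul1r; apply: (le_trans (nrm_comp _ _)).
  by rewrite ler_piMr ?nrm_ge0 ?nrm_lambda.
have := tends_bop T (gamma_tends ha hb (x \oB lam s)); rewrite TE.
apply: tends_ext => n; rewrite TE seriesEnat /gamma_partial comp_suml.
by apply: eq_bigr => k _; exact: bop_eq.
Qed.

Lemma haagerup_tails (Y : set B) u : haagerup_series Y u ->
  tail_small (fun r (c : R) => row_bound r u.1 c) /\
  tail_small (fun r (c : R) => col_bound r u.2 c).
Proof.
move=> [_ _ cr cc]; split.
  apply: (tail_small_imp _ (series_tail cr)) => r c _; exact: row_bound_of_nrm.
apply: (tail_small_imp _ (series_tail cc)) => r c _; exact: col_bound_of_nrm.
Qed.

Variable F : G -> B -> B.
Hypothesis F_CB : forall s : G, completely_bounded C0 C0 (F s).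
Variables a b : nat -> B.
Hypothesis hu : haagerup_series (compact_op R G) (a, b).
Hypothesis hF : forall (x : B) (s : G), C0 x -> Gamma (haagerup_conj s (a, b)) x = F s x.

Let ha := (haagerup_tails hu).1.
Let hb := (haagerup_tails hu).2.
Let Gam := Gamma (a, b).

Lemma F_gamma s x : C0 x -> F s x = Gam (x \oB lam s) \oB lam s^-1%g.
Proof. by move=> Cx; rewrite -hF// gamma_conj. Qed.

(** Compressing first defines the map on all of B(H), so one formula serves the l1 algebra and its
    closure. *)
Definition S_gamma (y : bop H H) : bop H H := twist R G (Gam (cmp y)).

Lemma S_gamma_linear (c : R[i]) x y : S_gamma (c *: x + y) = c *: S_gamma x + S_gamma y.
Proof.
by rewrite /S_gamma cmp_linear /Gam (gamma_linear ha hb) linearP.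
Qed.

Lemma S_gamma_cb : exists2 M : R, 0 <= M &
  forall m (x : 'M[bop H H]_m), mxnorm (map_mx S_gamma x) <= M * mxnorm x.
Proof.
have [M M0 hM] := gamma_mxnorm ha hb; exists M => // m x.
have -> : map_mx S_gamma x = map_mx (twist R G) (map_mx Gam (map_mx (@cmp R G) x)).
  by apply/matrixP => i j; rewrite mxE [RHS]mxE mxE mxE.
apply: (le_trans (mxnorm_twist _)); apply: (le_trans (hM _ _)).
by rewrite ler_wpM2l// mxnorm_cmp.
Qed.

Lemma F_cb : exists2 M : R, 0 <= M & forall s, cb_bound C0 (F s) M.
Proof.
have [M M0 hM] := gamma_mxnorm ha hb; exists M => // s m x Cx.
have -> : map_mx (F s) x = map_mx (fun z => z \oB lam s^-1%g)
    (map_mx Gam (map_mx (fun z => z \oB lam s) x)).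
  by apply/matrixP => i j; rewrite mxE [RHS]mxE mxE mxE F_gamma.
apply: (le_trans (mxnorm_comp_r _ _)).
apply: (@le_trans _ _ (mxnorm (map_mx Gam (map_mx (fun z => z \oB lam s) x)))).
  by rewrite ler_piMr ?mxnorm_ge0 ?nrm_lambda.
apply: (le_trans (hM m (map_mx (fun z => z \oB lam s) x))); apply: (ler_wpM2l M0).
apply: (le_trans (mxnorm_comp_r _ _)).
by rewrite ler_piMr ?mxnorm_ge0 ?nrm_lambda.
Qed.

Lemma F_nrm : exists2 M : R, 0 <= M & forall s x, C0 x -> nrm (F s x) <= M * nrm x.
Proof. by have [M M0 hM] := F_cb; exists M => // s x; exact: cb_bound_nrm. Qed.

(** All F(s) come from the single map Gamma_u, so they are bounded uniformly in s; this keeps F f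
    summable. *)
Lemma pmul_l1 f : l1 C0 f -> l1 C0 (pmul F f).
Proof.
move=> fl; have [M M0 hM] := F_nrm; have [N hN] := l1_bound fl.
apply: (@l1_of_bound _ _ _ (M * N)) => [t|A].
  by have [FC _ _] := F_CB t; apply: FC; exact: fl.1.
apply: (@le_trans _ _ (\sum_(t <- A) M * nrm (f t))).
  by apply: ler_sum => t _; apply: hM; exact: fl.1.
by rewrite -mulr_sumr ler_wpM2l.
Qed.

(** Gamma_u is bounded and so commutes with the sum over t; termwise the identity is [F_gamma]
    multiplied by lambda_t. *)
Lemma S_gamma_extends : extends_SF C0 act F S_gamma.
Proof.
move=> f fl; have [z [hz ->]] := l1_hsum fl.
have [w [hw ->]] := l1_hsum (pmul_l1 fl).
rewrite /S_gamma cmp_twist; congr (twist R G _).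
have [T TE] : exists T : bop B B, forall y, T y = Gam y.
  have [M M0 hM] := gamma_mxnorm ha hb.
  apply: (@bop_ex R B B Gam M) => [c x y|x]; first exact: gamma_linear.
  exact: (@cb_bound_nrm _ _ _ setT Gam M x M0 (fun m y _ => hM m y)).
have h := hsum_bop T hz; rewrite TE in h.
apply: (hsum_uniq h); apply: (hsum_ext _ hw) => t.
by rewrite TE /pmul F_gamma ?lambdaK//; exact: fl.1.
Qed.

Lemma S_gamma_XD x : XD x -> XD (S_gamma x).
Proof.
move=> [f fl <-]; exists (pmul F f); first exact: pmul_l1.
exact: esym (S_gamma_extends fl).
Qed.

Lemma S_gamma_nrm : exists2 M : R, 0 <= M & forall x y, nrm (S_gamma x - S_gamma y) <= M * nrm (x - y).
Proof.
have [M M0 hM] := S_gamma_cb; exists M => // x y.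
have -> : S_gamma x - S_gamma y = S_gamma (x - y).
  have sE (u v : bop H H) : u - v = (-1) *: v + u by rewrite scaleN1r addrC.
  by rewrite (sE x) (sE (S_gamma x)) S_gamma_linear.
exact: (@cb_bound_nrm _ _ _ setT S_gamma M (x - y) M0 (fun m y _ => hM m y)).
Qed.

Lemma S_gamma_X x : X x -> X (S_gamma x).
Proof.
move=> /closure_nrmP Xx; have [M M0 hM] := S_gamma_nrm; apply/closure_nrmP => e e0.
have M1 : 0 < M + 1 by rewrite ltr_wpDl.
have [|d Dd dx] := Xx (e / (M + 1)); first by rewrite divr_gt0.
exists (S_gamma d); first exact: S_gamma_XD.
apply: (le_trans (hM _ _)); apply: (@le_trans _ _ ((M + 1) * nrm (d - x))).
  by rewrite ler_wpM2r ?nrm_ge0// lerDl.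
by rewrite -ler_pdivlMl// mulrC.
Qed.

Lemma S_gamma_compact (e : R) : 0 < e -> exists Y, [/\ finite_dim_subspace Y, Y `<=` X &
  forall m (x : 'M[bop H H]_m), mx_over X x -> mxnorm x <= 1 ->
    mxdist Y (map_mx S_gamma x) < e].
Proof.
move=> e0; have [ca cb _ _] := hu.
have e2 : 0 < e / 2 by rewrite divr_gt0.
have [A hA] := gamma_trunc ha hb ca cb e2.
(* [Y] is spanned by the twisted matrix units with both indices in [A]; the list numbers them by
   ordinals. *)
pose l := [seq (p, q) | p <- enum_fset A, q <- enum_fset A].
pose y (i : 'I_(size l)) := let pq := nth (1%g, 1%g) l i in twist R G (unitop pq.1 pq.2).
pose Y := [set \sum_(i < size l) c i *: y i | c in [set: 'I_(size l) -> R[i]]].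
have YX : Y `<=` X.
  move=> _ [c _ <-]; refine (subset_closure (XD_sum _ _ (fun i => _))).
  exact: twist_unitop_XD.
exists Y; split; [by exists (size l), y|exact: YX|move=> m x Xx x1; pose w := map_mx (fun z => twist R G
  (cproj A \oB Gam (cmp z) \oB cproj A)) x].
have Yw : mx_over Y w.
  move=> i j; rewrite mxE cproj_decomp.
  exists (fun k => let pq := nth (1%g, 1%g) l k in mxcoef (Gam (cmp (x i j))) pq.1 pq.2) => //.
  rewrite linear_sum.
  under [RHS]eq_bigr do rewrite linear_sum.
  have hl (g : G * G -> bop H H) :
      \sum_(p <- A) \sum_(q <- A) g (p, q) = \sum_(pq <- l) g pq.
    by rewrite /l big_allpairs_dep.
  rewrite (hl (fun pq => twist R G (mxcoef (Gam (cmp (x i j))) pq.1 pq.2 *: unitop pq.1 pq.2))).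
  rewrite (big_nth (1%g, 1%g)) big_mkord; apply: eq_bigr => k _.
  by rewrite linearZ.
apply: (@le_lt_trans _ _ (e / 2)); last by rewrite ltr_pdivrMr// ltr_pMr// ltr1n.
apply: (@le_trans _ _ (mxnorm (map_mx S_gamma x - w))).
  apply: ge_inf; last by exists w.
  by exists 0 => _ [v _ <-]; exact: mxnorm_ge0.
have -> : map_mx S_gamma x - w = map_mx (twist R G) (map_mx (fun z => Gam z
      - cproj A \oB Gam z \oB cproj A) (map_mx (@cmp R G) x)).
  by apply/matrixP => i j; rewrite !mxE (bopB (twist R G)).
apply: (le_trans (mxnorm_twist _)); apply: (le_trans (hA _ _)).
rewrite ler_piMr ?(ltW e2)//; exact: le_trans (mxnorm_cmp _) x1.
Qed.

Lemma sufficiency : cc_herz_schur_multiplier C0 act F.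
Proof.
have [M M0 hM] := S_gamma_cb; have [N N0 hN] := F_cb.
split; first split; first by exists N.
  exists S_gamma; split; first exact: S_gamma_extends.
  split; [exact: S_gamma_XD| |by exists M => m x _].
  by move=> c x y _ _; exact: S_gamma_linear.
exists S_gamma; split; first exact: S_gamma_extends.
split; last exact: S_gamma_compact.
split; [exact: S_gamma_X| |by exists M => m x _].
by move=> c x y _ _; exact: S_gamma_linear.
Qed.

End Sufficiency.

(** * Factorization of completely bounded maps on matrix algebras *)

Section ConeSeparation.
Variables (R : realType) (T : finType).
Implicit Types (u v w k : T -> R).

Definition dotr u v : R := \sum_(t : T) u t * v t.

Lemma dotr_ge0 u : 0 <= dotr u u.
Proof. by apply: sumr_ge0 => t _; rewrite -expr2 sqr_ge0. Qed.

Lemma dotr_sqD (c : R) w k :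
  dotr (fun t => w t + c * k t) (fun t => w t + c * k t)
    = dotr w w + 2 * c * dotr w k + c ^+ 2 * dotr k k.
Proof.
rewrite /dotr !mulr_sumr -!big_split /=; apply: eq_bigr => t _; ring.
Qed.

(** No closedness is assumed, so the distance from v may not be attained. A point k0 at almost
    minimal distance gives w = v - k0; comparing k0 with k0 + h k bounds <w, k> up to the error e
    (|k|^2 + 1), while the margin d does not depend on e. *)
Lemma cone_separation (K : set (T -> R)) v :
  K (fun=> 0) ->
  (forall k l, K k -> K l -> K (fun t => k t + l t)) ->
  (forall (c : R) k, 0 < c -> K k -> K (fun t => c * k t)) ->
  (forall e : R, 0 < e -> exists2 k, K k & dotr (fun t => v t - k t) (fun t => v t - k t) <= e)
  \/ exists2 d : R, 0 < d & forall e : R, 0 < e -> exists w,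
      (forall k, K k -> dotr w k <= e * (dotr k k + 1)) /\ d <= dotr w v.
Proof.
move=> K0 KD KZ.
pose dist k := dotr (fun t => v t - k t) (fun t => v t - k t).
pose D := [set dist k | k in K].
have hi : has_inf D.
  split; first by exists (dist (fun=> 0)), (fun=> 0).
  by exists 0 => _ [k _ <-]; exact: dotr_ge0.
have d0 : 0 <= inf D.
  by apply: lb_le_inf => [|_ [k _ <-]]; [exact: hi.1|exact: dotr_ge0].
have dle k : K k -> inf D <= dist k.
  by move=> Kk; apply: ge_inf; [exact: hi.2|exists k].
have near (e : R) : 0 < e -> exists2 k, K k & dist k < inf D + e.
  by move=> e0; have [_ [k Kk <-] hk] := inf_adherent e0 hi; exists k.
have [dz|dn] := eqVneq (inf D) 0.
  by left=> e /near[k Kk]; rewrite dz add0r => /ltW; exists k.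
right; have {dn}d0 : 0 < inf D by rewrite lt_neqAle eq_sym dn.
exists (inf D / 2); first by rewrite divr_gt0.
move=> e e0; set V := dotr v v.
have V0 : 0 <= V := dotr_ge0 v.
(* An upper bound for |k0|^2 + 1, so that the error at k0 is at most half of [inf D]. *)
pose q := (4 * V + 3).
have q0 : 0 < q by rewrite /q; lra.
pose h := Num.min (Num.min e (1 / 2)) (inf D / q).
have h0 : 0 < h by rewrite !lt_min e0 divr_gt0// divr_gt0.
have h1 : h <= e by rewrite !ge_min lexx.
have h2 : h <= 1 / 2 by rewrite !ge_min lexx orbT.
have h3 : h * q <= inf D by rewrite -ler_pdivlMr// !ge_min lexx orbT.
(* Minimal up to h^2: divided by the step length h, the defect is of order h. *)
have [k0 Kk0 hk0] := near (h ^+ 2) (exprn_gt0 2 h0).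
pose w t := v t - k0 t; exists w.
have wle k : K (fun t => k0 t + h * k t) -> dotr w k <= h * (dotr k k + 1) / 2.
  move=> /dle; rewrite /dist.
  have -> : (fun t => v t - (k0 t + h * k t)) = (fun t => w t + (- h) * k t).
    by apply/funext => t; rewrite /w; ring.
  rewrite dotr_sqD sqrrN => hh.
  have hw0 : dotr w w < inf D + h ^+ 2 := hk0.
  by rewrite -(ler_pM2l h0); lra.
split=> [k Kk|].
  have := wle k (KD _ _ Kk0 (KZ _ _ h0 Kk)).
  have := dotr_ge0 k; nra.
(* Moving towards the origin, to (1 - h) k0, bounds <w, k0> from below. *)
have Kneg : K (fun t => k0 t + h * (- k0 t)).
  have -> : (fun t => k0 t + h * (- k0 t)) = (fun t => (1 - h) * k0 t).
    by apply/funext => t; ring.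
  by apply: KZ => //; lra.
have := wle _ Kneg.
have -> : dotr w (fun t => - k0 t) = - dotr w k0.
  by rewrite /dotr -sumrN; apply: eq_bigr => t _; rewrite mulrN.
have -> : dotr (fun t => - k0 t) (fun t => - k0 t) = dotr k0 k0.
  by apply: eq_bigr => t _; rewrite mulrNN.
have ev : dotr w v = dotr w w + dotr w k0.
  by rewrite /dotr -big_split /=; apply: eq_bigr => t _; rewrite /w; ring.
have kk : dotr k0 k0 <= 2 * V + 2 * dotr w w.
  rewrite /V /dotr !mulr_sumr -big_split /=; apply: ler_sum => t _; rewrite /w.
  by have := sqr_ge0 (2 * v t - k0 t); nra.
have ww : inf D <= dotr w w := dle k0 Kk0.
have wV : dotr w w <= V + h ^+ 2.
  have : inf D <= V.
    have := dle _ K0; congr (_ <= _); apply: eq_bigr => t _.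
    by rewrite subr0.
  by move=> hV; have := ltW hk0; rewrite /dist -/w => /le_trans; apply; rewrite lerD2r.
move=> hw; rewrite ev.
have hh1 : h ^+ 2 <= 1 / 4 by nra.
have : h * (dotr k0 k0 + 1) / 2 <= inf D / 2.
  apply: (@le_trans _ _ (h * q / 2)); last by rewrite ler_pM2r ?invr_gt0.
  by rewrite ler_pM2r ?invr_gt0// ler_pM2l// /q; lra.
lra.
Qed.

End ConeSeparation.

(** * Hermitian and bilinear forms *)

Section HermitianForms.
Variables (R : realType) (n : nat).
Notation C := R[i].
Notation sq z := (nrm (z : C^o) ^+ 2).
Implicit Types (al : 'I_n -> C).

Lemma sq_conj (z : C) : z^* * z = (sq z)%:C%C.
Proof. by rewrite mulrC mul_conj. Qed.

Lemma sqM (z w : C) : sq (z * w) = sq z * sq w.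
Proof. by rewrite nrmM exprMn. Qed.

Lemma Re_sum (I : Type) (r : seq I) (P : pred I) (f : I -> C) :
  complex.Re (\sum_(i <- r | P i) f i) = \sum_(i <- r | P i) complex.Re (f i).
Proof. exact: raddf_sum. Qed.

Lemma Re_real (x : R) : complex.Re x%:C%C = x. Proof. by []. Qed.

Lemma Re_le_nrm (z : C) : complex.Re z <= nrm (z : C^o).
Proof.
apply: (le_trans (ler_norm _)); rewrite -lecR nrmE; exact: normc_ge_Re.
Qed.

(** Diagonalize M = U^* d U and take for L the entrywise conjugate of U with rows scaled by the
    square roots of d. The lower bound h makes every eigenvalue positive, so L has an inverse T. *)
Lemma spectral_factor (M : 'M[C]_n) (h : R) : 0 < h ->
  (forall i j, M j i = (M i j)^*) ->
  (forall al, h * (\sum_s sq (al s)) <=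
     complex.Re (\sum_s \sum_s' M s s' * (al s * (al s')^*))) ->
  exists L T : 'I_n -> 'I_n -> C,
  [/\ forall al, complex.Re (\sum_s \sum_s' M s s' * (al s * (al s')^*)) =
        \sum_i sq (\sum_s L i s * al s),
      forall i j, \sum_s L i s * T s j = (i == j)%:R &
      forall s t, \sum_i T s i * L i t = (s == t)%:R].
Proof.
move=> h0 Mh Mpos.
have Mherm : M \is hermsymmx.
  by apply/is_hermitianmxP; rewrite expr0 scale1r; apply/matrixP => i j; rewrite !mxE.
have /orthomx_spectralP ME := hermitian_normalmx Mherm.
have dr := hermitian_spectral_diag_real Mherm.
have Uu := spectral_unitarymx M.
move: ME dr Uu; set U := spectralmx M; set d := spectral_diag M => ME dr Uu.
have UUt i j : \sum_s U i s * (U j s)^* = (i == j)%:R.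
  have /unitarymxP/matrixP/(_ i j) := Uu; rewrite mxE [RHS]mxE => <-.
  by apply: eq_bigr => s _; rewrite !mxE.
have UtU s t : \sum_i (U i s)^* * U i t = (s == t)%:R.
  have := mulVmx (unitarymx_unit Uu); rewrite invmx_unitary//.
  move=> /matrixP/(_ s t); rewrite mxE [RHS]mxE => <-.
  by apply: eq_bigr => i _; rewrite !mxE.
have dE i : d 0 i = (complex.Re (d 0 i))%:C%C.
  by rewrite RRe_real//; exact: (mxOverP dr).
have Mst s t : M s t = \sum_i (U i s)^* * d 0 i * U i t.
  rewrite {1}ME invmx_unitary// mxE; apply: eq_bigr => i _.
  by rewrite mul_mx_diag !mxE.
have form al : \sum_s \sum_s' M s s' * (al s * (al s')^*) =
    (\sum_i complex.Re (d 0 i) * sq (\sum_s (U i s)^* * al s))%:C%C.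
  transitivity (\sum_s \sum_s' \sum_i ((U i s)^* * d 0 i * U i s') * (al s * (al s')^*)).
    by apply: eq_bigr => s _; apply: eq_bigr => t _; rewrite Mst mulr_suml.
  transitivity (\sum_i \sum_s \sum_s' ((U i s)^* * d 0 i * U i s') * (al s * (al s')^*)).
    rewrite [RHS]exchange_big; apply: eq_bigr => s _.
    by rewrite [RHS]exchange_big.
  rewrite rmorph_sum; apply: eq_bigr => i _.
  rewrite rmorphM /= -dE -mul_conj rmorph_sum mulr_suml mulr_sumr.
  apply: eq_bigr => s _; rewrite !mulr_sumr; apply: eq_bigr => t _.
  rewrite rmorphM /= conjCK; ring.
have dpos i : 0 < complex.Re (d 0 i).
  have := Mpos (fun s => U i s); rewrite form Re_real.
  have -> : \sum_s sq (U i s) = 1.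
    apply: (@complexI R); rewrite rmorph_sum /=.
    transitivity (\sum_s U i s * (U i s)^*); last by rewrite UUt eqxx.
    by apply: eq_bigr => s _; rewrite mul_conj.
  have -> : \sum_j complex.Re (d 0 j) * sq (\sum_s (U j s)^* * U i s) = complex.Re (d 0 i).
    have e j : \sum_s (U j s)^* * U i s = (j == i)%:R.
      transitivity (\sum_s U i s * (U j s)^*); last by rewrite UUt eq_sym.
      by apply: eq_bigr => s _; rewrite mulrC.
    under eq_bigr => j _ do rewrite e nrm_bool.
    rewrite (bigD1 i)//= eqxx expr1n mulr1 big1 ?addr0// => j /negbTE ->.
    by rewrite expr0n mulr0.
  by rewrite mulr1; exact: lt_le_trans.
pose r i := (Num.sqrt (complex.Re (d 0 i)))%:C%C.
have r0 i : r i != 0 by rewrite /r fmorph_eq0 sqrtr_eq0 -ltNge.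
exists (fun i s => r i * (U i s)^*), (fun s i => U i s / r i); split.
- move=> al; rewrite form Re_real; apply: eq_bigr => i _.
  have -> : \sum_s r i * (U i s)^* * al s = r i * \sum_s (U i s)^* * al s.
    by rewrite mulr_sumr; apply: eq_bigr => s _; rewrite mulrA.
  by rewrite sqM nrm_real ger0_norm ?sqrtr_ge0// sqr_sqrtr// ltW.
- move=> i j; rewrite -[RHS]mul1r -{1}(divff (r0 i)).
  have -> : \sum_s r i * (U i s)^* * (U j s / r j) = r i / r j * (j == i)%:R.
    by rewrite -UUt mulr_sumr; apply: eq_bigr => s _; ring.
  by rewrite eq_sym; case: eqP => [->//|_]; rewrite !mulr0.
- move=> s t.
  rewrite eq_sym -UtU; apply: eq_bigr => i _.
  by rewrite -[RHS]mulr1 -(divff (r0 i)); ring.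
Qed.

Lemma bilinear_bound (W : 'I_n -> 'I_n -> 'I_n -> 'I_n -> C) :
  let Bl x y := \sum_i \sum_p \sum_j \sum_q W i p j q * (x i p * y j q) in
  let N (x : 'I_n -> 'I_n -> C) := \sum_i \sum_p sq (x i p) in
  (forall x y, complex.Re (Bl x y) <= N x + N y) ->
  forall x y, sq (Bl x y) <= 4 * (N x * N y).
Proof.
move=> Bl N h x y; set z := Bl x y.
have N0 u : 0 <= N u by apply: sumr_ge0 => i _; apply: sumr_ge0 => p _; exact: sqr_ge0.
have [z0|zn] := eqVneq z 0; first by rewrite z0 nrm0 expr0n mulr_ge0// mulr_ge0.
have m0 : 0 < nrm (z : C^o).
  rewrite lt_neqAle nrm_ge0 andbT eq_sym; apply: contra_neq zn => e.
  by apply: (@nrm0_eq0 _ C^o).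
set m := nrm (z : C^o) in m0 *.
have BZ (c : C) : Bl (fun i p => c * x i p) y = c * z.
  rewrite /z /Bl !mulr_sumr; apply: eq_bigr => i _; rewrite !mulr_sumr.
  apply: eq_bigr => p _; rewrite !mulr_sumr; apply: eq_bigr => j _.
  by rewrite !mulr_sumr; apply: eq_bigr => q _; ring.
have NZ (c : C) : N (fun i p => c * x i p) = sq c * N x.
  rewrite /N mulr_sumr; apply: eq_bigr => i _; rewrite mulr_sumr.
  by apply: eq_bigr => p _; rewrite sqM.
(* The factor conj(z) / m rotates the value of the form to the positive axis; t remains free. *)
have key (t : R) : t * m <= t ^+ 2 * N x + N y.
  have := h (fun i p => (t / m)%:C%C * z^* * x i p) y.
  rewrite BZ NZ sqM nrm_real nrm_conj -/m -mulrA sq_conj -rmorphM /=.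
  rewrite real_normK ?num_real// -exprMn divfK ?gt_eqF//.
  by rewrite expr2 mulrA divfK ?gt_eqF.
have [X0|Xn] := eqVneq (N x) 0.
  (* When N x = 0 the bound t m <= N y would hold for every t, against m > 0. *)
  have := key ((N y + 1) / m); rewrite X0 mulr0 add0r divfK ?gt_eqF//; lra.
have X0 : 0 < N x by rewrite lt_neqAle eq_sym Xn N0.
(* The maximum of t m - t^2 N x. *)
have := key (m / (2 * N x)).
have -> : (m / (2 * N x)) ^+ 2 * N x = m ^+ 2 / (4 * N x) by field; rewrite gt_eqF.
have -> : m / (2 * N x) * m = 2 * (m ^+ 2 / (4 * N x)) by field; rewrite gt_eqF.
have mE : m ^+ 2 = m ^+ 2 / (4 * N x) * (4 * N x) by field; rewrite gt_eqF.
move=> hh; rewrite mE.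
have : m ^+ 2 / (4 * N x) <= N y by lra.
have -> : 4 * (N x * N y) = N y * (4 * N x) by ring.
by rewrite ler_pM2r// mulr_gt0.
Qed.

End HermitianForms.

(** * The cone of sums of squares and tensors *)

Section HaagerupFactorization.
Variables (R : realType) (n : nat).
Notation C := R[i].
Notation I := 'I_n.
Notation sq z := (nrm (z : C^o) ^+ 2).
Notation T := (bool * ((I * I + I * I) + ((I * I) * (I * I))))%type.

Definition cpart (b : bool) (z : C) : R := if b then complex.Re z else complex.Im z.

(* A triple (f0, f1, f2) as a real vector; the boolean selects the real or the
   imaginary part. *)
Definition tvec (f0 f1 : I -> I -> C) (f2 : I -> I -> I -> I -> C) : T -> R := fun x => cpart x.1
  match x.2 with
  | inl (inl (s, t)) => f0 s t
  | inl (inr (s, t)) => f1 s t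
  | inr ((s, p), (t, q)) => f2 s p t q
  end.

Lemma sum_T (g : T -> R) : \sum_x g x =
  \sum_s \sum_t (g (true, inl (inl (s, t))) + g (false, inl (inl (s, t)))) +
  \sum_s \sum_t (g (true, inl (inr (s, t))) + g (false, inl (inr (s, t)))) +
  \sum_s \sum_p \sum_t \sum_q (g (true, inr ((s, p), (t, q))) + g (false, inr ((s, p), (t, q)))).
Proof.
rewrite (eq_bigr (fun x => g (x.1, x.2))); last by case.
rewrite -(pair_bigA _ (fun b z => g (b, z))) /= big_bool /= -big_split /=.
rewrite big_sumType big_sumType /=; congr (_ + _ + _).
- by rewrite pair_bigA; apply: eq_bigr => -[].
- by rewrite pair_bigA; apply: eq_bigr => -[].
- rewrite (eq_bigr (fun x => g (true, inr (x.1, x.2)) + g (false, inr (x.1, x.2)))); last by case.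
  rewrite -(pair_bigA _ (fun x y => g (true, inr (x, y)) + g (false, inr (x, y)))) /=.
  rewrite [RHS]pair_bigA; apply: eq_bigr => -[s p] _ /=.
  by rewrite [RHS]pair_bigA; apply: eq_bigr => -[].
Qed.

Lemma sqE (z : C) : sq z = complex.Re z ^+ 2 + complex.Im z ^+ 2.
Proof. by case: z => a b; rewrite nrm_normc /= sqr_sqrtr// addr_ge0 ?sqr_ge0. Qed.

Lemma dotr_tvec_self f0 f1 f2 : dotr (tvec f0 f1 f2) (tvec f0 f1 f2) =
  \sum_s \sum_t sq (f0 s t) + \sum_s \sum_t sq (f1 s t)
  + \sum_s \sum_p \sum_t \sum_q sq (f2 s p t q).
Proof.
rewrite /dotr sum_T; congr (_ + _ + _).
- by apply: eq_bigr => s _; apply: eq_bigr => t _; rewrite sqE !expr2.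
- by apply: eq_bigr => s _; apply: eq_bigr => t _; rewrite sqE !expr2.
- apply: eq_bigr => s _; apply: eq_bigr => p _; apply: eq_bigr => t _.
  by apply: eq_bigr => q _; rewrite sqE !expr2.
Qed.

(** The conjugate of the complex coordinate of w; the real dot product becomes the real part of a
    complex bilinear pairing. *)
Definition wc (w : T -> R) x : C := (w (true, x) -i* w (false, x))%C.

Lemma Re_wc w x (z : C) :
  complex.Re (wc w x * z) = w (true, x) * complex.Re z + w (false, x) * complex.Im z.
Proof. by case: z => a b /=; rewrite mulNr opprK. Qed.

Lemma dotr_tvec w f0 f1 f2 : dotr w (tvec f0 f1 f2) =
  complex.Re (\sum_s \sum_t wc w (inl (inl (s, t))) * f0 s t) +
  complex.Re (\sum_s \sum_t wc w (inl (inr (s, t))) * f1 s t) +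
  complex.Re (\sum_s \sum_p \sum_t \sum_q wc w (inr ((s, p), (t, q))) * f2 s p t q).
Proof.
rewrite /dotr sum_T !Re_sum; congr (_ + _ + _).
- by apply: eq_bigr => s _; rewrite Re_sum; apply: eq_bigr => t _; rewrite Re_wc.
- by apply: eq_bigr => s _; rewrite Re_sum; apply: eq_bigr => t _; rewrite Re_wc.
- apply: eq_bigr => s _; rewrite Re_sum; apply: eq_bigr => p _; rewrite Re_sum.
  by apply: eq_bigr => t _; rewrite Re_sum; apply: eq_bigr => q _; rewrite Re_wc.
Qed.

Notation P := ((I -> I -> C) * (I -> I -> C))%type.
Implicit Types (L : seq P) (h : P -> I -> I -> C).

(** The second component of a pair stores b transposed. Thus [gram fst] is sum a a^* while
    [gram snd] is the transpose of sum b^* b, and both sides share one formula. *)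
Definition gram h L (s t : I) : C := \sum_(ab <- L) \sum_p h ab s p * (h ab t p)^*.

Definition tens L (s p t q : I) : C := \sum_(ab <- L) ab.1 s p * ab.2 t q.

Definition Ncol (x : I -> I -> C) : R := \sum_i \sum_p sq (x i p).

(** Concatenating lists adds these vectors, so they form a convex cone. *)
Definition hvec L : T -> R := tvec (gram fst L) (gram snd L) (tens L).

Definition bform (W : I -> I -> I -> I -> C) (x y : I -> I -> C) : C :=
  \sum_i \sum_p \sum_j \sum_q W i p j q * (x i p * y j q).

(** Here [th s p t q] is the (s, t) entry of the image of e_{p,q} under a map on matrices. That map
    is amplified n times and applied to the block matrix W; the result is evaluated as a bilinear
    form at (x, y). *)
Definition cb_value (W th : I -> I -> I -> I -> C) (x y : I -> I -> C) : C :=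
  \sum_s \sum_p \sum_t \sum_q th s p t q * (\sum_i \sum_j W i p j q * (x i s * y j t)).

(** Says that sum a a^* (for [fst]) or sum b^* b (for [snd]) is at most c as a form, up to
    conjugating z in the first case. *)
Definition quad_bound h L (c : R) := forall z : I -> C,
  \sum_(ab <- L) \sum_p sq (\sum_s h ab s p * z s) <= c * \sum_s sq (z s).

Lemma sq_ge0 (z : C) : 0 <= sq z. Proof. exact: sqr_ge0. Qed.

Lemma Ncol_ge0 x : 0 <= Ncol x.
Proof. by apply: sumr_ge0 => i _; apply: sumr_ge0 => p _; exact: sq_ge0. Qed.

Lemma tvecD f0 f1 f2 g0 g1 g2 x : tvec f0 f1 f2 x + tvec g0 g1 g2 x =
  tvec (fun s t => f0 s t + g0 s t) (fun s t => f1 s t + g1 s t)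
       (fun s p t q => f2 s p t q + g2 s p t q) x.
Proof. by case: x => [[] [[[s t]|[s t]]|[[s p] [t q]]]]; rewrite /tvec /= raddfD. Qed.

Lemma tvecB f0 f1 f2 g0 g1 g2 x : tvec f0 f1 f2 x - tvec g0 g1 g2 x =
  tvec (fun s t => f0 s t - g0 s t) (fun s t => f1 s t - g1 s t)
       (fun s p t q => f2 s p t q - g2 s p t q) x.
Proof. by case: x => [[] [[[s t]|[s t]]|[[s p] [t q]]]]; rewrite /tvec /= raddfB. Qed.

Lemma tvec_ext f0 f1 f2 g0 g1 g2 : (forall s t, f0 s t = g0 s t) ->
  (forall s t, f1 s t = g1 s t) -> (forall s p t q, f2 s p t q = g2 s p t q) ->
  tvec f0 f1 f2 = tvec g0 g1 g2.
Proof.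
move=> h0 h1 h2; apply/funext.
by case=> [b [[[s t]|[s t]]|[[s p] [t q]]]]; rewrite /tvec /= ?h0 ?h1 ?h2.
Qed.

Lemma hvec_nil : hvec [::] = fun=> 0.
Proof.
apply/funext; case=> [[] [[[s t]|[s t]]|[[s p] [t q]]]];
by rewrite /hvec /tvec /gram /tens /= big_nil.
Qed.

Lemma hvec_cat L1 L2 : hvec (L1 ++ L2) = fun x => hvec L1 x + hvec L2 x.
Proof.
rewrite /hvec; under [RHS]eq_fun do rewrite tvecD.
by apply: tvec_ext => *; rewrite /gram /tens big_cat.
Qed.

(** The square root sits on both factors, so all three components of [hvec] are multiplied by c. *)
Definition scale_list (c : R) L : seq P := [seq (fun s p => (Num.sqrt c)%:C%C * ab.1 s p,
  fun s p => (Num.sqrt c)%:C%C * ab.2 s p) | ab <- L].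

Lemma sqrt_sqC (c : R) : 0 < c -> (Num.sqrt c)%:C%C * (Num.sqrt c)%:C%C = c%:C%C :> C.
Proof. by move=> c0; rewrite -rmorphM /= -expr2 sqr_sqrtr// ltW. Qed.

Lemma conj_real (c : R) : (c%:C%C : C)^* = c%:C%C.
Proof. exact: conjc_real. Qed.

Lemma cpartZ (c : R) b (z : C) : cpart b (c%:C%C * z) = c * cpart b z.
Proof. by case: b z => -[x y] /=; rewrite mul0r ?subr0 ?addr0. Qed.

Lemma hvec_scale (c : R) L : 0 < c -> hvec (scale_list c L) = fun x => c * hvec L x.
Proof.
move=> c0; transitivity (tvec (fun s t => c%:C%C * gram fst L s t)
    (fun s t => c%:C%C * gram snd L s t) (fun s p t q => c%:C%C * tens L s p t q)).
  apply: tvec_ext => [s t|s t|s p t q]; rewrite ?/gram ?/tens big_map mulr_sumr;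
    apply: eq_bigr => ab _ /=.
  - rewrite mulr_sumr; apply: eq_bigr => p _; rewrite rmorphM /= conj_real -(sqrt_sqC c0); ring.
  - rewrite mulr_sumr; apply: eq_bigr => p _; rewrite rmorphM /= conj_real -(sqrt_sqC c0); ring.
  - rewrite -(sqrt_sqC c0); ring.
apply/funext => x; rewrite /hvec /tvec.
by case: x => [b [[[s t]|[s t]]|[[s p] [t q]]]] /=; rewrite cpartZ.
Qed.

Lemma gram_sq_le h ab : \sum_s \sum_t sq (gram h [:: ab] s t) <= Ncol (h ab) ^+ 2.
Proof.
rewrite /Ncol expr2 mulr_suml; apply: ler_sum => s _; rewrite mulr_sumr.
apply: ler_sum => t _; rewrite /gram big_seq1.
apply: (le_trans (cauchy_schwarz_complex _ _ _)); rewrite ler_wpM2l//.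
  by apply: sumr_ge0 => p _; exact: sq_ge0.
by apply: ler_sum => p _; rewrite nrm_conj.
Qed.

Lemma tens_sq ab : \sum_s \sum_p \sum_t \sum_q sq (tens [:: ab] s p t q)
  = Ncol ab.1 * Ncol ab.2.
Proof.
rewrite /Ncol mulr_suml; apply: eq_bigr => s _; rewrite mulr_suml.
apply: eq_bigr => p _; rewrite mulr_sumr; apply: eq_bigr => t _; rewrite mulr_sumr.
by apply: eq_bigr => q _; rewrite /tens big_seq1 sqM.
Qed.

Lemma hvec1_le ab : dotr (hvec [:: ab]) (hvec [:: ab]) <= (Ncol ab.1 + Ncol ab.2) ^+ 2.
Proof.
rewrite /hvec dotr_tvec_self tens_sq.
have h1 := gram_sq_le fst ab; have h2 := gram_sq_le snd ab.
have := Ncol_ge0 ab.1; have := Ncol_ge0 ab.2; move: h1 h2; rewrite /=.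
set x := Ncol _; set y := Ncol _; nra.
Qed.

(* Optimizes the bound over the positive multiples of the single tensor ab. *)
Lemma near_polar (w : T -> R) (e : R) ab : 0 < e ->
  (forall L, dotr w (hvec L) <= e * (dotr (hvec L) (hvec L) + 1)) ->
  dotr w (hvec [:: ab]) <= 2 * e * (Ncol ab.1 + Ncol ab.2).
Proof.
move=> e0 hw; apply/ler_addgt0Pr => d d0.
set k := hvec [:: ab]; set N := Ncol ab.1 + Ncol ab.2.
have N0 : 0 <= N by rewrite addr_ge0 ?Ncol_ge0.
(* The increment keeps N' positive even when both matrices of ab vanish, so that 1 / N' is an
   admissible scale; it costs exactly d at the end. *)
pose N' := N + d / (2 * e).
have N'0 : 0 < N' by rewrite ltr_wpDl// divr_gt0// mulr_gt0.
have kN : dotr k k <= N' ^+ 2.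
  apply: (le_trans (hvec1_le ab)); rewrite ler_sqr ?nnegrE ?(ltW N'0)//.
  by rewrite lerDl ltW// divr_gt0// mulr_gt0.
have rN : 0 < N'^-1 by rewrite invr_gt0.
have := hw (scale_list N'^-1 [:: ab]); rewrite hvec_scale//.
have -> : dotr w (fun x => N'^-1 * k x) = N'^-1 * dotr w k.
  by rewrite /dotr mulr_sumr; apply: eq_bigr => x _; rewrite mulrCA.
have -> : dotr (fun x => N'^-1 * k x) (fun x => N'^-1 * k x) = dotr k k / N' ^+ 2.
  rewrite /dotr mulr_suml; apply: eq_bigr => x _.
  by rewrite expr2 invfM; ring.
have h1 : dotr k k / N' ^+ 2 <= 1 by rewrite ler_pdivrMr ?exprn_gt0// mul1r.
rewrite mulrC ler_pdivrMr// => h.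
have -> : 2 * e * N + d = e * (1 + 1) * N' by rewrite /N'; field; rewrite gt_eqF.
apply: (le_trans h); rewrite ler_pM2r// ler_pM2l//; lra.
Qed.

Lemma gram_quad h L (z : I -> C) :
  (\sum_(ab <- L) \sum_p sq (\sum_s h ab s p * z s))%:C%C =
  \sum_s \sum_t gram h L s t * (z s * (z t)^*).
Proof.
rewrite rmorph_sum /=.
transitivity (\sum_(ab <- L) \sum_s \sum_t
    (\sum_p h ab s p * (h ab t p)^*) * (z s * (z t)^*)).
  apply: eq_bigr => ab _; rewrite rmorph_sum /=.
  transitivity (\sum_p \sum_s \sum_t (h ab s p * (h ab t p)^*) * (z s * (z t)^*)).
    apply: eq_bigr => p _; rewrite -mul_conj rmorph_sum mulr_suml; apply: eq_bigr => s _.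
    rewrite mulr_sumr; apply: eq_bigr => t _; rewrite rmorphM /=; ring.
  rewrite exchange_big; apply: eq_bigr => s _; rewrite exchange_big.
  by apply: eq_bigr => t _; rewrite mulr_suml.
rewrite exchange_big; apply: eq_bigr => s _; rewrite exchange_big.
by apply: eq_bigr => t _; rewrite /gram mulr_suml.
Qed.

Lemma sum_swap4 (F : I -> I -> I -> I -> C) :
  \sum_i \sum_p \sum_j \sum_q F i p j q = \sum_p \sum_q \sum_i \sum_j F i p j q.
Proof.
rewrite exchange_big; apply: eq_bigr => p _.
transitivity (\sum_i \sum_q \sum_j F i p j q).
  by apply: eq_bigr => i _; rewrite exchange_big.
by rewrite exchange_big.
Qed.

Lemma sum_subst (w A B : I -> I -> C) :
  \sum_s \sum_t w s t * ((\sum_i A s i) * (\sum_j B t j)) =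
  \sum_i \sum_j \sum_s \sum_t w s t * (A s i * B t j).
Proof.
transitivity (\sum_s \sum_i \sum_j \sum_t w s t * (A s i * B t j)); last first.
  rewrite exchange_big; apply: eq_bigr => i _; rewrite exchange_big.
  by apply: eq_bigr.
apply: eq_bigr => s _; transitivity (\sum_t \sum_i \sum_j w s t * (A s i * B t j)).
  apply: eq_bigr => t _; rewrite mulr_suml mulr_sumr; apply: eq_bigr => i _.
  by rewrite !mulr_sumr.
rewrite exchange_big; apply: eq_bigr => i _.
by rewrite exchange_big.
Qed.

End HaagerupFactorization.

Lemma ReB (R : realType) (z w : R[i]) : complex.Re (z - w) = complex.Re z - complex.Re w.
Proof. by case: z w => a b []. Qed.

(** * Approximate factorization by duality *)

Section HaagerupFactorizationTheorem.
Variables (R : realType) (n : nat).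
Notation C := R[i].
Notation I := 'I_n.
Notation sq z := (nrm (z : C^o) ^+ 2).
Notation P := ((I -> I -> C) * (I -> I -> C))%type.
Implicit Types (al : I -> C).

Definition qform (w : I -> I -> C) al : R :=
  complex.Re (\sum_s \sum_t w s t * (al s * (al t)^*)).

(* The form [3 e |al|^2 - qform w al] dominates [e |al|^2]; it is factored as [|L al|^2]. *)
Lemma qform_factor (w : I -> I -> C) (e : R) : 0 < e ->
  (forall al, qform w al <= 2 * e * \sum_s sq (al s)) ->
  exists L S : I -> I -> C,
  [/\ forall al, \sum_i sq (\sum_s L i s * al s) = 3 * e * (\sum_s sq (al s)) - qform w al,
      forall i j, \sum_s L i s * S s j = (i == j)%:R &
      forall s t, \sum_i S s i * L i t = (s == t)%:R].
Proof.
move=> e0 we.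
(* Only the Hermitian part of w enters the real part of the form. *)
pose M : 'M[C]_n := \matrix_(s, t) ((3 * e)%:C%C * (s == t)%:R - (w s t + (w t s)^*) / 2).
have Mform al : complex.Re (\sum_s \sum_t M s t * (al s * (al t)^*)) =
    3 * e * (\sum_s sq (al s)) - qform w al.
  have -> : \sum_s \sum_t M s t * (al s * (al t)^*) =
      ((3 * e) * (\sum_s sq (al s)))%:C%C -
      ((\sum_s \sum_t w s t * (al s * (al t)^*)) +
       (\sum_s \sum_t w s t * (al s * (al t)^*))^*) / 2.
    have -> : (\sum_s \sum_t w s t * (al s * (al t)^*))^* =
        \sum_s \sum_t (w t s)^* * (al s * (al t)^*).
      rewrite rmorph_sum exchange_big; apply: eq_bigr => s _; rewrite rmorph_sum.
      apply: eq_bigr => t _; rewrite !rmorphM /= conjCK; ring.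
    have -> : ((3 * e) * (\sum_s sq (al s)))%:C%C =
        \sum_s \sum_t (3 * e)%:C%C * (s == t)%:R * (al s * (al t)^*).
      rewrite rmorphM rmorph_sum mulr_sumr /=; apply: eq_bigr => s _.
      rewrite (bigD1 s)//= eqxx mulr1 mul_conj big1 ?addr0// => t /negbTE ts.
      by rewrite eq_sym ts mulr0 mul0r.
    rewrite -big_split mulr_suml -sumrB /=; apply: eq_bigr => s _.
    rewrite -big_split mulr_suml -sumrB /=; apply: eq_bigr => t _.
    by rewrite mxE; ring.
  set z := \sum_s \sum_t w s t * _; rewrite ReB Re_real; congr (_ - _).
  rewrite -/(qform w al) /qform -/z; case: z => x y.
  have -> : (x +i* y)%C + ((x +i* y)%C)^* = (x * 2)%:C%C.
    by apply/eqP; rewrite eq_complex /= subrr eqxx andbT; apply/eqP; ring.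
  have e2 : (2 : R)%:C%C = 2 :> C by exact: (rmorph_nat (real_complex R) 2).
  have -> : (x * 2)%:C%C = x%:C%C * (2 : R)%:C%C :> C by exact: rmorphM.
  by rewrite e2 mulfK ?pnatr_eq0.
have [||L [S [h1 h2 h3]]] := @spectral_factor R n M e e0.
- move=> s t; have cE : ((w s t + (w t s)^*) / 2)^* = (w t s + (w s t)^*) / 2.
    by rewrite rmorphM rmorphD /= conjCK fmorphV rmorph_nat addrC.
  have dE : ((3 * e)%:C%C * (s == t)%:R : C)^* = (3 * e)%:C%C * (s == t)%:R.
    by rewrite rmorphM /= conj_real rmorph_nat.
  by rewrite !mxE rmorphB /= cE dE eq_sym.
- move=> al; rewrite Mform lerBrDr; have := we al.
  by set N := \sum_s _; set q := qform _ _; lra.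
by exists L, S; split => // al; rewrite -h1 Mform.
Qed.

Lemma gram1_form (w : I -> I -> C) (h : P -> I -> I -> C) ab :
  complex.Re (\sum_s \sum_t w s t * gram h [:: ab] s t) = \sum_p qform w (fun s => h ab s p).
Proof.
rewrite /qform -Re_sum; congr complex.Re.
transitivity (\sum_s \sum_p \sum_t w s t * (h ab s p * (h ab t p)^*)).
  apply: eq_bigr => s _; rewrite exchange_big; apply: eq_bigr => t _.
  by rewrite /gram big_seq1 mulr_sumr.
by rewrite exchange_big.
Qed.

Lemma Ncol_swap (x : I -> I -> C) : Ncol x = \sum_p \sum_i sq (x i p).
Proof. exact: exchange_big. Qed.

Lemma sum_pick (c : I -> C) (i : I) : \sum_j (i == j)%:R * c j = c i.
Proof.
rewrite (bigD1 i)//= eqxx mul1r big1 ?addr0// => j /negbTE ji.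
by rewrite eq_sym ji mul0r.
Qed.

Lemma recover (L S x : I -> I -> C) :
  (forall i j, \sum_s L i s * S s j = (i == j)%:R) ->
  forall i p, \sum_s L i s * (\sum_j S s j * x j p) = x i p.
Proof.
move=> h i p; rewrite -[RHS](sum_pick (fun j => x j p)).
transitivity (\sum_s \sum_j L i s * S s j * x j p).
  by apply: eq_bigr => s _; rewrite mulr_sumr; apply: eq_bigr => j _; rewrite mulrA.
by rewrite exchange_big; apply: eq_bigr => j _; rewrite -mulr_suml h.
Qed.

Variables (th : I -> I -> I -> I -> C) (c : R).
Hypothesis c0 : 0 < c.
Hypothesis th_cb : forall W : I -> I -> I -> I -> C,
  (forall x y, sq (bform W x y) <= 4 * (Ncol x * Ncol y)) ->
  forall x y, sq (cb_value W th x y) <= 4 * c ^+ 2 * (Ncol x * Ncol y).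

Definition idvec : I -> I -> C := fun s t => c%:C%C * (s == t)%:R.

Lemma Re_diag (w : I -> I -> C) :
  complex.Re (\sum_s \sum_t w s t * idvec s t) = c * \sum_s complex.Re (w s s).
Proof.
rewrite -Re_sum -[RHS](_ : complex.Re (c%:C%C * \sum_s w s s) = _); last first.
  by case: (\sum_s w s s) => x y /=; rewrite mul0r subr0.
congr complex.Re; rewrite mulr_sumr; apply: eq_bigr => s _.
rewrite -(sum_pick (fun t => c%:C%C * w s t)); apply: eq_bigr => t _.
by rewrite /idvec; ring.
Qed.

(** Evaluation on the standard basis. It expresses the Hilbert-Schmidt norm of L by the trace of w,
    the quantity that pairs w with [idvec]. *)
Lemma factor_trace (w L : I -> I -> C) (e : R) :
  (forall al, \sum_i sq (\sum_s L i s * al s) = 3 * e * (\sum_s sq (al s)) - qform w al) ->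
  Ncol L = 3 * e * n%:R - \sum_s complex.Re (w s s).
Proof.
move=> h; rewrite Ncol_swap.
have e1 (s : I) : \sum_i sq (L i s) = 3 * e - complex.Re (w s s).
  have := h (fun t => (s == t)%:R); have -> : \sum_t sq ((s == t)%:R : C) = 1.
    rewrite (bigD1 s)//= eqxx nrm1 expr1n big1 ?addr0// => t /negbTE ts.
    by rewrite eq_sym ts nrm0 expr0n.
  rewrite mulr1 => e1; rewrite -[LHS](_ : \sum_i sq (\sum_t L i t * (s == t)%:R) = _).
    rewrite e1; congr (_ - _); rewrite /qform; congr complex.Re.
    rewrite -[RHS](sum_pick (fun t => w s t)) -[RHS](sum_pick (fun u =>  \sum_t (s == t)%:R * w u t)).
    apply: eq_bigr => u _; rewrite mulr_sumr; apply: eq_bigr => t _.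
    by rewrite rmorph_nat; ring.
  apply: eq_bigr => i _; congr (nrm _ ^+ 2); rewrite -[RHS](sum_pick (fun t => L i t)).
  by apply: eq_bigr => t _; rewrite mulrC.
under eq_bigr do rewrite e1.
by rewrite sumrB sumr_const card_ord -[X in X - _]mulr_natr.
Qed.

(** The target is the triple (c 1, c 1, th). If it stays away from the cone, a nearly polar w has
    components w0, w1, w2. Inverting the factors L0, L1 of the forms 3 e - w0 and 3 e - w1 turns w2
    into a test block W, and the complete bound of th at L0, L1 bounds the pairing of w2 with th by
    c (6 e n - tr w0 - tr w1), with real traces. Hence <w, v> <= 6 e n c, which is below the margin
    d. *)
Lemma haagerup_approx (e : R) : 0 < e -> exists L : seq P,
  [/\ forall s t, sq (gram fst L s t - idvec s t) <= e,
      forall s t, sq (gram snd L s t - idvec s t) <= e &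
      forall s p t q, sq (th s p t q - tens L s p t q) <= e].
Proof.
move: e; pose K := range (@hvec R n).
pose v := tvec idvec idvec th.
have K0 : K (fun=> 0) by exists [::] => //; exact: hvec_nil.
have KD k l : K k -> K l -> K (fun t => k t + l t).
  by move=> [L1 _ <-] [L2 _ <-]; exists (L1 ++ L2) => //; exact: hvec_cat.
have KZ (r : R) k : 0 < r -> K k -> K (fun t => r * k t).
  by move=> r0 [L _ <-]; exists (scale_list r L) => //; exact: hvec_scale.
have [h e e0|[d d0 hd]] := cone_separation v K0 KD KZ.
  have [_ [L _ <-] hL] := h e e0; exists L.
  have {hL} : dotr (fun x => v x - hvec L x) (fun x => v x - hvec L x) <= e by [].
  have -> : (fun x => v x - hvec L x) = tvec (fun s t => idvec s t - gram fst L s t)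
      (fun s t => idvec s t - gram snd L s t) (fun s p t q => th s p t q - tens L s p t q).
    by apply/funext => x; rewrite tvecB.
  rewrite dotr_tvec_self; set A := \sum_s \sum_t sq (idvec s t - gram fst L s t).
  set D := \sum_s \sum_t sq (idvec s t - gram snd L s t).
  set E := \sum_s \sum_p _ => hL.
  have A0 : 0 <= A by do 2 (apply: sumr_ge0 => ? _); exact: sq_ge0.
  have D0 : 0 <= D by do 2 (apply: sumr_ge0 => ? _); exact: sq_ge0.
  have E0 : 0 <= E by do 4 (apply: sumr_ge0 => ? _); exact: sq_ge0.
  split.
  - move=> s t; rewrite nrmBC; apply: (@le_trans _ _ A); last by lra.
    rewrite /A (bigD1 s)//= (bigD1 t)//= -addrA lerDl addr_ge0//.
      by apply: sumr_ge0 => ? _; exact: sq_ge0.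
    by do 2 (apply: sumr_ge0 => ? _); exact: sq_ge0.
  - move=> s t; rewrite nrmBC; apply: (@le_trans _ _ D); last by lra.
    rewrite /D (bigD1 s)//= (bigD1 t)//= -addrA lerDl addr_ge0//.
      by apply: sumr_ge0 => ? _; exact: sq_ge0.
    by do 2 (apply: sumr_ge0 => ? _); exact: sq_ge0.
  - move=> s p t q; apply: (@le_trans _ _ E); last by lra.
    rewrite /E (bigD1 s)//= (bigD1 p)//= (bigD1 t)//= (bigD1 q)//= -!addrA lerDl.
    by do ?[apply: addr_ge0]; do ?[apply: sumr_ge0 => ? _]; exact: sq_ge0.
exfalso.
(* The constant 6 collects 3 e n from each of the two traces; the added 1 makes the final inequality
   strict. *)
pose m : R := 6 * n%:R * c + 1.
have m0 : 0 < m by rewrite ltr_wpDl// !mulr_ge0// ltW.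
pose e := d / m.
have e0 : 0 < e by rewrite divr_gt0.
have [w [wK wv]] := hd e e0.
have polar ab : dotr w (hvec [:: ab]) <= 2 * e * (Ncol ab.1 + Ncol ab.2).
  by apply: near_polar => // L; apply: wK; exists L.
pose w0 s t := wc w (inl (inl (s, t))); pose w1 s t := wc w (inl (inr (s, t))).
pose w2 s p t q := wc w (inr ((s, p), (t, q))).
have dE ab : dotr w (hvec [:: ab]) = \sum_p qform w0 (fun s => ab.1 s p) +
    \sum_p qform w1 (fun s => ab.2 s p) +
    complex.Re (\sum_s \sum_p \sum_t \sum_q w2 s p t q * (ab.1 s p * ab.2 t q)).
  rewrite /hvec dotr_tvec (gram1_form w0 fst) (gram1_form w1 snd); congr (_ + _ + complex.Re _).
  apply: eq_bigr => s _; apply: eq_bigr => p _; apply: eq_bigr => t _.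
  by apply: eq_bigr => q _; rewrite /tens big_seq1.
have qform0 (w' : I -> I -> C) : qform w' (fun=> 0) = 0.
  by rewrite /qform big1// => s _; rewrite big1// => t _; rewrite mul0r mulr0.
have Ncol0 : Ncol (fun _ _ : I => 0 : C) = 0.
  by rewrite /Ncol big1// => s _; rewrite big1// => t _; rewrite nrm0 expr0n.
(* A pair with one nonzero column on one side reduces the polar condition to a bound at a single
   vector. *)
have single_col al (p0 : I) (w' : I -> I -> C) :
    \sum_p qform w' (fun s => if p == p0 then al s else 0) = qform w' al /\
    Ncol (fun s p => if p == p0 then al s else 0) = \sum_s sq (al s).
  split.
    by rewrite (bigD1 p0)//= eqxx big1 ?addr0// => p /negbTE ->; exact: qform0.
  apply: eq_bigr => s _; rewrite (bigD1 p0)//= eqxx big1 ?addr0// => p /negbTE ->.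
  by rewrite nrm0 expr0n.
(* For n = 0 there is no column to test on, but then every sum vanishes. *)
have empty_or al (Q : Prop) : (forall p0 : I, Q) -> ((forall f : I -> R, \sum_s f s = 0) ->
    (forall f : I -> C, \sum_s f s = 0) -> Q) -> Q.
  move=> h1 h2; case: (posnP n) => [n0|n0]; last by apply: h1; exact: Ordinal n0.
  by apply: h2 => f; rewrite big1// => i; exfalso; move: (ltn_ord i); rewrite [X in (_ < X)%N]n0.
have w0b al : qform w0 al <= 2 * e * \sum_s sq (al s).
  apply: (empty_or al) => [p0|hR hC]; last by rewrite /qform hR hC mulr0.
  have [h1 h2] := single_col al p0 w0.
  have := polar ((fun s p => if p == p0 then al s else 0), (fun _ _ => 0)).
  rewrite dE /= h1 h2 Ncol0 addr0.
  rewrite [X in _ + X + _]big1 => [|p _]; last exact: qform0.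
  rewrite [X in complex.Re X]big1 ?addr0// => s _; rewrite big1// => p _.
  by rewrite big1// => t _; rewrite big1// => q _; rewrite !mulr0.
have w1b al : qform w1 al <= 2 * e * \sum_s sq (al s).
  apply: (empty_or al) => [p0|hR hC]; last by rewrite /qform hR hC mulr0.
  have [h1 h2] := single_col al p0 w1.
  have := polar ((fun _ _ => 0), (fun s p => if p == p0 then al s else 0)).
  rewrite dE /= h1 h2 Ncol0 add0r.
  rewrite [X in X + _ + _]big1 => [|p _]; last exact: qform0.
  rewrite add0r [X in complex.Re X]big1 ?addr0// => s _; rewrite big1// => p _.
  by rewrite big1// => t _; rewrite big1// => q _; rewrite mul0r mulr0.
have [L0 [S0 [hL0 hLS0 hSL0]]] := qform_factor e0 w0b.
have [L1 [S1 [hL1 hLS1 hSL1]]] := qform_factor e0 w1b.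
(* This is w2 in the coordinates where the two dominating forms become Euclidean. *)
pose W i p j q := \sum_s \sum_t w2 s p t q * (S0 s i * S1 t j).
have WE (x y : I -> I -> C) p q : \sum_i \sum_j W i p j q * (x i p * y j q) =
    \sum_s \sum_t w2 s p t q * ((\sum_i S0 s i * x i p) * (\sum_j S1 t j * y j q)).
  rewrite sum_subst; apply: eq_bigr => i _; apply: eq_bigr => j _.
  rewrite /W mulr_suml; apply: eq_bigr => s _; rewrite mulr_suml.
  by apply: eq_bigr => t _; ring.
have WB x y : complex.Re (bform W x y) <= Ncol x + Ncol y.
  pose ax s p := \sum_i S0 s i * x i p; pose ay t q := \sum_j S1 t j * y j q.
  have -> : bform W x y = \sum_s \sum_p \sum_t \sum_q w2 s p t q * (ax s p * ay t q).
    rewrite /bform sum_swap4 [RHS]sum_swap4; apply: eq_bigr => p _.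
    by apply: eq_bigr => q _; rewrite WE.
  have := polar (ax, ay); rewrite dE /=.
  have cx : Ncol x = 3 * e * Ncol ax - \sum_p qform w0 (fun s => ax s p).
    rewrite Ncol_swap Ncol_swap mulr_sumr -sumrB; apply: eq_bigr => p _.
    by rewrite -hL0; apply: eq_bigr => i _; rewrite (recover _ hLS0).
  have cy : Ncol y = 3 * e * Ncol ay - \sum_p qform w1 (fun s => ay s p).
    rewrite Ncol_swap Ncol_swap mulr_sumr -sumrB; apply: eq_bigr => p _.
    by rewrite -hL1; apply: eq_bigr => i _; rewrite (recover _ hLS1).
  have := Ncol_ge0 ax; have := Ncol_ge0 ay; rewrite cx cy.
  move: e0; clear; set X := Ncol ax; set Y := Ncol ay.
  move: (\sum_p qform w0 _) (\sum_p qform w1 _) (complex.Re _) => a b z e0 Y0 X0 h.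
  have := mulr_ge0 (ltW e0) X0; have := mulr_ge0 (ltW e0) Y0; nra.
(* Evaluating at L0 and L1 undoes S0 and S1, so the value is the pairing of w2 with th. *)
have hval := th_cb (bilinear_bound WB) L0 L1.
have valE : cb_value W th L0 L1 = \sum_s \sum_p \sum_t \sum_q w2 s p t q * th s p t q.
  apply: eq_bigr => s _; apply: eq_bigr => p _; apply: eq_bigr => t _.
  apply: eq_bigr => q _; rewrite mulrC; congr (_ * _).
  have := WE (fun i _ => L0 i s) (fun j _ => L1 j t) p q; rewrite /= => ->.
  transitivity (\sum_s' \sum_t' w2 s' p t' q * ((s' == s)%:R * (t' == t)%:R)).
    by apply: eq_bigr => s' _; apply: eq_bigr => t' _; rewrite hSL0 hSL1.
  rewrite -[RHS](sum_pick (fun s' => w2 s' p t q)); apply: eq_bigr => s' _.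
  rewrite -(sum_pick (fun t' => w2 s' p t' q)) mulr_sumr; apply: eq_bigr => t' _.
  by rewrite (eq_sym s') (eq_sym t'); ring.
rewrite valE in hval.
have hL0t := factor_trace hL0; have hL1t := factor_trace hL1.
have wvE : dotr w v = c * (\sum_s complex.Re (w0 s s)) + c * (\sum_s complex.Re (w1 s s))
    + complex.Re (\sum_s \sum_p \sum_t \sum_q w2 s p t q * th s p t q).
  by rewrite /v dotr_tvec (Re_diag w0) (Re_diag w1).
set z := \sum_s _ in hval wvE.
have zle : complex.Re z <= c * (Ncol L0 + Ncol L1).
  apply: (le_trans (Re_le_nrm z)).
  have s0 : 0 <= c * (Ncol L0 + Ncol L1) by rewrite mulr_ge0 ?addr_ge0 ?Ncol_ge0 ?(ltW c0).
  rewrite -ler_sqr ?nnegrE ?nrm_ge0//; apply: (le_trans hval).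
  rewrite [leRHS]exprMn -mulrA mulrCA ler_wpM2l ?sqr_ge0//.
  by have := sqr_ge0 (Ncol L0 - Ncol L1); lra.
have em : e * (6 * n%:R * c) < d.
  have -> : d = e * m by rewrite /e divfK ?gt_eqF.
  by rewrite ltr_pM2l// /m ltrDl.
move: zle wv; rewrite wvE hL0t hL1t; nra.
Qed.

End HaagerupFactorizationTheorem.

(** * Correcting the approximate factorization *)

Section HaagerupExact.
Variables (R : realType) (n : nat).
Notation C := R[i].
Notation I := 'I_n.
Notation sq z := (nrm (z : C^o) ^+ 2).
Notation P := ((I -> I -> C) * (I -> I -> C))%type.
Notation X := ((I * I) * (I * I))%type.
Implicit Types (L : seq P) (h : P -> I -> I -> C).

Lemma sum_nrm_sq (z : I -> C) :
  (\sum_s nrm (z s : C^o)) ^+ 2 <= n%:R * \sum_s sq (z s).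
Proof.
have h := cauchy_schwarz_real (index_enum I) (fun=> 1) (fun s => nrm (z s : C^o)).
have e1 : \sum_(s : I) 1 * nrm (z s : C^o) = \sum_s nrm (z s : C^o).
  by apply: eq_bigr => s _; rewrite mul1r.
have e2 : \sum_(s : I) (1 : R) ^+ 2 = n%:R by rewrite expr1n sumr_const card_ord.
by rewrite e1 e2 in h.
Qed.

(** An entrywise error e changes the form by at most e (sum |z_s|)^2 <= e n |z|^2. *)
Lemma quad_of_gram h L (c e : R) : 0 <= e ->
  (forall s t, sq (gram h L s t - idvec c s t) <= e ^+ 2) ->
  quad_bound h L (c + e * n%:R).
Proof.
move=> e0 hL z.
set Q := \sum_(ab <- L) _.
have QE : Q = complex.Re (\sum_s \sum_t gram h L s t * (z s * (z t)^*)).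
  by rewrite -gram_quad Re_real.
have idE : complex.Re (\sum_s \sum_t idvec c s t * (z s * (z t)^*)) = c * \sum_s sq (z s).
  rewrite mulr_sumr Re_sum; apply: eq_bigr => s _.
  have -> : \sum_t idvec c s t * (z s * (z t)^*) = (c * sq (z s))%:C%C.
    rewrite rmorphM /= -mul_conj -[RHS](sum_pick (fun t => c%:C%C * (z s * (z t)^*)) s).
    by apply: eq_bigr => t _; rewrite /idvec; ring.
  by [].
have hd : complex.Re (\sum_s \sum_t (gram h L s t - idvec c s t) * (z s * (z t)^*))
    <= e * (\sum_s nrm (z s : C^o)) ^+ 2.
  rewrite expr2 mulr_suml mulr_sumr Re_sum; apply: ler_sum => s _.
  rewrite mulr_sumr mulr_sumr Re_sum; apply: ler_sum => t _.
  apply: (le_trans (Re_le_nrm _)); rewrite nrmM nrmM nrm_conj.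
  rewrite ler_wpM2r ?mulr_ge0 ?nrm_ge0//.
  by rewrite -ler_sqr ?nnegrE ?nrm_ge0.
have -> : Q = c * \sum_s sq (z s) +
    complex.Re (\sum_s \sum_t (gram h L s t - idvec c s t) * (z s * (z t)^*)).
  rewrite QE -idE -[X in _ = _ + X](_ : complex.Re
    (\sum_s \sum_t gram h L s t * (z s * (z t)^*) - \sum_s \sum_t idvec c s t * (z s * (z t)^*)) = _).
    by rewrite ReB addrC subrK.
  congr complex.Re; rewrite -sumrB; apply: eq_bigr => s _.
  by rewrite -sumrB; apply: eq_bigr => t _; rewrite mulrBl.
rewrite mulrDl lerD2l; apply: (le_trans hd); rewrite -mulrA ler_wpM2l//.
exact: sum_nrm_sq.
Qed.

(* Single matrix units absorbing an entrywise error rh, with each side of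
   square norm at most e. *)
Definition unit_pair (e : R) (rh : I -> I -> I -> I -> C) (x : X) : P :=
  (fun s p => (Num.sqrt e)%:C%C * ((s == x.1.1)%:R * (p == x.1.2)%:R),
   fun t q => rh x.1.1 x.1.2 x.2.1 x.2.2 / (Num.sqrt e)%:C%C *
     ((t == x.2.1)%:R * (q == x.2.2)%:R)).

Definition error_list e rh : seq P := [seq unit_pair e rh x | x <- index_enum X].

Lemma error_tens (e : R) rh s p t q : 0 < e -> tens (error_list e rh) s p t q = rh s p t q.
Proof.
move=> e0; rewrite /tens big_map (bigD1 ((s, p), (t, q)))//= !eqxx !mulr1 big1 ?addr0.
  by rewrite mulrCA divff ?mulr1// fmorph_eq0 sqrtr_eq0 -ltNge.
move=> [[s' p'] [t' q']] /= ne; have [/andP[]|] := boolP ((s == s') && (p == p')).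
  move=> /eqP ss /eqP pp; have [/andP[]|] := boolP ((t == t') && (q == q')).
    by move=> /eqP tt /eqP qq; rewrite ss pp tt qq eqxx in ne.
  by rewrite negb_and => /orP[] /negbTE ->; rewrite ?mul0r !mulr0.
by rewrite negb_and => /orP[] /negbTE ->; rewrite ?mul0r !mulr0 !mul0r.
Qed.

Lemma unit_quad (k : C) (i j : I) (z : I -> C) :
  \sum_p sq (\sum_s k * ((s == i)%:R * (p == j)%:R) * z s) = sq k * sq (z i).
Proof.
have e p : \sum_s k * ((s == i)%:R * (p == j)%:R) * z s = (p == j)%:R * (k * z i).
  rewrite -(sum_pick (fun s => k * z s) i) mulr_sumr; apply: eq_bigr => s _.
  by rewrite (eq_sym i); ring.
under eq_bigr do rewrite e sqM nrm_bool.
rewrite (bigD1 j)//= eqxx expr1n mul1r big1 ?addr0 ?sqM// => p /negbTE ->.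
by rewrite expr0n mul0r.
Qed.

Lemma coord_sq_le (z : I -> C) i : sq (z i) <= \sum_s sq (z s).
Proof.
by rewrite (bigD1 i)//= lerDl; apply: sumr_ge0 => s _; exact: sq_ge0.
Qed.

Lemma error_quad_fst (e : R) rh : 0 < e ->
  quad_bound fst (error_list e rh) (e * #|{: X}|%:R).
Proof.
move=> e0 z; rewrite big_map.
apply: (@le_trans _ _ (\sum_(x : X) e * \sum_s sq (z s))).
  apply: ler_sum => x _; rewrite unit_quad nrm_real ger0_norm ?sqrtr_ge0//.
  by rewrite sqr_sqrtr ?(ltW e0)// ler_pM2l// coord_sq_le.
by rewrite sumr_const -[leLHS]mulr_natr mulrAC.
Qed.

Lemma error_quad_snd (e : R) rh : 0 < e ->
  (forall s p t q, sq (rh s p t q) <= e ^+ 2) ->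
  quad_bound snd (error_list e rh) (e * #|{: X}|%:R).
Proof.
move=> e0 he z; rewrite big_map.
apply: (@le_trans _ _ (\sum_(x : X) e * \sum_s sq (z s))).
  apply: ler_sum => x _; rewrite unit_quad.
  apply: ler_pM; rewrite ?sq_ge0 ?coord_sq_le//.
  have s0 : 0 < Num.sqrt e by rewrite sqrtr_gt0.
  rewrite -[X in rh _ _ _ _ * X](_ : ((Num.sqrt e)^-1)%:C%C = _); last exact: fmorphV.
  rewrite sqM nrm_real ger0_norm ?invr_ge0 ?(ltW s0)// exprVn sqr_sqrtr ?(ltW e0)//.
  by rewrite ler_pdivrMr// -expr2.
by rewrite sumr_const -[leLHS]mulr_natr mulrAC.
Qed.

Lemma quad_bound_cat h L1 L2 (c d : R) : quad_bound h L1 c -> quad_bound h L2 d ->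
  quad_bound h (L1 ++ L2) (c + d).
Proof. by move=> h1 h2 z; rewrite big_cat mulrDl lerD. Qed.

Lemma quad_bound_le h L (c d : R) : c <= d -> quad_bound h L c -> quad_bound h L d.
Proof.
move=> cd hL z; apply: (le_trans (hL z)); rewrite ler_wpM2r//.
by apply: sumr_ge0 => s _; exact: sq_ge0.
Qed.

(* The finite-dimensional Haagerup-Paulsen-Wittstock factorization, with an
   inessential loss of a factor 2 in the constant. *)
Theorem haagerup_fin (th : I -> I -> I -> I -> C) (c : R) : 0 < c ->
  (forall W : I -> I -> I -> I -> C,
    (forall x y, sq (bform W x y) <= 4 * (Ncol x * Ncol y)) ->
    forall x y, sq (cb_value W th x y) <= 4 * c ^+ 2 * (Ncol x * Ncol y)) ->
  exists L, [/\ forall s p t q, th s p t q = tens L s p t q,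
    quad_bound fst L (2 * c) & quad_bound snd L (2 * c)].
Proof.
(* The error budget: e n for the inexact identity and e times the number of index quadruples for the
   correcting units, together at most c. *)
move=> c0 hcb; pose m : R := n%:R + #|{: X}|%:R + 1.
have m0 : 0 < m by rewrite ltr_wpDl.
pose e := c / m; have e0 : 0 < e by rewrite divr_gt0.
have em : c + e * n%:R + e * #|{: X}|%:R <= 2 * c.
  have : c = e * m by rewrite /e divfK ?gt_eqF.
  by rewrite /m !mulrDr mulr1; lra.
have [L [h0 h1 h2]] := haagerup_approx c0 hcb (exprn_gt0 2 e0).
pose rh s p t q := th s p t q - tens L s p t q.
exists (L ++ error_list e rh); split.
- move=> s p t q; have := error_tens rh s p t q e0.
  by rewrite /tens big_cat /= -!/(tens _ _ _ _ _) => ->; rewrite /rh addrC subrK.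
- apply: (quad_bound_le em); apply: quad_bound_cat; last exact: error_quad_fst.
  by apply: quad_of_gram; [exact: ltW|].
- apply: (quad_bound_le em); apply: quad_bound_cat; last exact: error_quad_snd.
  by apply: quad_of_gram; [exact: ltW|].
Qed.

End HaagerupExact.

(** * From multipliers to the Haagerup tensor product *)

Lemma bop_scale (R : realType) (H K : normedModType R[i]) (T : bop H K) (a : R[i]) x :
  T (a *: x) = a *: T x.
Proof. exact: linearZ. Qed.

(** * Scalar functionals and uniform truncation of spans *)

Section ScalarMatrices.
Variables (R : realType) (G : groupType).
Notation ell := (ell2 G R[i]^o).
Notation B := (B_ell2 R G).

(** A scalar matrix acts separately in each coordinate r of ell, so its bound on C^m is summed over
    r. *)
Lemma scal_mx_vec m (k : 'I_m -> 'I_m -> R[i]) (K : R) :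
  (forall z : 'I_m -> R[i]^o, \sum_i nrm (\sum_j k i j *: z j) ^+ 2
     <= K ^+ 2 * \sum_j nrm (z j) ^+ 2) ->
  forall xi : 'I_m -> ell, \sum_i nrm (\sum_j k i j *: xi j) ^+ 2
     <= K ^+ 2 * \sum_j nrm (xi j) ^+ 2.
Proof.
move=> hk xi; rewrite -lee_fin -sumEFin.
under eq_bigr do rewrite -ell2_nrm_esum.
rewrite -esum_sum; last by move=> r i _ _; rewrite lee_fin sqr_ge0.
have -> : (K ^+ 2 * \sum_j nrm (xi j) ^+ 2)%:E =
    (\esum_(r in [set: G]) ((K ^+ 2)%:E * \sum_j (nrm (xi j r) ^+ 2)%:E))%E.
  rewrite ge0_esumZl ?sqr_ge0//; last first.
    by move=> r; apply: sume_ge0 => j _; rewrite lee_fin sqr_ge0.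
  rewrite esum_sum; last by move=> r j _ _; rewrite lee_fin sqr_ge0.
  rewrite EFinM -sumEFin; congr (_ * _)%E; apply: eq_bigr => j _.
  by rewrite ell2_nrm_esum.
apply: le_esum => r _; rewrite !sumEFin -EFinM lee_fin.
apply: (le_trans _ (hk (fun j => xi j r))); apply: ler_sum => i _.
by rewrite ell2_sumE.
Qed.

Lemma coef_mx_vec m (x : 'M[B]_m) s t (z : 'I_m -> R[i]^o) :
  \sum_i nrm (\sum_j mxcoef (x i j) s t *: z j) ^+ 2
     <= mxnorm x ^+ 2 * \sum_j nrm (z j) ^+ 2.
Proof.
have h := mxnormP x (fun j => z j *: delta R t).
have e : \sum_j nrm (z j *: delta R t) ^+ 2 = \sum_j nrm (z j) ^+ 2.
  by apply: eq_bigr => j _; rewrite nrmZ nrm_delta mulr1.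
rewrite e in h; apply: (le_trans _ h); apply: ler_sum => i _.
rewrite ler_sqr ?nnegrE ?nrm_ge0//.
have -> : \sum_j mxcoef (x i j) s t *: z j = (\sum_j x i j (z j *: delta R t)) s.
  rewrite ell2_sumE; apply: eq_bigr => j _; rewrite linearZ.
  by rewrite (ell2ZE (z j) (x i j (delta R t)) s) /mxcoef; exact: mulrC.
exact: ell2_coord_le.
Qed.

(** A matrix coefficient times a fixed operator b is completely bounded with constant |b|: the
    scalar matrix of coefficients is a compression of x. *)
Lemma scal_mxnorm m (x : 'M[B]_m) s t (b : B) :
  mxnorm (\matrix_(i, j) (mxcoef (x i j) s t *: b)) <= mxnorm x * nrm b.
Proof.
apply: mxnorm_le => [|xi]; first by rewrite mulr_ge0 ?mxnorm_ge0 ?nrm_ge0.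
have e i : \sum_j (\matrix_(i, j) (mxcoef (x i j) s t *: b)) i j (xi j)
    = b (\sum_j mxcoef (x i j) s t *: xi j).
  rewrite linear_sum; apply: eq_bigr => j _; rewrite mxE linearZ.
  exact: bopZE.
under eq_bigr do rewrite e.
apply: (@le_trans _ _ (\sum_i nrm b ^+ 2 * nrm (\sum_j mxcoef (x i j) s t *: xi j) ^+ 2)).
  apply: ler_sum => i _; rewrite -exprMn ler_sqr ?nnegrE ?mulr_ge0 ?nrm_ge0//.
  exact: nrm_bopP.
rewrite -mulr_sumr exprMn (mulrC (mxnorm x ^+ 2)) -(mulrA (nrm b ^+ 2) (mxnorm x ^+ 2)).
apply: ler_wpM2l; first exact: sqr_ge0.
apply: scal_mx_vec; exact: coef_mx_vec.
Qed.

Lemma mxcoefZD (c : R[i]) (x y : B) s t :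
  mxcoef (c *: x + y) s t = c * mxcoef x s t + mxcoef y s t.
Proof. by rewrite /mxcoef; exact: (bopZD_ell2E c x y (delta R t) s). Qed.

Lemma mxcoef_sum (J : Type) (r : seq J) (c : J -> R[i]) (x : J -> B) s t :
  mxcoef (\sum_(j <- r) c j *: x j) s t = \sum_(j <- r) c j * mxcoef (x j) s t.
Proof.
elim: r => [|j r IH]; first by rewrite !big_nil.
by rewrite !big_cons mxcoefZD IH.
Qed.

Lemma mxcoef_eq0 (x : B) : (forall s t, mxcoef x s t = 0) -> x = 0.
Proof.
move=> h; apply: bop_eq => xi.
have d0 t : x (delta R t) = 0 by apply: ell2_eq => s; exact: h.
apply: (hsum_uniq (hsum_bop x (delta_hsum xi))).
apply: (hsum_ext (f := fun=> 0)) => [s|].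
  by rewrite (bop_scale x) d0 scaler0.
have := @hsum_fin _ _ _ (fun=> 0 : ell) (fset0 : {fset G}).
by rewrite big_seq_fset0; apply.
Qed.

(* Operators with small tails; these are exactly the compact ones. *)
Definition approximable (b : B) := forall e : R, 0 < e -> exists A : {fset G},
  forall D, (A `<=` D)%fset -> nrm (b - cproj D \oB b \oB cproj D) <= e.

Lemma compress_ZD D (c : R[i]) (x y : B) :
  c *: x + y - cproj D \oB (c *: x + y) \oB cproj D =
  c *: (x - cproj D \oB x \oB cproj D) + (y - cproj D \oB y \oB cproj D).
Proof. by rewrite compDr compZr compDl compZl scalerBr opprD addrACA. Qed.

Lemma approximable_ZD (c : R[i]) (x y : B) :
  approximable x -> approximable y -> approximable (c *: x + y).
Proof.
move=> hx hy e e0; have n0 : 0 < Normc.normc c + 1 by rewrite ltr_wpDl ?normc_ge0.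
have e2 : 0 < e / 2 by rewrite divr_gt0.
have [A hA] := hx _ (divr_gt0 e2 n0); have [A' hA'] := hy _ e2.
exists (A `|` A')%fset => D; rewrite fsubUset => /andP[h1 h2].
rewrite compress_ZD (splitr e); apply: (le_trans (nrmD _ _)); apply: lerD; last exact: hA'.
rewrite nrmZ; apply: (@le_trans _ _ ((Normc.normc c + 1) * (e / 2 / (Normc.normc c + 1)))).
  by apply: ler_pM; rewrite ?normc_ge0 ?nrm_ge0 ?hA// lerDl.
by rewrite mulrC divfK ?gt_eqF.
Qed.

Lemma approximable_closed (b : B) :
  (forall e : R, 0 < e -> exists2 x, approximable x & nrm (x - b) <= e) -> approximable b.
Proof.
move=> h e e0; have e3 : 0 < e / 3 by rewrite divr_gt0.
have [x ax xb] := h _ e3; have [A hA] := ax _ e3; exists A => D AD.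
have -> : b - cproj D \oB b \oB cproj D = (b - x) + (x - cproj D \oB x \oB cproj D)
    + cproj D \oB (x - b) \oB cproj D.
  by rewrite compBr compBl; exact: sub_telescope3.
have -> : e = e / 3 + e / 3 + e / 3 by field.
apply: (le_trans (nrmD _ _)); apply: lerD.
  apply: (le_trans (nrmD _ _)); apply: lerD; first by rewrite nrmBC.
  exact: hA.
apply: (le_trans (nrm_comp _ _)); apply: (@le_trans _ _ (nrm (cproj D \oB (x - b)))).
  by rewrite ler_piMr ?nrm_ge0 ?nrm_proj.
apply: (le_trans (nrm_comp _ _)); apply: (le_trans _ xb).
by rewrite ler_piMl ?nrm_ge0 ?nrm_proj.
Qed.

Definition in_span (l : seq B) (x : B) :=
  exists c : nat -> R[i], x = \sum_(i < size l) c i *: nth 0 l i.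

Definition comp_mx D m (y : 'M[B]_m) : 'M[B]_m :=
  map_mx (fun z => z - cproj D \oB z \oB cproj D) y.

(* Induction on the number of generators: a nonzero matrix coefficient of the
   first one is a completely bounded functional that splits it off. *)
Lemma span_uniform_trunc (l : seq B) : (forall b, List.In b l -> approximable b) ->
  forall e : R, 0 < e -> exists A : {fset G}, forall D, (A `<=` D)%fset ->
    forall m (y : 'M[B]_m), (forall i j, in_span l (y i j)) ->
      mxnorm (comp_mx D y) <= e * mxnorm y.
Proof.
have [k hk] := ubnP (size l); elim: k l hk => // k IH [|b l] hk al e e0.
  exists fset0 => D _ m y hy; have -> : comp_mx D y = 0.
    apply/matrixP => i j; rewrite mxE [RHS]mxE; have [c ->] := hy i j.
    have p0 : cproj D \oB 0 \oB cproj D = 0 :> B.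
      by apply: bop_eq => x; exact: (linear0 (cproj D)).
    by rewrite big_ord0 p0 subr0.
  by rewrite mxnorm0 mulr_ge0 ?mxnorm_ge0// ltW.
have [h|] := pselect (forall s t, mxcoef b s t = 0).
  have b0 := mxcoef_eq0 h.
  have [|x xl|A hA] := IH l _ _ e e0; first by [].
    by apply: al; right.
  exists A => D AD m y hy; apply: hA => // i j; have [c ->] := hy i j.
  exists (fun i => c i.+1); rewrite big_ord_recl /= b0 scaler0 add0r.
  by apply: eq_bigr.
move=> /existsNP[s /existsNP[t /eqP bst]].
(* Normalized by f(b) = 1. The map y |-> f(y) b has completely bounded norm at most [q], and y -
   f(y) b lies in the span of the corrected generators [l']. *)
pose f x := mxcoef x s t / mxcoef b s t.
pose l' := [seq x - f x *: b | x <- l].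
pose q := nrm b / nrm (mxcoef b s t : R[i]^o).
have q0 : 0 <= q by rewrite divr_ge0 ?nrm_ge0.
have e2 : 0 < e / 2 by rewrite divr_gt0.
have m0 : 0 < nrm (mxcoef b s t : R[i]^o).
  rewrite lt_neqAle nrm_ge0 andbT eq_sym; apply: contra_neq bst.
  exact: (@nrm0_eq0 _ R[i]^o).
have q1 : 0 < 1 + q by rewrite ltr_pwDl.
have [|x|A hA] := IH l' _ _ _ (divr_gt0 e2 q1).
- by rewrite size_map.
- move=> /List.in_map_iff[z [<- zl]]; rewrite addrC -scaleNr.
  by apply: approximable_ZD; [apply: al; left|apply: al; right].
have [A' hA'] := al b (or_introl erefl) _ (mulr_gt0 e2 m0).
exists (A `|` A')%fset => D; rewrite fsubUset => /andP[AD A'D] m y hy.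
pose y1 : 'M[B]_m := \matrix_(i, j) (f (y i j) *: b).
pose y2 : 'M[B]_m := y - y1.
have hy1 : mxnorm y1 <= q * mxnorm y.
  have -> : y1 = \matrix_(i, j) (mxcoef (y i j) s t *: ((mxcoef b s t)^-1 *: b)).
    by apply/matrixP => i j; rewrite !mxE scalerA.
  apply: (le_trans (scal_mxnorm _ _ _ _)); rewrite nrmZ Normc.normcV -nrm_normc.
  by rewrite mulrC /q [X in X * _ <= _]mulrC.
have hy2 : mxnorm y2 <= (1 + q) * mxnorm y.
  by apply: (le_trans (mxnormB _ _)); rewrite mulrDl mul1r lerD2l.
have sp2 i j : in_span l' (y2 i j).
  rewrite /y2 /y1; have [c yE] := hy i j; exists (fun i => c i.+1).
  have -> : (y - \matrix_(i, j) (f (y i j) *: b)) i j = y i j - f (y i j) *: b.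
    by rewrite !mxE.
  rewrite size_map.
  have fE : f (y i j) = c 0%N + \sum_(u < size l) c u.+1 * f (nth 0 l u).
    rewrite /f yE mxcoef_sum big_ord_recl /= mulrDl mulfK//; congr (_ + _).
    by rewrite mulr_suml; apply: eq_bigr => u _; rewrite mulrA.
  rewrite {1}yE fE big_ord_recl /= scalerDl opprD addrACA subrr add0r.
  rewrite scaler_suml -sumrB; apply: eq_bigr => u _.
  by rewrite (nth_map 0)// scalerBr scalerA.
have h2 := hA D AD m y2 sp2.
have h1 : mxnorm (comp_mx D y1) <= e / 2 * mxnorm y.
  pose b' := b - cproj D \oB b \oB cproj D.
  have -> : comp_mx D y1 = \matrix_(i, j) (mxcoef (y i j) s t *: ((mxcoef b s t)^-1 *: b')).
    apply/matrixP => i j; rewrite !mxE /b' scalerA.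
    by rewrite compZr compZl -scalerBr.
  apply: (le_trans (scal_mxnorm _ _ _ _)); rewrite nrmZ Normc.normcV -nrm_normc mulrC.
  rewrite ler_wpM2r ?mxnorm_ge0// mulrC ler_pdivrMr//.
  exact: hA'.
have -> : comp_mx D y = comp_mx D y2 + comp_mx D y1.
  apply/matrixP => i j; rewrite mxE [RHS]mxE /comp_mx !mxE -/(y1 i j).
  rewrite -[X in X - _](subrK (y1 i j)) /y1 mxE.
  by have := compress_ZD D 1 (y i j - f (y i j) *: b) (f (y i j) *: b); rewrite !scale1r subrK.
have ee : e * mxnorm y = e / 2 * mxnorm y + e / 2 * mxnorm y by field.
rewrite ee; apply: (le_trans (mxnormD _ _)); apply: (lerD _ h1).
apply: (le_trans h2); apply: (@le_trans _ _ (e / 2 / (1 + q) * ((1 + q) * mxnorm y))).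
  by apply: ler_wpM2l hy2; exact: ltW (divr_gt0 e2 q1).
by rewrite mulrA (divfK (lt0r_neq0 q1)) lexx.
Qed.

End ScalarMatrices.

Lemma bopB_ell2E (R : realType) (I : choiceType) (H V : normedModType R[i])
    (S T : bop H (ell2 I V)) x i : (S - T) x i = S x i - T x i.
Proof. by rewrite (bopBE S T) (ell2BE (S x) (T x)). Qed.

(** * The multiplier on matrix units and truncation of its range *)

Section MultiplierOnMatrixUnits.
Variables (R : realType) (G : groupType).
Notation ell := (ell2 G R[i]^o).
Notation H := (ell2 G ell).
Notation B := (B_ell2 R G).
Notation C0 := (c0_mulops R G).
Notation act := (c0_act R G).
Notation XD := (pi_tilde act @` l1 C0).
Notation X := (crossed_product C0 act).
Notation lam := (lambda R[i]^o).
Notation mdelta p := (mulop (fun s => (s == p)%:R)).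

Lemma C0_mdelta (p : G) : C0 (mdelta p).
Proof. by exists (fun s => (s == p)%:R) => //; exact: c0_ind1. Qed.

Lemma mulop_fin_approx (a : G -> R[i]) : c0 a -> forall e : R, 0 < e ->
  exists A : {fset G}, nrm (mulop a - \sum_(p <- A) a p *: mdelta p) <= e.
Proof.
move=> ca e e0; have fin : finite_set [set s | e%:C%C <= `|a s|].
  by apply: ca; rewrite ltcR.
exists (fset_set [set s | e%:C%C <= `|a s|]); set A := fset_set _.
apply/opnorm_leP => [|xi]; first exact: ltW.
apply/ell2_nrm_leP => [|D]; first by rewrite mulr_ge0 ?nrm_ge0// ltW.
have coordE s : (mulop a - \sum_(p <- A) a p *: mdelta p) xi s
    = (s \notin A)%:R * (a s * xi s).
  have h : (\sum_(p <- A) a p *: mdelta p) xi s = (s \in A)%:R * (a s * xi s).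
    rewrite bop_sumE ell2_sumE -(sum_fset_pick A s (fun p => a p * xi s)).
    apply: eq_bigr => p _; refine (etrans (bopZ_ell2E (a p) (mdelta p) xi s) _).
    refine (etrans (congr1 (fun u : R[i]^o => a p *: u) (mulopE xi s (c0_ind1 p))) _).
    exact: mulrCA.
  refine (etrans (bopB_ell2E (mulop a) (\sum_(p <- A) a p *: mdelta p) xi s) _).
  refine (etrans (congr2 (fun u v : R[i]^o => u - v) (mulopE xi s ca) h) _).
  by case: (s \in A); rewrite ?mul1r ?subrr ?mul0r ?subr0.
apply: (@le_trans _ _ (\sum_(s <- D) e ^+ 2 * nrm (xi s) ^+ 2)).
  apply: ler_sum => s _; rewrite coordE -exprMn.
  rewrite ler_sqr ?nnegrE ?mulr_ge0 ?nrm_ge0 ?(ltW e0)//.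
  have [sA|sA] := boolP (s \in A); first by rewrite mul0r nrm0 mulr_ge0 ?nrm_ge0// ltW.
  rewrite mul1r nrmM ler_wpM2r ?nrm_ge0// -lecR nrmE.
  move: sA; rewrite in_fset_set// notin_setE /= => /negP.
  have er : e%:C%C = (complex.Re e%:C%C)%:C%C :> R[i] by [].
  by rewrite -real_ltNge ?complex_real ?eqxx ?normr_real// => /ltW.
by rewrite -mulr_sumr exprMn ler_wpM2l ?sqr_ge0 ?ell2_sum_le.
Qed.

Lemma mdelta_lam (p t : G) : mdelta p \oB lam t = unitop p (t^-1 * p)%g :> B.
Proof.
rewrite unitop_mulop; congr (_ \oB lam _); apply: (mulIg (t^-1 * p)%g).
by rewrite mulgVK mulVKg.
Qed.

Lemma approximable_unitop (p q : G) : approximable (unitop p q : B).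
Proof.
move=> e e0; exists [fset p; q]%fset => D /fsubsetP pqD.
have pD : p \in D by apply: pqD; rewrite !inE eqxx.
have qD : q \in D by apply: pqD; rewrite !inE eqxx orbT.
have -> : cproj D \oB unitop p q \oB cproj D = unitop p q :> B.
  apply: bop_eq => xi; apply: ell2_eq => s.
  refine (etrans (projE D (unitop p q (cproj D xi)) s) _).
  rewrite (unitopE p q (cproj D xi) s) (projE D xi q) (unitopE p q xi s) qD mul1r.
  by case: eqP => [->|_]; rewrite ?pD ?mul1r// !mul0r mulr0.
by rewrite subrr nrm0 ltW.
Qed.

Lemma approximable0 : approximable (0 : B).
Proof.
move=> e e0; exists fset0 => D _.
have -> : cproj D \oB 0 \oB cproj D = 0 :> B.
  by apply: bop_eq => x; exact: (linear0 (cproj D)).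
by rewrite subr0 nrm0 ltW.
Qed.

Lemma approximable_sum (J : Type) (r : seq J) (c : J -> R[i]) (x : J -> B) :
  (forall j, approximable (x j)) -> approximable (\sum_(j <- r) c j *: x j).
Proof.
move=> hx; elim: r => [|j r IH]; first by rewrite big_nil; exact: approximable0.
by rewrite big_cons; apply: approximable_ZD; [exact: hx|exact: IH].
Qed.

Lemma approximable_mulop (x : B) (t : G) : C0 x -> approximable (x \oB lam t).
Proof.
move=> [a ca <-]; apply: approximable_closed => e e0.
have [A hA] := mulop_fin_approx ca e0.
exists (\sum_(p <- A) a p *: unitop p (t^-1 * p)%g).
  by apply: approximable_sum => p; exact: approximable_unitop.
have -> : \sum_(p <- A) a p *: unitop p (t^-1 * p)%g = (\sum_(p <- A) a p *: mdelta p) \oB lam t.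
  by rewrite comp_suml; apply: eq_bigr => p _; rewrite compZl mdelta_lam.
rewrite -compBl; apply: (le_trans (nrm_comp _ _)); rewrite nrmBC; apply: (le_trans _ hA).
by rewrite ler_piMr ?nrm_ge0 ?nrm_lambda.
Qed.

(** On the l1 part the compression is a norm limit of finite combinations of matrix units, and
    approximability passes to the closure. *)
Lemma approximable_cmp (x : bop H H) : X x -> approximable (cmp x).
Proof.
move=> /closure_nrmP Xx; apply: approximable_closed => e e0.
have [d [f fl fd] dx] := Xx e e0; exists (cmp d); last first.
  by rewrite -cmp_sub; exact: le_trans (nrm_cmp _) dx.
have [z [hz pz]] := l1_hsum fl; rewrite -fd pz cmp_twist.
apply: approximable_closed => e' e'0; have [A hA] := hz e' e'0.
exists (\sum_(t <- A) f t \oB lam t); last exact: hA (fsubset_refl A).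
rewrite (eq_bigr (fun t => 1 *: (f t \oB lam t))) => [|t _]; last by rewrite scale1r.
by apply: approximable_sum => t; apply: approximable_mulop; exact: fl.1.
Qed.

Variable F : G -> B -> B.
Hypothesis F_CB : forall s : G, completely_bounded C0 C0 (F s).
Variable S : bop H H -> bop H H.
Hypothesis S_ext : extends_SF C0 act F S.
Hypothesis S_cc : completely_compact X X S.

(* S transported from the crossed product to B(ell2 G). *)
Definition Phi (x : B) : B := cmp (S (twist R G x)).

(** Linearity and bounds of S are available only on the crossed product, so [Phi] is used on
    operators whose twist lies in the l1 part. *)
Definition matrixlike (x : B) := XD (twist R G x).

Lemma matrixlike_X x : matrixlike x -> X (twist R G x).
Proof. by move=> ?; exact: subset_closure. Qed.

Lemma matrixlike_ZD (c : R[i]) x y : matrixlike x -> matrixlike y -> matrixlike (c *: x + y).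
Proof. by rewrite /matrixlike (bop_lin (twist R G)) => hx hy; exact: XD_lin. Qed.

Lemma matrixlike0 : matrixlike 0.
Proof. by rewrite /matrixlike linear0; exact: XD_0. Qed.

Lemma matrixlike_sum (J : Type) (r : seq J) (c : J -> R[i]) (x : J -> B) :
  (forall j, matrixlike (x j)) -> matrixlike (\sum_(j <- r) c j *: x j).
Proof.
move=> hx; elim: r => [|j r IH]; first by rewrite big_nil; exact: matrixlike0.
by rewrite big_cons; apply: matrixlike_ZD; [exact: hx|exact: IH].
Qed.

Lemma matrixlike_unitop p q : matrixlike (unitop p q).
Proof. exact: twist_unitop_XD. Qed.

Lemma Phi_ZD (c : R[i]) x y : matrixlike x -> matrixlike y ->
  Phi (c *: x + y) = c *: Phi x + Phi y.
Proof.
move=> hx hy; have [[_ Sl _] _] := S_cc.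
rewrite /Phi (bop_lin (twist R G)).
by rewrite (Sl _ _ _ (matrixlike_X hx) (matrixlike_X hy)) cmp_linear.
Qed.

Lemma Phi0 : Phi 0 = 0.
Proof.
have := Phi_ZD 1 matrixlike0 matrixlike0; rewrite scaler0 addr0 scale1r.
by move=> /eqP; rewrite -subr_eq0 opprD addrA subrr sub0r oppr_eq0 => /eqP.
Qed.

Lemma Phi_sum (J : Type) (r : seq J) (c : J -> R[i]) (x : J -> B) :
  (forall j, matrixlike (x j)) ->
  Phi (\sum_(j <- r) c j *: x j) = \sum_(j <- r) c j *: Phi (x j).
Proof.
move=> hx; elim: r => [|j r IH]; first by rewrite !big_nil Phi0.
by rewrite !big_cons Phi_ZD ?IH//; exact: matrixlike_sum.
Qed.

Lemma Phi_mxnorm : exists2 M : R, 0 <= M & forall m (x : 'M[B]_m),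
  (forall i j, matrixlike (x i j)) -> mxnorm (map_mx Phi x) <= M * mxnorm x.
Proof.
have [[_ _ [M hM]] _] := S_cc; exists `|M| => // m x hx.
have -> : map_mx Phi x = map_mx (@cmp R G) (map_mx S (map_mx (twist R G) x)).
  by apply/matrixP => i j; rewrite mxE [RHS]mxE mxE mxE.
apply: (le_trans (mxnorm_cmp _)).
have h : mx_over X (map_mx (twist R G) x).
  by move=> i j; rewrite mxE; exact: matrixlike_X.
apply: (le_trans (hM m _ h)).
apply: (@le_trans _ _ (`|M| * mxnorm (map_mx (twist R G) x))).
  by rewrite ler_wpM2r ?mxnorm_ge0 ?ler_norm.
apply: ler_wpM2l; [exact: normr_ge0|exact: mxnorm_twist].
Qed.

Lemma F0 t : F t 0 = 0.
Proof.
have [_ Fl _] := F_CB t; have := Fl 1 0 0 (C0_0 R G) (C0_0 R G).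
rewrite scaler0 addr0 scale1r => /eqP.
by rewrite -subr_eq0 opprD addrA subrr sub0r oppr_eq0 => /eqP.
Qed.

(** The twisted matrix unit is pi_tilde of a function supported at p q^-1, where S acts through
    F. *)
Lemma Phi_unitop p q :
  Phi (unitop p q) = F (p * q^-1)%g (mdelta p) \oB lam (p * q^-1)%g.
Proof.
have Cp := C0_mdelta p; have [FC _ _] := F_CB (p * q^-1)%g.
rewrite /Phi unitop_mulop -(pi_tilde_single _ Cp).
have e := S_ext (single_l1 (p * q^-1)%g Cp).
have -> : S (pi_tilde act (single (p * q^-1)%g (mdelta p))) =
    pi_tilde act (single (p * q^-1)%g (F (p * q^-1)%g (mdelta p))).
  rewrite e; congr pi_tilde; apply/funext => s; rewrite /pmul /single.
  by case: eqP => [->//|_]; exact: F0.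
by rewrite (pi_tilde_single _ (FC _ Cp)) cmp_twist.
Qed.

(** F maps into multiplication operators, so Phi(e_{p,q}) is such an operator times lambda_{p q^-1}
    and lives on the diagonal s t^-1 = p q^-1. *)
Lemma Phi_band p q s t : q != (t * s^-1 * p)%g -> mxcoef (Phi (unitop p q)) s t = 0.
Proof.
move=> hq; rewrite Phi_unitop; have [FC _ _] := F_CB (p * q^-1)%g.
have [b cb <-] := FC _ (C0_mdelta p).
refine (etrans (mulopE (lam (p * q^-1)%g (delta R t)) s cb) _).
refine (etrans (congr1 (fun u => b s * u) (lambdaE _ (delta R t) s)) _).
rewrite deltaE; case: eqP => [h|_]; last exact: mulr0.
by move: hq; rewrite -h invgF mulgK mulgVK eqxx.
Qed.

(** Because [Y] lies in the crossed product its compressed generators are approximable, and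
    [span_uniform_trunc] truncates a nearby matrix over their span uniformly in m. Scaling extends
    the bound from the unit ball. *)
Lemma Phi_range_trunc (e : R) : 0 < e -> exists A : {fset G}, forall D, (A `<=` D)%fset ->
  forall m (x : 'M[B]_m), (forall i j, matrixlike (x i j)) ->
    mxnorm (comp_mx D (map_mx Phi x)) <= e * mxnorm x.
Proof.
move=> e0; have [M M0 hM] := Phi_mxnorm; have [_ hcc] := S_cc.
have e4 : 0 < e / 4 by rewrite divr_gt0.
have [Y [[k [y YE]] YX hY]] := hcc _ e4.
pose l := [seq cmp (y i) | i <- enum 'I_k].
have sl : size l = k by rewrite size_map size_enum_ord.
have yX i : X (y i).
  apply: YX; rewrite YE; exists (fun j => (j == i)%:R) => //.
  rewrite (bigD1 i)//= eqxx scale1r big1 ?addr0// => j /negbTE ->.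
  exact: scale0r.
have la b : List.In b l -> approximable b.
  by move=> /List.in_map_iff[i [<- _]]; apply: approximable_cmp.
(* A matrix within e / 4 of the image of the unit ball has norm at most M + e / 4, which fixes the
   relative accuracy of its truncation. *)
have d0 : 0 < e / 2 / (M + e / 4) by rewrite !divr_gt0// ltr_wpDl.
have [A hA] := span_uniform_trunc la d0.
exists A => D AD.
have unit_ball m (x : 'M[B]_m) : (forall i j, matrixlike (x i j)) -> mxnorm x <= 1 ->
    mxnorm (comp_mx D (map_mx Phi x)) <= e.
  move=> hx x1.
  have tX : mx_over X (map_mx (twist R G) x).
    by move=> i j; rewrite mxE; exact: matrixlike_X.
  have ne : [set mxnorm (map_mx S (map_mx (twist R G) x) - v) | v in mx_over Y (m := m)] !=set0.
    exists (mxnorm (map_mx S (map_mx (twist R G) x) - const_mx 0)), (const_mx 0) => // i j.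
    rewrite mxE YE; exists (fun=> 0) => //.
    by rewrite big1// => u _; rewrite scale0r.
  have [_ [w Yw <-] hw] := inf_lt ne (hY m _ tX (le_trans (mxnorm_twist x) x1)).
  pose w' := map_mx (@cmp R G) w.
  have sub : map_mx Phi x - w' = map_mx (@cmp R G) (map_mx S (map_mx (twist R G) x) - w).
    apply/matrixP => i j; rewrite [RHS]mxE.
    have -> : (map_mx S (map_mx (twist R G) x) - w) i j = S (twist R G (x i j)) - w i j.
      by rewrite mxE !mxE.
    by rewrite cmp_sub !mxE.
  have h1 : mxnorm (map_mx Phi x - w') <= e / 4.
    by rewrite sub; apply: (le_trans (mxnorm_cmp _)); exact: ltW.
  have hw' i j : in_span l (w' i j).
    rewrite mxE; have := Yw i j; rewrite YE => -[c _ <-].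
    exists (fun u => if insub u is Some v then c v else 0); rewrite sl.
    have cs : forall (J : Type) (r : seq J) (d : J -> R[i]) (z : J -> bop H H),
        cmp (\sum_(j <- r) d j *: z j) = \sum_(j <- r) d j *: cmp (z j).
      move=> J r d z; elim: r => [|a r IH]; last by rewrite !big_cons cmp_linear IH.
      by rewrite !big_nil -[X in cmp X](subrr 0) cmp_sub subrr.
    rewrite cs; apply: eq_bigr => u _; rewrite valK; congr (_ *: _).
    by rewrite (nth_map u) ?size_enum_ord// nth_ord_enum.
  have w'n : mxnorm w' <= M + e / 4.
    have -> : w' = map_mx Phi x - (map_mx Phi x - w') by rewrite opprB addrC subrK.
    apply: (le_trans (mxnormB _ _)); apply: lerD => //.
    apply: (le_trans (hM m x hx)); rewrite -[leRHS]mulr1; exact: ler_wpM2l.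
  have h2 : mxnorm (comp_mx D w') <= e / 2.
    apply: (le_trans (hA D AD m w' hw')).
    apply: (@le_trans _ _ (e / 2 / (M + e / 4) * (M + e / 4))).
      by apply: ler_wpM2l w'n; exact: ltW.
    by rewrite divfK// gt_eqF// ltr_wpDl.
  pose v := map_mx Phi x - w'.
  pose v' := map_mx (fun z => z \oB cproj D) (map_mx (bop_comp (cproj D)) v).
  have v'n : mxnorm v' <= e / 4.
    apply: (le_trans (mxnorm_comp_r _ _)).
    apply: (@le_trans _ _ (mxnorm (map_mx (bop_comp (cproj D)) v))).
      by rewrite ler_piMr ?mxnorm_ge0 ?nrm_proj.
    apply: (le_trans (mxnorm_comp_l _ _)); apply: (le_trans _ h1).
    by rewrite ler_piMl ?mxnorm_ge0 ?nrm_proj.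
  have -> : comp_mx D (map_mx Phi x) = v + comp_mx D w' - v'.
    apply/matrixP => i j; rewrite mx_addsubE.
    have -> : v i j = Phi (x i j) - w' i j by rewrite mxE [X in X + _]mxE mxE.
    have -> : v' i j = cproj D \oB (Phi (x i j) - w' i j) \oB cproj D.
      by rewrite mxE mxE; congr (_ \oB _ \oB _); rewrite mxE [X in X + _]mxE mxE.
    rewrite mxE [map_mx Phi x i j]mxE [comp_mx D w' i j]mxE compBr compBl opprB.
    exact: sub_telescope3.
  have -> : e = e / 4 + e / 2 + e / 4 by field.
  apply: (le_trans (mxnormB _ _)); apply: (lerD _ v'n).
  exact: (le_trans (mxnormD _ _) (lerD h1 h2)).
move=> m x hx; apply/ler_addgt0Pr => d d'0.
(* Positive even for x = 0, so that x / N is defined; the excess costs exactly the slack d. *)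
pose N := mxnorm x + d / e.
have N0 : 0 < N by rewrite ltr_wpDl ?mxnorm_ge0// divr_gt0.
pose a : R[i] := (N^-1)%:C%C.
pose x1 : 'M[B]_m := \matrix_(i, j) (a *: x i j).
have na : Normc.normc a = N^-1 by rewrite -nrm_normc nrm_real ger0_norm// invr_ge0 ltW.
have x1n : mxnorm x1 <= 1.
  apply: (le_trans (mxnormZ (a := a) (x := x) _)) => [i j|]; first by rewrite mxE.
  by rewrite na ler_pdivrMl// mulr1 lerDl ltW// divr_gt0.
have hx1 i j : matrixlike (x1 i j).
  by rewrite mxE -[_ *: _]addr0; apply: matrixlike_ZD; [exact: hx|exact: matrixlike0].
have := unit_ball m x1 hx1 x1n => h.
have -> : e * mxnorm x + d = N * e by rewrite /N mulrDl divfK ?gt_eqF// mulrC.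
apply: (@le_trans _ _ (N * mxnorm (comp_mx D (map_mx Phi x1)))); last by rewrite ler_pM2l.
have nN : Normc.normc (N%:C%C : R[i]) = N by rewrite -nrm_normc nrm_real ger0_norm// ltW.
rewrite -[X in X * _]nN; apply: mxnormZ => i j.
have Pz : Phi (x1 i j) = a *: Phi (x i j).
  by rewrite mxE -[a *: x i j]addr0 Phi_ZD ?Phi0 ?addr0//; exact: matrixlike0.
rewrite mxE mxE [RHS](congr1 (fun z => N%:C%C *: z) (mxE _ _ i j)) [map_mx Phi x1 i j]mxE Pz.
rewrite compZr compZl -scalerBr scalerA /a -rmorphM /= mulfV ?gt_eqF//.
by rewrite scale1r.
Qed.

End MultiplierOnMatrixUnits.

Lemma sum_fset_nat (V : nmodType) (I : choiceType) (A D : {fset I}) (f : I -> V) :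
  (A `<=` D)%fset -> (forall i, i \notin A -> f i = 0) ->
  \sum_(i <- A) f i = \sum_(i <- D) f i.
Proof. by move=> AD f0; apply: big_fset_incl => // i _; exact: f0. Qed.

(** * Truncation of the domain *)

Section DomainTruncation.
Variables (R : realType) (G : groupType).
Notation ell := (ell2 G R[i]^o).
Notation H := (ell2 G ell).
Notation B := (B_ell2 R G).
Notation C0 := (c0_mulops R G).
Notation act := (c0_act R G).
Notation X := (crossed_product C0 act).

Lemma nrm_unitop (p q : G) : nrm (unitop p q : B) <= 1.
Proof.
apply/opnorm_leP => // xi; rewrite mul1r; apply/ell2_nrm_leP => [|D]; first exact: nrm_ge0.
have [pD|pD] := boolP (p \in D).
  rewrite (bigD1_seq p pD (fset_uniq D)) /= unitopE eqxx mul1r big1 => [|s /negbTE sp].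
    by rewrite addr0 ler_sqr ?nnegrE ?nrm_ge0// ell2_coord_le.
  by rewrite unitopE sp mul0r nrm0 expr0n.
rewrite big1_fset ?sqr_ge0// => s sD _; rewrite unitopE; case: eqP => [sp|_].
  by rewrite sp (negbTE pD) in sD.
by rewrite mul0r nrm0 expr0n.
Qed.

Lemma diag_coord (A : {fset G}) (u : G -> R[i]) (g : G -> G) (xi : ell) s :
  (\sum_(p <- A) u p *: unitop p (g p)) xi s = (s \in A)%:R * (u s * xi (g s)).
Proof.
rewrite bop_sumE ell2_sumE -(sum_fset_pick A s (fun p => u p * xi (g p))).
apply: eq_bigr => p _; refine (etrans (bopZ_ell2E (u p) (unitop p (g p)) xi s) _).
refine (etrans (congr1 (fun v : R[i]^o => u p *: v) (unitopE p (g p) xi s)) _).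
exact: mulrCA.
Qed.

(** For injective g this is a weighted partial permutation of the coordinates. *)
Lemma nrm_diag (A : {fset G}) (u : G -> R[i]) (g : G -> G) : injective g ->
  (forall p, nrm (u p : R[i]^o) <= 1) -> nrm (\sum_(p <- A) u p *: unitop p (g p) : B) <= 1.
Proof.
move=> gi u1; apply/opnorm_leP => // xi; rewrite mul1r.
apply/ell2_nrm_leP => [|D]; first exact: nrm_ge0.
apply: (le_trans _ (ell2_sum_le xi [fset g s | s in D]%fset)).
rewrite big_imfset /=; last by move=> a b _ _; exact: gi.
apply: ler_sum => s _; rewrite diag_coord ler_sqr ?nnegrE ?nrm_ge0//.
case: (s \in A); last by rewrite mul0r nrm0 nrm_ge0.
by rewrite mul1r nrmM ler_piMl ?nrm_ge0.
Qed.

(** Finite matrices, on which Phi is determined by its values on matrix units. *)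
Definition supported_on (U : {fset G}) (z : B) :=
  z = \sum_(p <- U) \sum_(q <- U) mxcoef z p q *: unitop p q.

Lemma mxcoef_sum0 (J : Type) (r : seq J) (x : J -> B) s t :
  mxcoef (\sum_(j <- r) x j) s t = \sum_(j <- r) mxcoef (x j) s t.
Proof.
elim: r => [|j r IH]; first by rewrite !big_nil.
have := mxcoefZD 1 (x j) (\sum_(j <- r) x j) s t; rewrite scale1r mul1r IH.
by rewrite !big_cons.
Qed.

Lemma mxcoef_block (U : {fset G}) (k : G -> G -> R[i]) s t :
  mxcoef (\sum_(p <- U) \sum_(q <- U) k p q *: unitop p q : B) s t =
  (s \in U)%:R * ((t \in U)%:R * k s t).
Proof.
rewrite mxcoef_sum0 -(sum_fset_pick U s (fun p => (t \in U)%:R * k p t)).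
apply: eq_bigr => p _; rewrite mxcoef_sum -(sum_fset_pick U t (fun q => k p q)) mulr_sumr.
by apply: eq_bigr => q _; rewrite mxcoef_unitop (eq_sym q); ring.
Qed.

Lemma supported_off (U : {fset G}) z s t : supported_on U z ->
  (s \notin U) || (t \notin U) -> mxcoef z s t = 0.
Proof.
by move=> zU h; rewrite zU mxcoef_block; case/orP: h => /negbTE ->; rewrite ?mul0r ?mulr0.
Qed.

Variable F : G -> B -> B.
Hypothesis F_CB : forall s : G, completely_bounded C0 C0 (F s).
Variable S : bop H H -> bop H H.
Hypothesis S_ext : extends_SF C0 act F S.
Hypothesis S_cc : completely_compact X X S.
Notation Phi := (Phi S).

Definition theta (s p t q : G) : R[i] := mxcoef (Phi (unitop p q)) s t.

(* The only q for which theta s p t q can be nonzero. *)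
Definition partner (s t p : G) : G := (t * s^-1 * p)%g.

Lemma supported_matrixlike U z : supported_on U z -> matrixlike z.
Proof.
move=> ->; rewrite (eq_bigr (fun p => 1 *: \sum_(q <- U) mxcoef z p q *: unitop p q)).
  by apply: matrixlike_sum => p; apply: matrixlike_sum => q; exact: matrixlike_unitop.
by move=> p _; rewrite scale1r.
Qed.

Lemma Phi_coef U z s t : supported_on U z ->
  mxcoef (Phi z) s t =
  \sum_(p <- U) theta s p t (partner s t p) * mxcoef z p (partner s t p).
Proof.
move=> zU; rewrite [in LHS]zU.
rewrite (eq_bigr (fun p => 1 *: \sum_(q <- U) mxcoef z p q *: unitop p q)); last first.
  by move=> p _; rewrite scale1r.
rewrite (Phi_sum S_cc); last first.
  by move=> p; apply: matrixlike_sum => q; exact: matrixlike_unitop.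
rewrite mxcoef_sum; apply: eq_bigr => p _; rewrite mul1r (Phi_sum S_cc); last first.
  by move=> q; exact: matrixlike_unitop.
rewrite mxcoef_sum.
have off q : q != partner s t p -> mxcoef z p q * mxcoef (Phi (unitop p q)) s t = 0.
  by move=> qn; rewrite (Phi_band F_CB S_ext qn) mulr0.
have [gU|gU] := boolP (partner s t p \in U).
  rewrite (bigD1_seq _ gU (fset_uniq U)) /= big1 ?addr0 => [|q]; last exact: off.
  exact: mulrC.
rewrite big1_fset => [|q qU _].
  by rewrite (supported_off zU) ?mulr0// gU orbT.
by apply: off; apply: contraNneq gU => <-.
Qed.

(** With u_p the conjugate phase of the coefficient, sum u_p e_{p,q(p)} along the partner diagonal
    is a contraction, and the (s, t) entry of its image under Phi is the sum of the absolute
    values. *)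
Lemma theta_l1 : exists M : R, forall s t (A : {fset G}),
  \sum_(p <- A) nrm (theta s p t (partner s t p) : R[i]^o) <= M.
Proof.
have [M M0 hM] := Phi_mxnorm S_cc; exists M => s t A.
pose th p := theta s p t (partner s t p).
pose u p : R[i] := if th p == 0 then 0 else (th p)^* * ((nrm (th p : R[i]^o))^-1)%:C%C.
have u1 p : nrm (u p : R[i]^o) <= 1.
  rewrite /u; case: eqP => [_|/eqP h]; first by rewrite nrm0.
  have n0 : nrm (th p : R[i]^o) != 0.
    by apply: contra_neq h => h0; apply: (@nrm0_eq0 _ R[i]^o).
  by rewrite nrmM nrm_conj nrm_real ger0_norm ?invr_ge0 ?nrm_ge0// divff.
have uth p : u p * th p = (nrm (th p : R[i]^o))%:C%C.
  rewrite /u; case: eqP => [->|/eqP h]; first by rewrite mul0r nrm0.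
  have n0 : nrm (th p : R[i]^o) != 0.
    by apply: contra_neq h => h0; apply: (@nrm0_eq0 _ R[i]^o).
  rewrite mulrAC sq_conj -rmorphM /=; congr (_%:C)%C.
  by rewrite expr2 mulfK.
have gi : injective (partner s t) by move=> a b /mulgI.
pose x : B := \sum_(p <- A) u p *: unitop p (partner s t p).
have hx : matrixlike x by apply: matrixlike_sum => p; exact: matrixlike_unitop.
have cE : mxcoef (Phi x) s t = (\sum_(p <- A) nrm (th p : R[i]^o))%:C%C.
  rewrite (Phi_sum S_cc) => [|p]; last exact: matrixlike_unitop.
  by rewrite mxcoef_sum rmorph_sum; apply: eq_bigr => p _; exact: uth.
have h := mxcoef_le (Phi x) s t; rewrite cE -nrm_normc nrm_real ger0_norm in h; last first.
  by apply: sumr_ge0 => p _; exact: nrm_ge0.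
apply: (le_trans h).
have hcb : cb_bound (@matrixlike R G) Phi M by move=> m y hy; exact: hM.
apply: (le_trans (cb_bound_nrm M0 hcb hx)).
by rewrite -[leRHS]mulr1; apply: ler_wpM2l => //; exact: nrm_diag.
Qed.

Definition Dcoef (T' : {fset G}) (z : B) (s t : G) : R[i] :=
  \sum_(p <- T') theta s p t (partner s t p) * mxcoef z p (partner s t p).

(** Plays the role of P_T Phi(P_T' z) P_T: the column q is determined by s, t and p, so restricting
    the row index p is enough to truncate the domain. *)
Definition Dop (T T' : {fset G}) (z : B) : B :=
  \sum_(s <- T) \sum_(t <- T) Dcoef T' z s t *: unitop s t.

Lemma Dop0 T' z : Dop fset0 T' z = 0.
Proof. by rewrite /Dop big_nil. Qed.

(** [T] comes from the range; [T'] captures almost all of the l1 mass of each of the finitely many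
    coefficients indexed by T x T. A discarded term is a matrix coefficient times a matrix unit, of
    completely bounded norm at most |theta|. The estimate does not depend on the support [U] of
    x. *)
Lemma Phi_trunc (e : R) : 0 < e -> exists T T' : {fset G}, forall m (x : 'M[B]_m) U,
  (forall i j, supported_on U (x i j)) ->
  mxnorm (map_mx (fun z => Phi z - Dop T T' z) x) <= e * mxnorm x.
Proof.
move=> e0; have e2 : 0 < e / 2 by rewrite divr_gt0.
have [T hT] := Phi_range_trunc S_cc e2; have {}hT := hT T (fsubset_refl T).
(* The number of pairs in T x T, plus 1 for positivity; the discarded mass is shared equally among
   them. *)
pose k : R := (\sum_(s <- T) \sum_(t <- T) 1) + 1.
have k0 : 0 < k.
  rewrite ltr_wpDl//; apply: sumr_ge0 => s _; exact: sumr_ge0.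
have d0 : 0 < e / 2 / k by rewrite divr_gt0.
have [M hM] := theta_l1.
have /choice[f hf] : forall st : G * G, exists A : {fset G}, forall D,
    [disjoint D & A]%fset ->
    \sum_(p <- D) nrm (theta st.1 p st.2 (partner st.1 st.2 p) : R[i]^o) <= e / 2 / k.
  move=> [s t]; apply: bounded_sum_tail d0 => [p|]; first exact: nrm_ge0.
  exact: hM.
pose T' := (\bigcup_(s <- T) \bigcup_(t <- T) f (s, t))%fset.
exists T, T' => m x U hx.
pose V := ((U `|` T') `\` T')%fset.
have diffE z s t : supported_on U z -> mxcoef (Phi z) s t - Dcoef T' z s t =
    \sum_(p <- V) theta s p t (partner s t p) * mxcoef z p (partner s t p).
  move=> zU; rewrite (Phi_coef _ _ zU).
  rewrite (sum_fset_nat (D := (U `|` T')%fset)) ?fsubsetUl//; last first.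
    by move=> p pU; rewrite (supported_off zU) ?mulr0// pU.
  by rewrite (sum_fset_split _ (fsubsetUr U T')) addrAC subrr add0r.
pose y s t p : 'M[B]_m := \matrix_(i, j) (mxcoef (x i j) p (partner s t p) *: unitop s t).
pose y' s t p : 'M[B]_m := \matrix_(i, j) (theta s p t (partner s t p) *: y s t p i j).
have yE : map_mx (fun z => Phi z - Dop T T' z) x = comp_mx T (map_mx Phi x) +
    \sum_(s <- T) \sum_(t <- T) \sum_(p <- V) y' s t p.
  apply/matrixP => i j; rewrite [RHS]mxE summxE.
  have -> : comp_mx T (map_mx Phi x) i j = Phi (x i j) - cproj T \oB Phi (x i j) \oB cproj T.
    by rewrite mxE mxE.
  have -> : map_mx (fun z => Phi z - Dop T T' z) x i j = Phi (x i j) - Dop T T' (x i j).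
    by rewrite mxE.
  rewrite cproj_decomp.
  have -> : \sum_(s <- T) (\sum_(t <- T) \sum_(p <- V) y' s t p) i j =
      \sum_(p <- T) \sum_(q <- T) mxcoef (Phi (x i j)) p q *: unitop p q - Dop T T' (x i j).
    rewrite /Dop -sumrB; apply: eq_bigr => s _; rewrite summxE -sumrB.
    apply: eq_bigr => t _; rewrite summxE -scalerBl (diffE _ _ _ (hx i j)) scaler_suml.
    by apply: eq_bigr => p _; rewrite !mxE scalerA.
  by rewrite subrKA.
have ee : e * mxnorm x = e / 2 * mxnorm x + e / 2 * mxnorm x by field.
rewrite yE ee; apply: (le_trans (mxnormD _ _)); apply: lerD.
  by apply: hT => i j; exact: supported_matrixlike (hx i j).
have yn s t p : mxnorm (y' s t p) <= nrm (theta s p t (partner s t p) : R[i]^o) * mxnorm x.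
  apply: (le_trans (mxnormZ (a := theta s p t (partner s t p)) (x := y s t p) _)).
    by move=> i j; rewrite mxE.
  rewrite nrm_normc; apply: ler_wpM2l; first exact: normc_ge0.
  apply: (le_trans (scal_mxnorm _ _ _ _)).
  by rewrite ler_piMr ?mxnorm_ge0 ?nrm_unitop.
apply: (@le_trans _ _ (\sum_(s <- T) \sum_(t <- T) (e / 2 / k * mxnorm x))).
  apply: (le_trans (mxnorm_sum _ _ _)); rewrite big_seq [leRHS]big_seq.
  apply: ler_sum => s sT.
  apply: (le_trans (mxnorm_sum _ _ _)); rewrite big_seq [leRHS]big_seq.
  apply: ler_sum => t tT.
  apply: (le_trans (mxnorm_sum _ _ _)).
  apply: (@le_trans _ _ (\sum_(p <- V) nrm (theta s p t (partner s t p) : R[i]^o) * mxnorm x)).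
    by apply: ler_sum => p _; exact: yn.
  rewrite -mulr_suml; apply: ler_wpM2r; first exact: mxnorm_ge0.
  apply: (hf (s, t)); apply/fdisjointP => p; rewrite inE => /andP[pT' _].
  apply: contra pT' => pf; apply/bigfcupP; exists s; first by rewrite sT.
  by apply/bigfcupP; exists t; rewrite ?tT.
have -> : \sum_(s <- T) \sum_(t <- T) (e / 2 / k * mxnorm x) =
    (\sum_(s <- T) \sum_(t <- T) 1) * (e / 2 / k * mxnorm x).
  rewrite mulr_suml; apply: eq_bigr => s _; rewrite mulr_suml.
  by apply: eq_bigr => t _; rewrite mul1r.
apply: (@le_trans _ _ (k * (e / 2 / k * mxnorm x))).
  apply: ler_wpM2r; first by rewrite mulr_ge0 ?mxnorm_ge0// ltW.
  by rewrite lerDl.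
by rewrite mulrA [k * _]mulrC divfK ?gt_eqF.
Qed.

End DomainTruncation.

(** * Compactness of finite matrices *)

Section FiniteRankCompact.
Variables (R : realType) (G : groupType).
Notation ell := (ell2 G R[i]^o).
Notation B := (B_ell2 R G).

Lemma compact_op_sub (T : B) (K : set ell) : compact K ->
  (forall xi, nrm xi <= 1 -> K (T xi)) -> compact_op R G T.
Proof.
move=> cK TK; apply: (precompact_subset (B := K)); first by move=> _ [xi /= x1 <-]; exact: TK.
by apply: compact_precompact => //; exact: norm_hausdorff.
Qed.

(** The unit ball is mapped into a disc in the line of delta_p, which lies in the continuous image
    of a compact real square. *)
Lemma compact_op_unitop (c : R[i]) (p q : G) : compact_op R G (c *: unitop p q).
Proof.
pose g (z : R * R) : ell := (z.1 +i* z.2)%C *: delta R p.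
pose M := nrm (c : R[i]^o).
pose K : set (R * R) := `[- M, M]%classic `*` `[- M, M]%classic.
have cK : compact K by apply: compact_setX; exact: segment_compact.
have cg : continuous g.
  move=> [x y]; apply/cvgrPdist_le => e e0.
  have er : e = (complex.Re e)%:C%C by rewrite RRe_real// gtr0_real.
  have e0' : 0 < complex.Re e / 2 by rewrite divr_gt0// -ltcR -er.
  exists ([set u | `|x - u| <= complex.Re e / 2], [set u | `|y - u| <= complex.Re e / 2]).
    split=> /=.
      by have /cvgrPdist_le/(_ _ e0') := @cvg_id _ (nbhs x).
    by have /cvgrPdist_le/(_ _ e0') := @cvg_id _ (nbhs y).
  move=> [u v] /= [xu yv]; rewrite -nrmE er lecR /g -scalerBl /=.
  rewrite nrmZ nrm_delta mulr1 (le_trans (normc_le_ReIm _))//= (splitr (complex.Re e)).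
  exact: lerD.
have cgK : compact (g @` K).
  by apply: continuous_compact => //; exact: continuous_subspaceT.
apply: (compact_op_sub cgK) => xi x1.
have vE : (c *: unitop p q : B) xi = (c * xi q) *: delta R p.
  apply: ell2_eq => s; refine (etrans (bopZ_ell2E c (unitop p q) xi s) _).
  refine (etrans (congr1 (fun v : R[i]^o => c *: v) (unitopE p q xi s)) _).
  by rewrite ell2ZE deltaE; exact: (etrans (mulrCA _ _ _) (mulrC _ _)).
have zM : nrm (c * xi q : R[i]^o) <= M.
  by rewrite nrmM ler_piMr ?nrm_ge0// (le_trans (ell2_coord_le _ _)).
rewrite vE; exists (complex.Re (c * xi q), complex.Im (c * xi q)); last first.
  by rewrite /g /=; congr (_ *: _); case: (c * xi q).
split; rewrite /= in_itv /= -ler_norml; apply: (le_trans _ zM).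
  by rewrite -lecR nrmE; exact: normc_ge_Re.
exact: normc_ge_Im.
Qed.

Lemma compact_opD (S T : B) : compact_op R G S -> compact_op R G T -> compact_op R G (S + T).
Proof.
rewrite /compact_op /= !precompactE => cS cT; rewrite -precompactE.
have c2 := compact_setX cS cT.
have cadd : continuous (fun z : ell * ell => z.1 + z.2).
  by move=> z; apply: cvgD; [exact: cvg_fst|exact: cvg_snd].
have := continuous_compact (continuous_subspaceT cadd) c2.
move=> cK; refine (compact_op_sub (T := S + T) cK _) => xi x1.
by exists (S xi, T xi) => //; split; apply: subset_closure; exists xi.
Qed.

Lemma compact_op_sum (J : Type) (r : seq J) (x : J -> B) :
  (forall j, compact_op R G (x j)) -> compact_op R G (\sum_(j <- r) x j).
Proof.
move=> hx; elim: r => [|j r IH]; last by rewrite big_cons; apply: compact_opD; [exact: hx|exact: IH].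
have := compact_op_unitop 0 1 1; rewrite scale0r big_nil; exact.
Qed.

End FiniteRankCompact.

(** * Factorization of maps supported on a finite block *)

Section FactorList.
Variables (R : realType) (G : groupType) (U : {fset G}).
Notation C := R[i].
Notation ell := (ell2 G R[i]^o).
Notation B := (B_ell2 R G).
Notation n := (size (enum_fset U)).
Notation I := 'I_n.
Notation sq z := (nrm (z : C^o) ^+ 2).
Implicit Types (k : I -> I -> C) (xi eta : ell).

Definition ent (i : I) : G := nth 1%g (enum_fset U) i.

Lemma ent_in i : ent i \in U. Proof. exact: mem_nth. Qed.

Lemma ent_eq i j : (ent i == ent j) = (i == j).
Proof. by rewrite /ent nth_uniq// fset_uniq. Qed.

Lemma ent_ex s : s \in U -> exists i, s = ent i.
Proof.
move=> sU; have h : (index s (enum_fset U) < n)%N by rewrite index_mem.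
by exists (Ordinal h); rewrite /ent /= nth_index.
Qed.

Lemma sum_ent (V : nmodType) (f : G -> V) : \sum_(p <- U) f p = \sum_(i : I) f (ent i).
Proof. by rewrite (big_nth 1%g) big_mkord. Qed.

Definition evec (v : I -> C) : ell := \sum_p v p *: delta R (ent p).

Lemma evecE v i : evec v (ent i) = v i.
Proof.
rewrite ell2_sumE -[RHS](sum_pick v i); apply: eq_bigr => j _.
by rewrite (ell2ZE (v j) (delta R (ent j))) deltaE ent_eq; exact: mulrC.
Qed.

Lemma evec_off v s : s \notin U -> evec v s = 0.
Proof.
move=> sU; rewrite ell2_sumE big1// => j _.
rewrite (ell2ZE (v j) (delta R (ent j))) deltaE; case: eqP => [e|_]; last exact: mulr0.
by rewrite e ent_in in sU.
Qed.

Lemma nrm_evec v : nrm (evec v) ^+ 2 = \sum_i sq (v i).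
Proof.
rewrite (@ell2_nrm_fin _ _ _ (evec v) U); last exact: evec_off.
by rewrite (sum_ent (fun s => nrm (evec v s) ^+ 2)); apply: eq_bigr => i _; rewrite evecE.
Qed.

Lemma ent_sum_le xi : \sum_i sq (xi (ent i)) <= nrm xi ^+ 2.
Proof. by rewrite -(sum_ent (fun s => sq (xi s))) ell2_sum_le. Qed.

Lemma inner_evec v eta : inner (evec v) eta = \sum_i v i * (eta (ent i))^*.
Proof. by rewrite inner_suml; apply: eq_bigr => i _; rewrite innerZl delta_inner. Qed.

Definition emat k : B := \sum_p \sum_q k p q *: unitop (ent p) (ent q).

Lemma ematE k xi : emat k xi = evec (fun p => \sum_q k p q * xi (ent q)).
Proof.
apply: ell2_eq => s; rewrite bop_sumE ell2_sumE ell2_sumE; apply: eq_bigr => p _.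
rewrite bop_sumE ell2_sumE.
refine (etrans _ (esym (ell2ZE (\sum_q k p q * xi (ent q)) (delta R (ent p)) s))).
rewrite deltaE scaler_suml; apply: eq_bigr => q _.
refine (etrans (bopZ_ell2E (k p q) (unitop (ent p) (ent q)) xi s) _).
refine (etrans (congr1 (fun v : R[i]^o => k p q *: v) (unitopE (ent p) (ent q) xi s)) _).
exact: (etrans (mulrCA _ _ _) (mulrC _ _)).
Qed.

Lemma nrm_emat k xi : nrm (emat k xi) ^+ 2 = \sum_p sq (\sum_q k p q * xi (ent q)).
Proof. by rewrite ematE nrm_evec. Qed.

Lemma compact_emat k : compact_op R G (emat k).
Proof.
apply: compact_op_sum => p; apply: compact_op_sum => q; exact: compact_op_unitop.
Qed.

Lemma mxcoef_emat k a b : mxcoef (emat k) (ent a) (ent b) = k a b.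
Proof.
rewrite /mxcoef ematE evecE -[RHS](sum_pick (k a) b); apply: eq_bigr => q _.
by rewrite deltaE ent_eq eq_sym mulrC.
Qed.

Lemma mxcoef_emat_off k s t : (s \notin U) || (t \notin U) -> mxcoef (emat k) s t = 0.
Proof.
move=> h; rewrite /mxcoef ematE; have [sU|sU] := boolP (s \in U); last exact: evec_off.
have [i ->] := ent_ex sU; rewrite evecE big1// => q _; rewrite deltaE.
case: eqP => [e|_]; last by rewrite mulr0.
by move: h; rewrite sU -e ent_in.
Qed.

Lemma supported_emat k : supported_on U (emat k).
Proof.
rewrite /supported_on (sum_ent (fun p => \sum_(q <- U) mxcoef (emat k) p q *: unitop p q)).
apply: eq_bigr => p _; rewrite (sum_ent (fun q => mxcoef (emat k) (ent p) q *: unitop (ent p) q)).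
by apply: eq_bigr => q _; rewrite mxcoef_emat.
Qed.

Lemma adjoint_emat k : adjoint (emat k) = emat (fun p s => (k s p)^*).
Proof.
apply: adjoint_uniq => xi eta; rewrite !ematE inner_evec inner_conj inner_evec.
rewrite rmorph_sum /=.
transitivity (\sum_p \sum_s k s p * xi (ent p) * (eta (ent s))^*).
  by rewrite exchange_big; apply: eq_bigr => s _; rewrite mulr_suml.
apply: eq_bigr => p _; rewrite rmorphM /= conjCK rmorph_sum mulr_suml /=.
by apply: eq_bigr => s _; rewrite rmorphM /= conjCK; ring.
Qed.

Lemma mxcoef_sandwich (A D : B) p q s t :
  mxcoef (A \oB unitop p q \oB D) s t = mxcoef A s p * mxcoef D q t.
Proof.
rewrite /mxcoef; have e : unitop p q (D (delta R t)) = D (delta R t) q *: delta R p.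
  by apply: ell2_eq => u; rewrite (unitopE p q (D (delta R t)) u) ell2ZE deltaE; exact: mulrC.
have -> : (A \oB unitop p q \oB D) (delta R t) = A (unitop p q (D (delta R t))) by [].
by rewrite e (bop_scale A) ell2ZE; exact: mulrC.
Qed.

Lemma Ncol_conj (x : I -> I -> C) : Ncol (fun i p => (x i p)^*) = Ncol x.
Proof. by apply: eq_bigr => i _; apply: eq_bigr => p _; rewrite nrm_conj. Qed.

Lemma cauchy_schwarz2 (x u : I -> I -> C) :
  sq (\sum_i \sum_s x i s * u i s) <= Ncol x * Ncol u.
Proof.
rewrite /Ncol !pair_bigA /=.
exact: (cauchy_schwarz_complex _ (fun z => x z.1 z.2) (fun z => u z.1 z.2)).
Qed.

(** Taking for x the conjugate of v = W y, the form equals |v|^2; the hypothesis reads |v|^4 <= 4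
    |v|^2 |y|^2, and one factor cancels. *)
Lemma contraction_of_bform (W : I -> I -> I -> I -> C) :
  (forall x y, sq (bform W x y) <= 4 * (Ncol x * Ncol y)) ->
  mxnorm (\matrix_(i < n, j < n) emat (fun p q => W i p j q)) <= 2.
Proof.
move=> hW; apply: mxnorm_le => // xi.
pose y j q : C := xi j (ent q).
pose v i p : C := \sum_j \sum_q W i p j q * y j q.
have e i : \sum_j (\matrix_(i < n, j < n) emat (fun p q => W i p j q)) i j (xi j) = evec (v i).
  apply: ell2_eq => s; rewrite ell2_sumE.
  have [sU|sU] := boolP (s \in U); last first.
    by rewrite evec_off// big1// => j _; rewrite mxE ematE evec_off.
  have [a ->] := ent_ex sU; rewrite evecE; apply: eq_bigr => j _.
  by rewrite mxE ematE evecE.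
under eq_bigr do rewrite e nrm_evec.
rewrite -/(Ncol v); have yN : Ncol y <= \sum_j nrm (xi j) ^+ 2.
  by apply: ler_sum => j _; exact: ent_sum_le.
have bE : bform W (fun i p => (v i p)^*) y = (Ncol v)%:C%C.
  rewrite /Ncol rmorph_sum; apply: eq_bigr => i _; rewrite rmorph_sum /=.
  apply: eq_bigr => p _; rewrite -sq_conj [in RHS]/v mulr_sumr; apply: eq_bigr => j _.
  by rewrite mulr_sumr; apply: eq_bigr => q _; rewrite mulrCA.
have h := hW (fun i p => (v i p)^*) y.
rewrite bE nrm_real ger0_norm ?Ncol_ge0// Ncol_conj in h.
apply: (@le_trans _ _ (4 * Ncol y)).
  apply: sqr_cancel; rewrite ?Ncol_ge0 ?mulr_ge0 ?Ncol_ge0//.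
  by rewrite -mulrA (mulrC (Ncol y)).
by rewrite (_ : 2 ^+ 2 = 4) ?ler_pM2l//; ring.
Qed.

Variables (Psi : B -> B) (psi : G -> G -> G -> G -> C) (c : R).
Hypothesis c0 : 0 < c.
Hypothesis Psi_coef : forall z s t, mxcoef (Psi z) s t =
  (s \in U)%:R * ((t \in U)%:R * \sum_(p <- U) \sum_(q <- U) psi s p t q * mxcoef z p q).
Hypothesis Psi_cb : forall m (x : 'M[B]_m), (forall i j, supported_on U (x i j)) ->
  mxnorm (map_mx Psi x) <= c * mxnorm x.

Let th s p t q := psi (ent s) (ent p) (ent t) (ent q).

Lemma sum_swap22 (A : I -> I -> I -> I -> C) :
  \sum_p \sum_q \sum_i \sum_j A i p j q = \sum_i \sum_j \sum_p \sum_q A i p j q.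
Proof.
rewrite -(sum_swap4 A); apply: eq_bigr => i _; rewrite exchange_big.
by [].
Qed.

(** The link from operators to the hypothesis of [haagerup_fin]: the amplified Psi sends the block
    matrix of W, of norm at most 2, to norm at most 2 c, and [cb_value] pairs its value at y with
    x. *)
Lemma Psi_cb_value (W : I -> I -> I -> I -> C) :
  (forall x y, sq (bform W x y) <= 4 * (Ncol x * Ncol y)) ->
  forall x y, sq (cb_value W th x y) <= 4 * c ^+ 2 * (Ncol x * Ncol y).
Proof.
move=> hW x y.
pose X : 'M[B]_n := \matrix_(i < n, j < n) emat (fun p q => W i p j q).
have hX : mxnorm (map_mx Psi X) <= 2 * c.
  apply: (le_trans (Psi_cb _)) => [i j|]; first by rewrite mxE; exact: supported_emat.
  by rewrite mulrC ler_pM2r//; exact: contraction_of_bform.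
pose xi j := evec (y j).
pose u i s : C := (\sum_j (map_mx Psi X) i j (xi j)) (ent s).
have uE i s : u i s = \sum_j \sum_t y j t * \sum_p \sum_q th s p t q * W i p j q.
  rewrite /u ell2_sumE; apply: eq_bigr => j _; rewrite mxE mxE.
  rewrite linear_sum ell2_sumE; apply: eq_bigr => t _.
  refine (etrans (congr1 (fun v : ell => v (ent s)) (bop_scale (Psi _) (y j t) (delta R (ent t)))) _).
  rewrite (ell2ZE (y j t)); congr (y j t * _).
  rewrite -/(mxcoef _ _ _) Psi_coef !ent_in !mul1r.
  rewrite (sum_ent (fun p => \sum_(q <- U) psi (ent s) p (ent t) q * mxcoef _ p q)).
  apply: eq_bigr => p _.
  rewrite (sum_ent (fun q => psi (ent s) (ent p) (ent t) q * mxcoef _ (ent p) q)).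
  by apply: eq_bigr => q _; rewrite mxcoef_emat.
have cE : cb_value W th x y = \sum_i \sum_s x i s * u i s.
  transitivity (\sum_i \sum_s \sum_j \sum_t
      \sum_p \sum_q th s p t q * (W i p j q * (x i s * y j t))).
    rewrite (sum_swap4 (fun i s j t => \sum_p \sum_q th s p t q * (W i p j q * (x i s * y j t)))).
    apply: eq_bigr => s _; rewrite exchange_big; apply: eq_bigr => t _.
    rewrite -(sum_swap22 (fun i p j q => th s p t q * (W i p j q * (x i s * y j t)))).
    apply: eq_bigr => p _; apply: eq_bigr => q _; rewrite mulr_sumr; apply: eq_bigr => i _.
    by rewrite mulr_sumr.
  apply: eq_bigr => i _; apply: eq_bigr => s _; rewrite uE mulr_sumr; apply: eq_bigr => j _.
  rewrite mulr_sumr; apply: eq_bigr => t _; rewrite !mulr_sumr; apply: eq_bigr => p _.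
  by rewrite !mulr_sumr; apply: eq_bigr => q _; ring.
rewrite cE; apply: (le_trans (cauchy_schwarz2 _ _)).
have uN : Ncol u <= 4 * c ^+ 2 * Ncol y.
  apply: (@le_trans _ _ (\sum_i nrm (\sum_j (map_mx Psi X) i j (xi j)) ^+ 2)).
    by apply: ler_sum => i _; exact: ent_sum_le.
  apply: (le_trans (mxnormP _ _)).
  have -> : \sum_j nrm (xi j) ^+ 2 = Ncol y by apply: eq_bigr => j _; rewrite nrm_evec.
  apply: ler_wpM2r; first exact: Ncol_ge0.
  have -> : 4 * c ^+ 2 = (2 * c) ^+ 2 by ring.
  by rewrite ler_sqr ?nnegrE ?mxnorm_ge0// mulr_ge0// ltW.
by rewrite mulrCA; apply: ler_wpM2l; rewrite ?Ncol_ge0.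
Qed.

(** Transposing the stored second factors back yields operators, and the quadratic bounds become
    column bounds for a^* and b. The final identity is checked on matrix coefficients; outside U
    both sides vanish. *)
Lemma factor_list : exists L : seq (B * B),
  [/\ forall ab, List.In ab L -> compact_op R G ab.1 /\ compact_op R G ab.2,
      col_bound L (fun ab => adjoint ab.1) (2 * c),
      col_bound L snd (2 * c) &
      forall p q, \sum_(ab <- L) ab.1 \oB unitop p q \oB ab.2 = Psi (unitop p q)].
Proof.
have [L [tL N1 N2]] := haagerup_fin c0 Psi_cb_value.
pose h (ab : (I -> I -> C) * (I -> I -> C)) : B * B :=
  (emat ab.1, emat (fun q t => ab.2 t q)).
exists [seq h ab | ab <- L]; split.
- by move=> _ /List.in_map_iff[ab [<- _]]; split; exact: compact_emat.
(* The quadratic bound is used at the conjugate of xi, since the adjoint has conjugate entries. *)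
- move=> xi; rewrite big_map; apply: (@le_trans _ _ (2 * c * \sum_s sq ((xi (ent s))^*))); last first.
    apply: ler_wpM2l; first by rewrite mulr_ge0// ltW.
    by under eq_bigr do rewrite nrm_conj; exact: ent_sum_le.
  apply: (le_trans _ (N1 (fun s => (xi (ent s))^*))); apply: ler_sum => ab _.
  rewrite /= adjoint_emat nrm_emat; apply: ler_sum => p _.
  rewrite -[X in X ^+ 2 <= _]nrm_conj rmorph_sum /=.
  by under eq_bigr do rewrite rmorphM /= conjCK.
- move=> xi; rewrite big_map; apply: (@le_trans _ _ (2 * c * \sum_s sq (xi (ent s)))); last first.
    by apply: ler_wpM2l (ent_sum_le xi); rewrite mulr_ge0// ltW.
  apply: (le_trans _ (N2 (fun s => xi (ent s)))); apply: ler_sum => ab _.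
  by rewrite /= nrm_emat.
- move=> p q; apply/eqP; rewrite -subr_eq0; apply/eqP; apply: mxcoef_eq0 => s t.
  rewrite /mxcoef (bopB_ell2E (\sum_(ab <- _) _) (Psi _)) -!/(mxcoef _ _ _).
  apply/eqP; rewrite subr_eq0; apply/eqP.
  rewrite mxcoef_sum0 big_map Psi_coef.
  under eq_bigr do rewrite mxcoef_sandwich /=.
  have pickE : \sum_(p1 <- U) \sum_(q1 <- U) psi s p1 t q1 * mxcoef (unitop p q : B) p1 q1 =
      (p \in U)%:R * ((q \in U)%:R * psi s p t q).
    rewrite -(sum_fset_pick U p (fun p1 => (q \in U)%:R * psi s p1 t q)).
    apply: eq_bigr => p1 _; rewrite -(sum_fset_pick U q (fun q1 => psi s p1 t q1)) mulr_sumr.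
    by apply: eq_bigr => q1 _; rewrite mxcoef_unitop (eq_sym p1); ring.
  rewrite pickE.
  have [sU|sU] := boolP (s \in U); last first.
    by rewrite mul0r big1// => ab _; rewrite mxcoef_emat_off ?mul0r ?sU.
  have [tU|tU] := boolP (t \in U); last first.
    by rewrite mul0r mulr0 big1// => ab _; rewrite (@mxcoef_emat_off (fun q t => ab.2 t q)) ?mulr0 ?tU ?orbT.
  have [pU|pU] := boolP (p \in U); last first.
    by rewrite mul0r !mulr0 big1// => ab _; rewrite mxcoef_emat_off ?mul0r ?pU ?orbT.
  have [qU|qU] := boolP (q \in U); last first.
    by rewrite mul0r !mulr0 big1// => ab _; rewrite (@mxcoef_emat_off (fun q t => ab.2 t q)) ?mulr0 ?qU.
  rewrite !mul1r; have [a ->] := ent_ex sU; have [b ->] := ent_ex tU.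
  have [d ->] := ent_ex pU; have [e ->] := ent_ex qU.
  rewrite -[RHS]/(th a d b e) (tL a d b e).
  by apply: eq_bigr => ab _; rewrite !mxcoef_emat.
Qed.

End FactorList.

(** * Concatenation of finite factorizations *)

Section Concatenation.
Variables (V : Type) (d : V) (L : nat -> seq V).
Hypothesis L_gt0 : forall k, (0 < size (L k))%N.

Definition flat n := flatten [seq L k | k <- iota 0 n].

(** Nonempty blocks give [flat i.+1] at least i + 1 terms, so the default [d] is never read. *)
Definition entry i := nth d (flat i.+1) i.

Lemma flatS n : flat n.+1 = flat n ++ L n.
Proof. by rewrite /flat -addn1 iotaD map_cat flatten_cat /= cats0. Qed.

Lemma size_flat n : (n <= size (flat n))%N.
Proof.
elim: n => // n IH; rewrite flatS size_cat -addn1; exact: leq_add.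
Qed.

Lemma flat_prefix n m i : (i < size (flat n))%N -> (n <= m)%N ->
  nth d (flat m) i = nth d (flat n) i.
Proof.
move=> hi /subnK <-; elim: (m - n)%N => [//|k IH].
rewrite addSn flatS nth_cat; case: ltnP => [_|h]; first exact: IH.
suff : (size (flat n) <= size (flat (k + n)))%N by move=> /(leq_trans hi)/leq_trans/(_ h); rewrite ltnn.
elim: (k) => // j; rewrite addSn flatS size_cat => /leq_trans; apply; exact: leq_addr.
Qed.

Lemma entryE n i : (i < size (flat n))%N -> entry i = nth d (flat n) i.
Proof.
move=> hi; have [h|/ltnW h] := leqP n i.+1; first exact: flat_prefix.
by rewrite (flat_prefix _ h)//; exact: size_flat.
Qed.

Lemma size_flat_mono m n : (m <= n)%N -> (size (flat m) <= size (flat n))%N.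
Proof.
move=> /subnK <-; elim: (n - m)%N => // k; rewrite addSn flatS size_cat => /leq_trans; apply.
exact: leq_addr.
Qed.

Lemma sum_entry (W : nmodType) (g : V -> W) n :
  \sum_(0 <= i < size (flat n)) g (entry i) = \sum_(0 <= k < n) \sum_(v <- L k) g v.
Proof.
transitivity (\sum_(v <- flat n) g v).
  rewrite (big_nth d); apply: eq_big_nat => i /andP[_ h]; by rewrite (entryE h).
elim: n => [|n IH]; first by rewrite big_nil big_geq.
by rewrite flatS big_cat /= IH big_nat_recr.
Qed.

Lemma entry_forall (P : V -> Prop) : (forall k v, List.In v (L k) -> P v) -> forall i, P (entry i).
Proof.
move=> hP; suff h n i : (i < size (flat n))%N -> P (nth d (flat n) i).
  by move=> i; apply: h; exact: size_flat.
elim: n => // n IH; rewrite flatS size_cat nth_cat => hi.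
case: ltnP => [/IH//|h]; apply: (hP n).
have : (i - size (flat n) < size (L n))%N by rewrite ltn_subLR.
elim: (L n) (i - size (flat n))%N => // v s IHs [|j] /=; first by left.
by move=> hj; right; exact: IHs.
Qed.

(** Indices past the first k0 blocks are covered by whole blocks, and the geometric bounds are
    summed by telescoping 2 K 2^-k. *)
Lemma entry_tail_sum (R : realType) (g : V -> R) (K : R) m n k0 : 0 <= K ->
  (forall v, 0 <= g v) -> (forall k, \sum_(v <- L k) g v <= K * 2^-1 ^+ k) ->
  (size (flat k0) <= m)%N ->
  \sum_(i <- index_iota m n) g (entry i) <= 2 * K * 2^-1 ^+ k0.
Proof.
move=> K0 g0 gK hm; pose p := maxn n k0.
have r0 : 0 <= 2 * K * 2^-1 ^+ k0 :> R by rewrite !mulr_ge0 ?exprn_ge0 ?invr_ge0.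
have [nm|/ltnW mn] := leqP n m; first by rewrite big_geq.
have np : (n <= size (flat p))%N by apply: leq_trans (size_flat p); exact: leq_maxl.
apply: (@le_trans _ _ (\sum_(size (flat k0) <= i < size (flat p)) g (entry i))).
  rewrite [leRHS](big_cat_nat (n := m))//=; last exact: leq_trans mn np.
  rewrite [in leRHS](big_cat_nat (m := m) (n := n) (p := size (flat p)))//=.
  by rewrite addrCA lerDl addr_ge0// sumr_ge0.
have -> : \sum_(size (flat k0) <= i < size (flat p)) g (entry i) =
    \sum_(k0 <= k < p) \sum_(v <- L k) g v.
  have h1 := sum_entry g p.
  rewrite (big_cat_nat (n := size (flat k0)))//= in h1; last by apply: size_flat_mono; exact: leq_maxr.
  rewrite sum_entry [in RHS](big_cat_nat (n := k0))//= in h1; last exact: leq_maxr.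
  exact: addrI h1.
apply: (@le_trans _ _ (\sum_(k0 <= k < p) (- (2 * K * 2^-1 ^+ k.+1) - - (2 * K * 2^-1 ^+ k)))).
  apply: ler_sum => k _; apply: (le_trans (gK k)); rewrite opprK exprS.
  by rewrite le_eqVlt; apply/orP; left; apply/eqP; field.
rewrite telescope_sumr; last exact: leq_maxr.
by rewrite opprK gerDr oppr_le0 !mulr_ge0 ?exprn_ge0 ?invr_ge0.
Qed.

End Concatenation.

Lemma geometric_small (R : realType) (K e : R) : 0 < e -> exists k, K * 2^-1 ^+ k <= e.
Proof.
move=> e0; have [K0|K0] := leP K 0.
  by exists 0%N; rewrite expr0 mulr1 (le_trans K0)// ltW.
have [n hn] : exists n : nat, K / e <= n%:R.
  exists (Num.truncn (K / e)).+1; exact/ltW/truncnS_gt.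
exists n; rewrite exprVn ler_pdivrMr ?exprn_gt0// -ler_pdivrMl// mulrC (le_trans hn)//.
by rewrite -natrX ler_nat ltnW// ltn_expl.
Qed.

Section HaagerupConcatenation.
Variables (R : realType) (G : groupType).
Notation ell := (ell2 G R[i]^o).
Notation B := (B_ell2 R G).

Lemma adjointK (T : B) : adjoint (adjoint T) = T.
Proof. by apply: adjoint_uniq => xi eta; exact: adjointPl. Qed.

Lemma adjoint0 : adjoint (0 : B) = 0.
Proof.
have i0 eta : inner (0 : ell) eta = 0 by have := innerZl 0 0 eta; rewrite scale0r mul0r.
apply: adjoint_uniq => xi eta; transitivity (0 : R[i]); first exact: i0.
symmetry; rewrite inner_conj; exact: etrans (congr1 (@Num.conj _) (i0 xi)) (conjC0 _).
Qed.

Variables (L : nat -> seq (B * B)) (K : R).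
Hypothesis K0 : 0 <= K.

(* Padding by (0, 0) makes every block nonempty. *)
Let Lp k := (0, 0) :: L k.
Let Lp_gt0 k : (0 < size (Lp k))%N. Proof. by []. Qed.
Let ent := entry (0, 0) Lp.

Lemma col_bound_concat (h : B * B -> B) : h (0, 0) = 0 ->
  (forall k, col_bound (L k) h (K * 2^-1 ^+ k)) ->
  tail_small (fun r (c : R) => col_bound r (fun i => h (ent i)) c).
Proof.
move=> h0 hL.
have bnd k0 m n : (size (flat Lp k0) <= m)%N ->
    col_bound (index_iota m n) (fun i => h (ent i)) (2 * K * 2^-1 ^+ k0).
  move=> hm xi; have n0 : 0 <= K * nrm xi ^+ 2 by rewrite mulr_ge0 ?sqr_ge0.
  have hk k : \sum_(v <- Lp k) nrm (h v xi) ^+ 2 <= K * nrm xi ^+ 2 * 2^-1 ^+ k.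
    rewrite big_cons h0 [X in X ^+ 2](@nrm0 R ell) expr0n add0r mulrAC; exact: hL.
  have := entry_tail_sum (0, 0) Lp_gt0 n n0 (fun v => sqr_ge0 (nrm (h v xi))) hk hm.
  by move=> /le_trans; apply; rewrite le_eqVlt; apply/orP; left; apply/eqP; ring.
split; first by exists (2 * K) => [|m n]; [rewrite mulr_ge0|have := bnd 0%N m n; rewrite mulr1; apply].
move=> e e0; have [k0 hk] := geometric_small (2 * K) e0.
exists (size (flat Lp k0)) => m n hm xi; apply: (le_trans (bnd k0 m n hm xi)).
by apply: ler_wpM2r hk; exact: sqr_ge0.
Qed.

Hypothesis L_compact : forall k ab, List.In ab (L k) -> compact_op R G ab.1 /\ compact_op R G ab.2.
Hypothesis L_col1 : forall k, col_bound (L k) (fun ab => adjoint ab.1) (K * 2^-1 ^+ k).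
Hypothesis L_col2 : forall k, col_bound (L k) snd (K * 2^-1 ^+ k).

(** The tail bounds make the full series converge, and its partial sums at the ends of blocks are
    those of the hypothesis, so the two limits agree. *)
Lemma haagerup_concat : exists u : (nat -> B) * (nat -> B),
  haagerup_series (compact_op R G) u /\
  forall x l, tends (fun n => \sum_(0 <= k < n) \sum_(ab <- L k) ab.1 \oB x \oB ab.2) l ->
    Gamma u x = l.
Proof.
pose u : (nat -> B) * (nat -> B) := (fun i => (ent i).1, fun i => (ent i).2).
have cpt i : compact_op R G (ent i).1 /\ compact_op R G (ent i).2.
  apply: (entry_forall (0, 0) Lp_gt0 (P := fun v => compact_op R G v.1 /\ compact_op R G v.2)).
  move=> k v /= [<-|]; last exact: L_compact.
  by have := @compact_op_unitop R G 0 1%g 1%g; rewrite scale0r.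
have hu : haagerup_series (compact_op R G) u.
  split=> [i|i||]; [exact: (cpt i).1|exact: (cpt i).2| |].
    apply: (series_cvg_of_tail (@B_complete R G)).
    apply: (tail_small_imp _ (col_bound_concat (h := fun ab => adjoint ab.1) adjoint0 L_col1)).
    move=> r c c0 hr; have := nrm_of_col_bound c0 hr.
    by under eq_bigr do rewrite adjointK.
  apply: (series_cvg_of_tail (@B_complete R G)).
  apply: (tail_small_imp _ (col_bound_concat (h := snd) erefl L_col2)) => r c.
  exact: nrm_of_col_bound.
exists u; split=> // x l hl; have [ta tb] := haagerup_tails hu.
have hg := gamma_tends ta tb x.
apply: tends_uniq hl => e e0; have [N hN] := hg e e0; exists N => n Nn.
have := hN (size (flat Lp n)) (leq_trans Nn (size_flat Lp_gt0 n)).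
rewrite /gamma_partial (sum_entry (0, 0) Lp_gt0 (fun ab : B * B => ab.1 \oB x \oB ab.2)).
suff -> : \sum_(0 <= k < n) \sum_(v <- Lp k) v.1 \oB x \oB v.2 =
  \sum_(0 <= k < n) \sum_(ab <- L k) ab.1 \oB x \oB ab.2 by [].
apply: eq_bigr => k _; rewrite big_cons.
have c00 : (0 : B) \oB x \oB (0 : B) = 0 by apply: (@bop_eq R ell ell) => xi.
exact: etrans (congr1 (fun y => y + _) c00) (add0r _).
Qed.

End HaagerupConcatenation.

(** * Construction of the Haagerup tensor *)

Section Necessity.
Variables (R : realType) (G : groupType).
Notation ell := (ell2 G R[i]^o).
Notation H := (ell2 G ell).
Notation B := (B_ell2 R G).
Notation C0 := (c0_mulops R G).
Notation act := (c0_act R G).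
Notation X := (crossed_product C0 act).
Notation lam := (lambda R[i]^o).
Notation mdelta p := (mulop (fun s => (s == p)%:R)).

Lemma C0_map_eq (f g : B -> B) (M N : R) :
  linear_on C0 f -> linear_on C0 g ->
  (forall x, C0 x -> nrm (f x) <= M * nrm x) ->
  (forall x, C0 x -> nrm (g x) <= N * nrm x) ->
  (forall p, f (mdelta p) = g (mdelta p)) ->
  forall x, C0 x -> f x = g x.
Proof.
move=> fl gl fM gN fg x [a ca <-].
pose h y := f y - g y.
have hl : linear_on C0 h.
  by move=> c y z hy hz; rewrite /h fl// gl// scalerBr opprD addrACA.
have h0 : h 0 = 0.
  have := hl 1 0 0 (C0_0 R G) (C0_0 R G); rewrite scaler0 addr0 scale1r => /eqP.
  by rewrite -subr_eq0 opprD addrA subrr sub0r oppr_eq0 => /eqP.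
have Ca : C0 (mulop a) by exists a.
have hsum0 (A : {fset G}) : C0 (\sum_(p <- A) a p *: mdelta p) /\
    h (\sum_(p <- A) a p *: mdelta p) = 0.
  elim: (enum_fset A) => [|p r [IH1 IH2]]; first by rewrite big_nil; split=> //; exact: C0_0.
  rewrite big_cons; split; first exact: c0_mulops_lin (C0_mdelta R p) IH1.
  rewrite (hl (a p) (mdelta p) _ (C0_mdelta R p) IH1) IH2 addr0.
  by rewrite /h fg subrr scaler0.
apply/eqP; rewrite -subr_eq0; apply/eqP; rewrite -/(h (mulop a)).
apply: nrm_small_eq0 => e e0.
pose K := `|M| + `|N| + 1; have K0 : 0 < K by rewrite ltr_wpDl// addr_ge0.
have [A hA] := mulop_fin_approx ca (divr_gt0 e0 K0).
set y := \sum_(p <- A) _ in hA; have [Cy hy] := hsum0 A.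
have Cd : C0 (mulop a - y).
  by have := c0_mulops_lin (-1) Cy Ca; rewrite scaleN1r addrC.
have -> : h (mulop a) = h (mulop a - y).
  have := hl (-1) y (mulop a) Cy Ca; rewrite hy scaler0 add0r scaleN1r addrC => <-.
  by rewrite addrC.
apply: (@le_trans _ _ (K * nrm (mulop a - y))); last by rewrite mulrC -ler_pdivlMr.
apply: (le_trans (nrmB _ _)); apply: (le_trans (lerD (fM _ Cd) (gN _ Cd))).
rewrite -mulrDl; apply: ler_wpM2r; first exact: nrm_ge0.
by rewrite /K -[leLHS]addr0; apply: lerD => //; apply: lerD; exact: ler_norm.
Qed.

Lemma supported_unitop p q : supported_on [fset p; q]%fset (unitop p q : B).
Proof.
apply/eqP; rewrite -subr_eq0; apply/eqP; apply: mxcoef_eq0 => s t.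
rewrite /mxcoef (bopB_ell2E (unitop p q) (\sum_(_ <- _) _)) -!/(mxcoef _ _ _).
rewrite mxcoef_block mxcoef_unitop /mxcoef (unitopE p q (delta R t) s) deltaE !inE (eq_sym q).
have [_|_] := eqVneq s p; last by rewrite !mul0r !mulr0 subrr.
by have [_|_] := eqVneq t q; rewrite ?orbT !mul1r ?mulr0 subrr.
Qed.

(** Consecutive approximants differ by at most 2 N 2^-n in completely bounded norm, so each
    difference factors with bounds 4 N 2^-n. On matrix units the differences telescope to D_n
    because D_0 vanishes there. *)
Lemma haagerup_of_approx (f : B -> B) (D : nat -> B -> B) (N : R) : 0 < N ->
  (forall p q, D 0%N (unitop p q) = 0) ->
  (forall n m (x : 'M[B]_m) U, (forall i j, supported_on U (x i j)) ->
    mxnorm (map_mx (fun z => f z - D n z) x) <= N * 2^-1 ^+ n * mxnorm x) ->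
  (forall n c, 0 < c ->
    (forall m (x : 'M[B]_m) U, (forall i j, supported_on U (x i j)) ->
      mxnorm (map_mx (fun z => D n.+1 z - D n z) x) <= c * mxnorm x) ->
    exists L : seq (B * B),
    [/\ forall ab, List.In ab L -> compact_op R G ab.1 /\ compact_op R G ab.2,
        col_bound L (fun ab => adjoint ab.1) (2 * c),
        col_bound L snd (2 * c) &
        forall p q, \sum_(ab <- L) ab.1 \oB unitop p q \oB ab.2 =
          D n.+1 (unitop p q) - D n (unitop p q)]) ->
  exists u : (nat -> B) * (nat -> B), haagerup_series (compact_op R G) u /\
    forall p q, Gamma u (unitop p q) = f (unitop p q).
Proof.
move=> N0 D0 hf hfac.
have half0 : 0 <= 2^-1 :> R by lra.
have half1 : 2^-1 <= 1 :> R by lra.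
have e0 n : 0 < N * 2^-1 ^+ n by rewrite mulr_gt0// exprn_gt0// invr_gt0.
have hD n m (x : 'M[B]_m) U : (forall i j, supported_on U (x i j)) ->
    mxnorm (map_mx (fun z => D n.+1 z - D n z) x) <= 2 * (N * 2^-1 ^+ n) * mxnorm x.
  move=> hx; have h1 := hf n m x U hx; have h2 := hf n.+1 m x U hx.
  have -> : map_mx (fun z => D n.+1 z - D n z) x =
      map_mx (fun z => f z - D n z) x - map_mx (fun z => f z - D n.+1 z) x.
    apply/matrixP => i j; rewrite mxE; transitivity
        (f (x i j) - D n (x i j) - (f (x i j) - D n.+1 (x i j))).
      by rewrite opprB [RHS]addrC subrKA.
    by rewrite [RHS]mxE [X in _ = X + _]mxE [X in _ = _ + X]mxE [X in _ = _ - X]mxE.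
  apply: (le_trans (mxnormB _ _)); apply: (le_trans (lerD h1 h2)).
  rewrite -mulrDl; apply: ler_wpM2r; first exact: mxnorm_ge0.
  rewrite mulr_natl mulr2n lerD2l; apply: ler_wpM2l; first exact: ltW.
  rewrite exprS; apply: ler_piMl half1; exact: exprn_ge0.
have /choice[L hL] n := hfac n _ (mulr_gt0 (ltr0Sn R 1) (e0 n)) (hD n).
have K0 : 0 <= 2 * (2 * N) by rewrite !mulr_ge0// ltW.
have KE n : 2 * (2 * (N * 2^-1 ^+ n)) = 2 * (2 * N) * 2^-1 ^+ n by rewrite !mulrA.
have [|n|n|u [hu hG]] := haagerup_concat K0 (L := L).
- by move=> k ab; have [h _ _ _] := hL k; exact: h.
- by have [_ h _ _] := hL n; rewrite -KE.
- by have [_ _ h _] := hL n; rewrite -KE.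
exists u; split=> // p q; apply: hG.
have sE n : \sum_(0 <= k < n) \sum_(ab <- L k) ab.1 \oB unitop p q \oB ab.2 = D n (unitop p q).
  rewrite (eq_bigr (fun k => D k.+1 (unitop p q) - D k (unitop p q))); last first.
    by move=> k _; have [_ _ _ h] := hL k; exact: h.
  by rewrite (telescope_sumr (fun k => D k (unitop p q)))// D0 subr0.
apply: (tends_ext (fun n => esym (sE n))) => e e1.
have [k hk] := geometric_small N e1; exists k => n kn.
have cb : cb_bound (@supported_on R G [fset p; q]%fset) (fun z => f z - D n z) (N * 2^-1 ^+ n).
  by move=> m x hx; exact: hf hx.
rewrite nrmBC; apply: (le_trans (cb_bound_nrm (ltW (e0 n)) cb (supported_unitop p q))).
apply: (le_trans _ hk); apply: (@le_trans _ _ (N * 2^-1 ^+ n)).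
  by apply: ler_piMr; [exact: ltW|exact: nrm_unitop].
apply: ler_wpM2l; first exact: ltW.
exact: ler_wiXn2l half0 half1 _ _ kn.
Qed.

Variable F : G -> B -> B.
Hypothesis F_CB : forall s : G, completely_bounded C0 C0 (F s).
Variable S : bop H H -> bop H H.
Hypothesis S_ext : extends_SF C0 act F S.
Hypothesis S_cc : completely_compact X X S.
Notation Phi := (Phi S).
Notation Dop := (Dop S).
Notation theta := (theta S).

(** The kernel of [Dop] with indicator functions, so that all four indices may range over a single
    finite set. *)
Let dpsi (T T' : {fset G}) (s p t q : G) : R[i] :=
  (s \in T)%:R * (t \in T)%:R * (p \in T')%:R * (q == partner s t p)%:R * theta s p t q.

Lemma Dop_coef (T T' U : {fset G}) : {subset T <= U} -> {subset T' <= U} ->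
  (forall s t p, s \in T -> t \in T -> p \in T' -> partner s t p \in U) ->
  forall z s t, mxcoef (Dop T T' z) s t =
    (s \in U)%:R * ((t \in U)%:R * \sum_(p <- U) \sum_(q <- U) dpsi T T' s p t q * mxcoef z p q).
Proof.
move=> TU T'U pU z s t; rewrite mxcoef_block.
have [sT|sT] := boolP (s \in T); last first.
  rewrite mul0r big1 ?mulr0// => p _; rewrite big1// => q _.
  by rewrite /dpsi (negbTE sT) !mul0r.
have [tT|tT] := boolP (t \in T); last first.
  rewrite mul0r mulr0 big1 ?mulr0// => p _; rewrite big1// => q _.
  by rewrite /dpsi (negbTE tT) mulr0 !mul0r.
rewrite (TU s sT) (TU t tT) !mul1r /Dcoef.
have e p : (p \in T')%:R * (theta s p t (partner s t p) * mxcoef z p (partner s t p)) =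
    \sum_(q <- U) dpsi T T' s p t q * mxcoef z p q.
  have [pT|pT] := boolP (p \in T'); last first.
    by rewrite mul0r big1// => q _; rewrite /dpsi (negbTE pT) mulr0 !mul0r.
  transitivity (\sum_(q <- U) theta s p t q * mxcoef z p q * (q == partner s t p)%:R).
    have h := pU s t p sT tT pT.
    rewrite (bigD1_seq _ h (fset_uniq U)) /= eqxx mulr1 mul1r big1 ?addr0// => q /negbTE ->.
    exact: mulr0.
  by apply: eq_bigr => q _; rewrite /dpsi sT tT pT !mul1r mulrC mulrA.
rewrite -(eq_bigr _ (fun p _ => e p)).
rewrite -(sum_fset_nat (A := T') (D := U)); last first.
- by move=> p /negbTE ->; rewrite mul0r.
- exact/fsubsetP.
by apply: eq_big_seq => p ->; rewrite mul1r.
Qed.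

Lemma Dop_diff_factor (T1 T1' T2 T2' : {fset G}) (c : R) : 0 < c ->
  (forall m (x : 'M[B]_m) U, (forall i j, supported_on U (x i j)) ->
    mxnorm (map_mx (fun z => Dop T2 T2' z - Dop T1 T1' z) x) <= c * mxnorm x) ->
  exists L : seq (B * B),
  [/\ forall ab, List.In ab L -> compact_op R G ab.1 /\ compact_op R G ab.2,
      col_bound L (fun ab => adjoint ab.1) (2 * c),
      col_bound L snd (2 * c) &
      forall p q, \sum_(ab <- L) ab.1 \oB unitop p q \oB ab.2 =
        Dop T2 T2' (unitop p q) - Dop T1 T1' (unitop p q)].
Proof.
move=> c0 hc; pose W := (T1 `|` T1' `|` (T2 `|` T2'))%fset.
(* The columns [partner s t p] must lie in U, or the sum over q in U would miss the only nonzero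
   term. *)
pose U := (W `|` \bigcup_(s <- W) \bigcup_(t <- W) [fset partner s t p | p in W])%fset.
have sub (A : {fset G}) : {subset A <= W} -> {subset A <= U}.
  by move=> AW p /AW pW; rewrite inE pW.
have par (A A' : {fset G}) : {subset A <= W} -> {subset A' <= W} -> forall s t p,
    s \in A -> t \in A -> p \in A' -> partner s t p \in U.
  move=> AW A'W s t p /AW sW /AW tW /A'W pW; rewrite inE; apply/orP; right.
  apply/bigfcupP; exists s; first by rewrite sW.
  by apply/bigfcupP; exists t; [rewrite tW|exact: in_imfset].
have W1 : {subset T1 <= W} by move=> p h; rewrite !inE h.
have W1' : {subset T1' <= W} by move=> p h; rewrite !inE h !orbT.
have W2 : {subset T2 <= W} by move=> p h; rewrite !inE h !orbT.
have W2' : {subset T2' <= W} by move=> p h; rewrite !inE h !orbT.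
pose Psi z := Dop T2 T2' z - Dop T1 T1' z.
pose psi s p t q := dpsi T2 T2' s p t q - dpsi T1 T1' s p t q.
have Psi_coef z s t : mxcoef (Psi z) s t = (s \in U)%:R * ((t \in U)%:R *
    \sum_(p <- U) \sum_(q <- U) psi s p t q * mxcoef z p q).
  rewrite /mxcoef (bopB_ell2E (Dop T2 T2' z) (Dop T1 T1' z)) -!/(mxcoef _ _ _).
  rewrite (Dop_coef (sub _ W2) (sub _ W2') (par _ _ W2 W2')).
  rewrite (Dop_coef (sub _ W1) (sub _ W1') (par _ _ W1 W1')).
  rewrite -!mulrBr -sumrB; congr (_ * (_ * _)); apply: eq_bigr => p _.
  by rewrite -sumrB; apply: eq_bigr => q _; rewrite -mulrBl.
exact: (factor_list c0 Psi_coef (fun m x => hc m x U)).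
Qed.

Lemma Phi_factor : exists u : (nat -> B) * (nat -> B),
  haagerup_series (compact_op R G) u /\
  forall p q, Gamma u (unitop p q) = Phi (unitop p q).
Proof.
have [M M0 hM] := Phi_mxnorm S_cc; pose N := M + 1.
have N0 : 0 < N by rewrite ltr_wpDl.
have /choice[A hA] n : exists A : {fset G} * {fset G},
    forall m (x : 'M[B]_m) U, (forall i j, supported_on U (x i j)) ->
      mxnorm (map_mx (fun z => Phi z - Dop A.1 A.2 z) x) <= N * 2^-1 ^+ n.+1 * mxnorm x.
  have en : 0 < N * 2^-1 ^+ n.+1 by rewrite mulr_gt0// exprn_gt0// invr_gt0.
  by have [T [T' h]] := Phi_trunc F_CB S_ext S_cc en; exists (T, T').
(* Shifted by one so that D_0 = 0, for which the required estimate is the bound M <= N of Phi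
   itself. *)
pose A0 n := if n is k.+1 then A k else (fset0, fset0).
apply: (haagerup_of_approx (D := fun n => Dop (A0 n).1 (A0 n).2) N0) => [p q|[|n]|n c c0].
- exact: Dop0.
- move=> m x U hx.
  have -> : map_mx (fun z => Phi z - Dop (A0 0%N).1 (A0 0%N).2 z) x = map_mx Phi x.
    by apply/matrixP => i j; rewrite mxE [RHS]mxE Dop0 subr0.
  apply: (le_trans (hM m x (fun i j => supported_matrixlike (hx i j)))).
  by apply: ler_wpM2r; rewrite ?mxnorm_ge0// expr0 mulr1 lerDl.
- exact: hA.
- exact: Dop_diff_factor.
Qed.

(** Gamma_u is known to agree with Phi on matrix units. As Gamma_{u_s} at the point mass of p is
    Gamma_u(e_{p,s^-1 p}) lambda_s^-1, this gives F(s) on point masses, and density of their span in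
    C with boundedness gives the rest. *)
Lemma necessity : exists u : (nat -> B) * (nat -> B),
  haagerup_series (compact_op R G) u /\
  forall (a : B) (s : G), C0 a -> Gamma (haagerup_conj s u) a = F s a.
Proof.
have [[a b] [hu hG]] := Phi_factor; exists (a, b); split=> // x s.
have [ha hb] := haagerup_tails hu; have [_ Fl [c hc]] := F_CB s.
have [M M0 hM] := gamma_mxnorm ha hb.
have cbG : cb_bound setT (Gamma (a, b)) M by move=> m y _; exact: hM.
have cE y : Gamma (haagerup_conj s (a, b)) y = Gamma (a, b) (y \oB lam s) \oB lam s^-1%g.
  exact: gamma_conj.
have cF : cb_bound C0 (F s) `|c|.
  move=> m y hy; apply: (le_trans (hc m y hy)).
  by apply: ler_wpM2r; [exact: mxnorm_ge0|exact: ler_norm].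
move: x; apply: (@C0_map_eq _ (F s) M `|c|) => //.
- move=> k y z _ _; rewrite !cE compDl compZl.
  rewrite (gamma_linear ha hb k (y \oB lam s) (z \oB lam s)).
  by rewrite compDl compZl.
- move=> y _; rewrite cE; apply: (le_trans (nrm_comp _ _)).
  apply: (@le_trans _ _ (nrm (Gamma (a, b) (y \oB lam s)))).
    by apply: ler_piMr; [exact: nrm_ge0|exact: nrm_lambda].
  apply: (le_trans (cb_bound_nrm M0 cbG (I : setT (y \oB lam s)))).
  apply: (ler_wpM2l M0); apply: (le_trans (nrm_comp _ _)).
  by apply: ler_piMr; [exact: nrm_ge0|exact: nrm_lambda].
- by move=> y Cy; exact: cb_bound_nrm (normr_ge0 c) cF Cy.
move=> p; rewrite cE mdelta_lam hG (Phi_unitop F_CB S_ext).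
have -> : (p * (s^-1 * p)^-1)%g = s by apply: (mulIg (s^-1 * p)%g); rewrite mulgVK mulVKg.
exact: lambdaKV.
Qed.

End Necessity.

Theorem theorem5p3 (R : realType) (G : groupType)
    (F : G -> B_ell2 R G -> B_ell2 R G)
    (F_CB : forall s : G,
      completely_bounded (c0_mulops R G) (c0_mulops R G) (F s)) :
  cc_herz_schur_multiplier (c0_mulops R G) (c0_act R G) F <->
  exists u : (nat -> B_ell2 R G) * (nat -> B_ell2 R G),
    haagerup_series (compact_op R G) u /\
    forall (a : B_ell2 R G) (s : G), c0_mulops R G a ->
      Gamma (haagerup_conj s u) a = F s a.
Proof.
split=> [[_ [S [S_ext S_cc]]]|[[a b] [hu hF]]]; first exact: (necessity F_CB S_ext S_cc).
exact: (sufficiency F_CB hu hF).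
Qed.
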